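(* Let $l \geq 1$ be an integer. There exists a constant $c=c(l)$ (independent of $X$) such that for all $\varepsilon > 0$ and all $X\ge 1$, \[ \sum_{1\le n\leq X} r(n)r(n+l) = cX+O_{\varepsilon}\left(X^{\frac{4}{5}}(X+l)^{\frac{3}{20}+\varepsilon}\right), \] with implied constant depending only on $\varepsilon$.
   Context: $r(n)$ denotes the number of representations of the integer $n$ as a sum of two squares, i.e. $r(n)=\#\{(x,y)\in\mathbf{Z}^2 : x^2+y^2=n\}$. *)

(* Defs.v *)
From HB Require Import structures.
From mathcomp Require Import all_boot all_order all_algebra finmap.
From mathcomp Require Import all_classical all_reals all_analysis.
Set Implicit Arguments.
Unset Strict Implicit.
Unset Printing Implicit Defensive.
Import Order.TTheory GRing.Theory Num.Theory.
Local Open Scope classical_set_scope.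
Local Open Scope ring_scope.

Definition two_squares (n : int) : set (int * int) :=
  [set p | p.1 ^+ 2 + p.2 ^+ 2 = n].

(* [fset_set] sends infinite sets to the empty finite set; this lemma shows
   that the junk value never occurs in [r] below. *)
Lemma finite_two_squares (n : int) : finite_set (two_squares n).
Proof.
have bnd (a b : int) : a ^+ 2 + b ^+ 2 = n -> (`|a| < `|n|.+1)%N.
  move=> ab; rewrite ltnS -lez_nat !abszE.
  have [->|a0] := eqVneq a 0; first by rewrite normr0.
  apply: (@le_trans _ _ (`|a| ^+ 2)).
    by rewrite expr2 ler_peMl// -gtz0_ge1 normr_gt0.
  rewrite real_normK ?num_real// -ab (le_trans _ (ler_norm _))//.
  by rewrite lerDl sqr_ge0.
pose I := [set k : int | (`|k| < `|n|.+1)%N].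
have finI : finite_set I.
  apply: (@sub_finite_set _ _ ((Posz @` `I_(`|n|.+1)) `|`
                               ((fun k => - Posz k) @` `I_(`|n|.+1)))).
    move=> k kn; have [k0|k0] := leP 0 k.
      by left; exists `|k|%N => //; rewrite gez0_abs.
    by right; exists `|k|%N => //; rewrite ltz0_abs// opprK.
  by rewrite finite_setU; split; apply: finite_image; exact: finite_II.
apply: (sub_finite_set _ (finite_setX finI finI)) => -[a b] /= ab.
by split; [exact: bnd ab | apply: (bnd b a); rewrite addrC].
Qed.

Definition r (n : int) : nat := #|` fset_set (two_squares n) |%fset.

(* Main.v *)
(* Counting Gaussian integers gives r(n) = 4 sigma(n) with sigma the twisted
   divisor sum, and pairing d with its codivisor gives, up to a contribution of
   n = 2^c d^2, r(n) = 8 rho(n), where rho(n) sums chi d over n = 2^c d e with d < e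
   and d = e modulo 4. Hence r(n) r(n + l) counts, with weight chi d chi x, the
   solutions of 2^c d e + l = 2^b x y. For fixed b, c, d and g = gcd(d, x), with
   x = g x', the congruence reads y = A / x' modulo q for an A which does not depend
   on x', so the count is a length divided by q plus sawtooth functions of
   (W / x' - A / x') / q.

   The sawtooth is expanded in a Fourier series smoothed at scale eta. The
   exponential sums over x' are completed modulo q: the complete sums are
   (twisted) Kloosterman sums, for which the elementary fourth moment bound suffices
   because only averages over the frequency occur, and the remaining oscillatory
   sums are bounded by the Kusmin-Landau inequality. With
   eta = H / (sqrt (X + l) d) and H = X^(4/5) (X + l)^(3/20) every contribution is
   at most H / d up to divisor functions, provided X + l <= X^(4/3); otherwise H >= X
   and there is nothing to prove.

   The main terms add up to the partial sums over n <= X of a singular series whose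
   tail at n is O(n^(-1/2)), by cancellation in chi. So the means of r(n) r(n + l)
   over n <= X and over n <= Y differ by an admissible amount for X <= Y <= 2 X, and
   the constant is the limit of these means. *)
Require Import Defs.
From mathcomp Require Import all_boot all_order all_algebra all_solvable all_field finmap.
From mathcomp Require Import all_classical all_reals all_analysis.
From mathcomp Require Import complex ring lra zify.
Import Order.TTheory GRing.Theory Num.Theory numFieldNormedType.Exports.
Set Implicit Arguments.
Unset Strict Implicit.
Unset Printing Implicit Defensive.
Local Open Scope ring_scope.

(* [zify] is slow in contexts with many real hypotheses. *)
Ltac nlia := repeat match goal with H : ?P |- _ => match P with
  | is_true (leq _ _) => fail 1 | is_true (andb _ _) => fail 1
  | is_true (negb (@eq_op nat _ _)) => fail 1 | is_true (negb (@eq_op (Datatypes_nat__canonical__eqtype_Equality) _ _)) => fail 1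
  | @eq nat _ _ => fail 1 | nat => fail 1 | _ => clear H end end; lia.

(** * Exponential sums *)

Section ExponentialSums.
Variable R : realType.
Notation C := (complex R).

(** All losses beyond powers of X and X + l pass through one parameter [th], which dominates the
    divisor function, the harmonic sums and the number of exponents of 2 up to a fixed multiple of X
    + l. Its ninth power occurs, so the divisor bound is taken with epsilon / 9; this is why epsilon
    sits on X + l and why the implied constant is uniform in l. The exponents of H are tied to the
    border X + l = X^(4/3). The stationary phase terms ask for H^5 >= X^3 (X + l)^(3/2) and the
    smoothing for H^3 >= X (X + l)^(3/2); at the border both become H >= X, which is the trivial
    bound, and below it H satisfies both. No infinite series is handled. The sawtooth is sampled on
    a finite cyclic group, so that its Fourier expansion is a finite identity. The singular series
    is truncated and never evaluated: the means over n <= X and n <= Y are compared with the same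
    truncation, and only its variation with n matters. The constant then exists by a Cauchy
    argument, and it has to be fixed before epsilon. *)

Definition nm (z : C) : R := ComplexField.Normc.normc z.

Lemma nmM z w : nm (z * w) = nm z * nm w.
Proof. exact: ComplexField.Normc.normcM. Qed.
Lemma nmD z w : nm (z + w) <= nm z + nm w.
Proof. exact: le_normcD. Qed.
Lemma nmN z : nm (- z) = nm z.
Proof. exact: normcN. Qed.
Lemma nm0 : nm 0 = 0.
Proof. exact: ComplexField.Normc.normc0. Qed.
Lemma nm1 : nm 1 = 1.
Proof. exact: ComplexField.Normc.normc1. Qed.
Lemma nm_ge0 z : 0 <= nm z.
Proof. by case: z => a b; exact: sqrtr_ge0. Qed.
Lemma nm_real (x : R) : nm x%:C%C = `|x|.
Proof. by rewrite /nm /= expr0n addr0 sqrtr_sqr. Qed.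
Lemma nm_sum (I : Type) (s : seq I) (P : pred I) (F : I -> C) :
  nm (\sum_(i <- s | P i) F i) <= \sum_(i <- s | P i) nm (F i).
Proof.
elim/big_rec2: _ => [|i y x _ yx]; first by rewrite nm0.
by apply: le_trans (nmD _ _) _; rewrite lerD2l.
Qed.

Definition e (t : R) : C := Complex (cos (2 * pi * t)) (sin (2 * pi * t)).

Lemma e0 : e 0 = 1.
Proof. by rewrite /e mulr0 cos0 sin0. Qed.
Lemma eD (s t : R) : e (s + t) = e s * e t.
Proof. by rewrite /e mulrDr cosD sinD; congr Complex; rewrite addrC mulrC. Qed.
Lemma nm_e (t : R) : nm (e t) = 1.
Proof. by rewrite /nm /= cos2Dsin2 sqrtr1. Qed.
Lemma e1 : e 1 = 1.
Proof. by rewrite /e mulr1 mulr_natl cos2pi sin2pi. Qed.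
Lemma e_nat (n : nat) : e n%:R = 1.
Proof. by elim: n => [|n IH]; rewrite ?e0// -natr1 eD IH e1 mulr1. Qed.
Lemma eN (t : R) : e (- t) * e t = 1.
Proof. by rewrite -eD addNr e0. Qed.
Lemma e_int (n : int) : e n%:~R = 1.
Proof.
case: n => n; first exact: e_nat.
by have := eN n.+1%:R; rewrite e_nat mulr1 NegzE mulrNz.
Qed.

(** With [y = x / 2], the double angle formula and the mean value theorem give sin x = x cos y cos c
    for some c in [0, y]. Both cosines are at least cos y, whose square is at least 1/2 because cos
    x is nonnegative. *)
Lemma sin_lower (x : R) : 0 <= x <= pi / 2 -> x <= 2 * sin x.
Proof.
move=> /andP[x0 xpi].
set y := x / 2.
have pi2 := pi_ge2 R.
have [->|xn0] := eqVneq x 0; first by rewrite sin0 mulr0.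
have xp : 0 < x by rewrite lt_neqAle eq_sym xn0.
have yp : 0 < y by rewrite divr_gt0.
have [|c cI E] := @MVT_segment R sin cos 0 y (ltW yp).
  by apply: continuous_subspaceT => z; exact: continuous_sin.
move: E; rewrite sin0 !subr0 => E.
move: cI; rewrite in_itv/= => /andP[c0 cy].
have cyy : cos y <= cos c.
  have [->//|ne] := eqVneq c y.
  have cy' : c < y by rewrite lt_neqAle ne.
  have cI : c \in `[0, pi] by rewrite in_itv/=; apply/andP; split; rewrite /y in cy; lra.
  have yI : y \in `[0, pi] by rewrite in_itv/=; apply/andP; split; rewrite /y; lra.
  by apply/ltW; rewrite ltr_cos.
have c2 : cos y ^+ 2 >= 1/2.
  have := @cos_mulr2n R y; have -> : y *+ 2 = x by rewrite mulr2n /y; field.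
  have : 0 <= cos x by apply: cos_ge0_pihalf; apply/andP; split; lra.
  rewrite mulr2n; lra.
have cp : 0 <= cos y by apply: cos_ge0_pihalf; rewrite /y; apply/andP; split; lra.
have D : sin x = 2 * (cos y * sin y).
  have xy : x = y + y by rewrite /y; field.
  by rewrite xy sinD; ring.
rewrite D E.
have -> : 2 * (2 * (cos y * (cos c * y))) = 2 * x * (cos y * cos c) by rewrite /y; field.
have cc : cos y * cos y <= cos y * cos c by rewrite ler_wpM2l.
have P : 1 <= 2 * (cos y * cos c) by rewrite expr2 in c2; lra.
by rewrite mulrAC ler_peMl.
Qed.

Lemma sinpi_lower (t : R) : 0 <= t <= 1 -> Num.min t (1 - t) <= sin (pi * t).
Proof.
move=> /andP[t0 t1].
have pi2 := pi_ge2 R.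
have H (s : R) : 0 <= s -> s <= 1/2 -> s <= sin (pi * s).
  move=> s0 s1; have : pi * s <= 2 * sin (pi * s).
    by apply: sin_lower; apply/andP; split; nra.
  nra.
have [tl|tl] := leP t (1 - t).
  by apply: H => //; lra.
have -> : sin (pi * t) = sin (pi * (1 - t)).
  by rewrite mulrBr mulr1 sinB sinpi cospi mul0r sub0r mulN1r opprK.
by apply: H; lra.
Qed.

Definition cot (t : R) := cos (pi * t) / sin (pi * t).

Lemma one_sub_e (t : R) :
  1 - e t = Complex (2 * sin (pi * t) ^+ 2) (- (2 * sin (pi * t) * cos (pi * t))).
Proof.
have E : 2 * pi * t = (pi * t) *+ 2 by rewrite mulr2n; ring.
rewrite /e E cos_mulr2n sin_mulr2n.
have := cos2Dsin2 (pi * t).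
set a := cos _; set b := sin _ => ab.
have -> : (1 : C) = Complex 1 0 by [].
rewrite -[_ - _]/(Complex _ _); congr Complex; rewrite !mulr2n; last by ring.
by rewrite expr2 in ab *; lra.
Qed.

Lemma nm_one_sub_e (t : R) : nm (1 - e t) = 2 * `|sin (pi * t)|.
Proof.
rewrite one_sub_e /nm /=.
have := cos2Dsin2 (pi * t).
set a := cos _; set b := sin _ => ab.
have -> : (2 * b ^+ 2) ^+ 2 + (- (2 * b * a)) ^+ 2 = (2 * b) ^+ 2 * (a ^+ 2 + b ^+ 2) by ring.
by rewrite ab mulr1 sqrtr_sqr normrM ger0_norm.
Qed.

(** This is [1 / (1 - e t)] when [sin (pi * t)] is nonzero. In Cartesian form only the imaginary
    part varies with [t], so its variation is that of a cotangent. *)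
Definition kern (t : R) : C := Complex (1 / 2) (cot t / 2).

Lemma kernE (t : R) : sin (pi * t) != 0 -> kern t * e t = kern t - 1.
Proof.
move=> s0.
suff : kern t * (1 - e t) = 1 by rewrite mulrBr mulr1 => /eqP; rewrite subr_eq => /eqP {2}->; rewrite [1 + _]addrC addrK.
rewrite one_sub_e /kern /cot.
have := cos2Dsin2 (pi * t).
move: s0; set a := cos _; set b := sin _ => s0 ab.
rewrite -[_ * _]/(Complex _ _); have -> : (1 : C) = Complex 1 0 by [].
congr Complex; last by field.
by rewrite -[RHS]ab; field.
Qed.

Lemma nm_kern (t : R) : 0 < sin (pi * t) -> nm (kern t) = 1 / (2 * sin (pi * t)).
Proof.
move=> s0; rewrite /nm /= /cot.
have := cos2Dsin2 (pi * t).
move: s0; set a := cos _; set b := sin _ => s0 ab.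
have -> : (1 / 2) ^+ 2 + (a / b / 2) ^+ 2 = (1 / (2 * b)) ^+ 2.
  have -> : (1 / 2) ^+ 2 + (a / b / 2) ^+ 2 = (a ^+ 2 + b ^+ 2) / (2 * b) ^+ 2
    by field; rewrite gt_eqF.
  by rewrite ab; field; rewrite gt_eqF.
by rewrite sqrtr_sqr ger0_norm// divr_ge0// mulr_ge0// ltW.
Qed.

Lemma cot_mono (s t : R) : 0 < s -> s <= t -> t < 1 -> cot t <= cot s.
Proof.
move=> s0 st t1.
have pi0 := pi_gt0 R.
have ss : 0 < sin (pi * s) by apply: sin_gt0_pi; apply/andP; split; nra.
have tt : 0 < sin (pi * t) by apply: sin_gt0_pi; apply/andP; split; nra.
rewrite /cot ler_pdivrMr// mulrAC ler_pdivlMr// -subr_ge0.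
have -> : cos (pi * s) * sin (pi * t) - cos (pi * t) * sin (pi * s) = sin (pi * (t - s)).
  by rewrite mulrBr sinB; ring.
by apply: sin_ge0_pi; apply/andP; split; nra.
Qed.

Lemma cot_bound (D t : R) : 0 < D -> D <= t -> t <= 1 - D -> `|cot t| <= 1 / D /\
   nm (kern t) <= 1 / (2 * D) /\ 0 < sin (pi * t).
Proof.
move=> D0 Dt tD.
have sD : D <= sin (pi * t).
  apply: le_trans (sinpi_lower _); last by apply/andP; split; lra.
  by rewrite le_min; apply/andP; split; lra.
have s0 : 0 < sin (pi * t) by lra.
split; last split=> //.
  rewrite /cot normrM normfV (gtr0_norm s0) ler_pdivrMr//.
  apply: le_trans (cos_max _) _; rewrite -[leLHS](divff (lt0r_neq0 D0)) mulrAC mul1r.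
  by rewrite ler_pM2r ?invr_gt0.
rewrite nm_kern// ler_pdivrMr ?mulr_gt0// mulrAC mul1r ler_pdivlMr ?mulr_gt0//.
by rewrite mul1r; lra.
Qed.

(* Summation by parts against [1 / (1 - e (g n)) = 1/2 + i cot (pi g n) / 2],
   whose variation telescopes because [cot] is monotone. *)
Lemma kusmin_landau (F : nat -> R) (a b : nat) (D : R) :
  0 < D ->
  (forall n, (a <= n < b)%N -> D <= F n.+1 - F n <= 1 - D) ->
  (forall n, (a <= n)%N -> (n.+1 < b)%N -> F n.+1 - F n <= F n.+2 - F n.+1) ->
  nm (\sum_(a <= n < b) e (F n)) <= 2 / D.
Proof.
move=> D0 gD gm.
have [ba|ab] := leqP b a; first by rewrite big_geq// nm0 divr_ge0// ltW.
pose g n := F n.+1 - F n.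
have EE n : e (F n.+1) = e (F n) * e (g n) by rewrite -eD /g addrC subrK.
(* The partial sum with a boundary term: [U a] has the norm of [kern (g a)], and [U m.+1 - U m] is
   [e (F m.+1)] times the increment of [kern], because [kern t * e t = kern t - 1]. *)
pose U m := \sum_(a <= n < m.+1) e (F n) + kern (g m) * e (F m.+1).
have gok n : (a <= n < b)%N -> `|cot (g n)| <= 1 / D /\
   nm (kern (g n)) <= 1 / (2 * D) /\ 0 < sin (pi * g n).
  by move=> nab; have /andP[? ?] := gD _ nab; apply: cot_bound.
have Ua : nm (U a) = nm (kern (g a)).
  rewrite /U big_nat1 EE mulrCA kernE; last first.
    by have [|_ [_ /lt0r_neq0]] := gok a; rewrite ?leqnn.
  by rewrite mulrBr mulr1 addrC subrK nmM nm_e mul1r.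
have UB j : (a + j < b)%N ->
    nm (U (a + j)%N) <= nm (kern (g a)) + (cot (g a) - cot (g (a + j)%N)) / 2.
  elim: j => [|j IH] ajb; first by rewrite addn0 Ua subrr mul0r addr0.
  have {}IH := IH ltac:(lia).
  rewrite addnS in ajb *; set m := (a + j)%N in ajb IH *.
  have am : (a <= m)%N by rewrite leq_addr.
  have -> : U m.+1 = U m + e (F m.+1) * (kern (g m.+1) - kern (g m)).
    rewrite /U big_nat_recr/=; last by lia.
    rewrite (EE m.+1) mulrCA kernE; first by ring.
    by have [|_ [_ /lt0r_neq0]] := gok m.+1; [lia|].
  apply: le_trans (nmD _ _) _; rewrite nmM nm_e mul1r.
  have -> : nm (kern (g m.+1) - kern (g m)) = (cot (g m) - cot (g m.+1)) / 2.
    have -> : kern (g m.+1) - kern (g m) = Complex 0 ((cot (g m.+1) - cot (g m)) / 2).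
      by rewrite -[_ - _]/(Complex _ _) subrr mulrBl.
    rewrite /nm /= expr0n add0r sqrtr_sqr normrM distrC.
    rewrite (@ger0_norm _ 2^-1) ?invr_ge0// ger0_norm ?subr_ge0//.
    have /andP[? ?] := gD m ltac:(lia); have /andP[? ?] := gD m.+1 ltac:(lia).
    have := gm m am ltac:(lia).
    by move=> ?; apply: cot_mono; rewrite /g; lra.
  apply: le_trans (lerD IH (lexx _)) _; lra.
have := UB (b.-1 - a)%N ltac:(lia).
rewrite subnKC; last by lia.
rewrite /U prednK ?(leq_ltn_trans _ ab)// => H.
have [c1 [k1 s1]] := gok a ltac:(lia).
have [c2 [k2 s2]] := gok b.-1 ltac:(lia).
have -> : \sum_(a <= n < b) e (F n) = (\sum_(a <= n < b) e (F n) + kern (g b.-1) * e (F b))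
   + - (kern (g b.-1) * e (F b)) by rewrite addrK.
apply: le_trans (nmD _ _) _; rewrite nmN nmM nm_e mulr1.
apply: le_trans (lerD H (lexx _)) _.
move: c1 c2; rewrite !ler_norml => /andP[? ?] /andP[? ?].
(* The two boundary terms contribute at most 1 / (2 D) each, and the variation, half a difference of
   cotangents, at most 1 / D. *)
have E : 1 / (2 * D) = 1 / D / 2 by field; rewrite gt_eqF.
rewrite E in k1 k2; have -> : 2 / D = 2 * (1 / D) by rewrite mul1r.
lra.
Qed.
End ExponentialSums.

(** * The divisor function *)

Section DivisorBound.
Local Open Scope nat_scope.

Definition tau (n : nat) := size (divisors n).

Lemma tau_gt0 n : 0 < tau n.
Proof.
by case: n => // n; rewrite /tau -has_predT; apply/hasP; exists 1; rewrite ?divisor1.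
Qed.

Lemma tau_prime_split p n : prime p -> 0 < n -> tau n <= (logn p n).+1 * tau (n`_p^').
Proof.
move=> pp n0.
have -> : (logn p n).+1 * tau (n`_p^') =
   size [seq p ^ i * d | i <- iota 0 (logn p n).+1, d <- divisors (n`_p^')].
  by rewrite size_allpairs size_iota.
apply: uniq_leq_size; first exact: divisors_uniq.
move=> d; rewrite -dvdn_divisors// => dn.
have d0 : 0 < d by apply: dvdn_gt0 dn.
apply/allpairsP; exists (logn p d, d`_p^'); split.
- by rewrite mem_iota add0n ltnS dvdn_leq_log.
- by rewrite -dvdn_divisors ?part_gt0// partn_dvd.
- by rewrite -p_part partnC.
Qed.

Variable R : realType.
Local Open Scope ring_scope.

Lemma powR_nat_exp (x eps : R) (n : nat) : 0 <= x -> (x ^+ n) `^ eps = (x `^ eps) ^+ n.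
Proof.
move=> x0; elim: n => [|n IH]; first by rewrite !expr0 powR1.
by rewrite !exprS powRM ?exprn_ge0// IH.
Qed.

Section Fixed.
Variables (eps : R) (s : nat).
Hypothesis eps0 : 0 < eps.
Hypothesis s1 : 1 <= s%:R * eps.

Let s0 : (0 < s)%N.
Proof. by case: s s1 => //; rewrite mul0r ler10. Qed.

Let pow2 : 2 <= (2 `^ eps) ^+ s :> R.
Proof.
rewrite -powR_mulrn ?powR_ge0// -powRrM mulrC.
by rewrite -[leLHS]powRr1//; apply: ler_powR => //; lra.
Qed.

Let two_eps : 1 <= 2 `^ eps :> R.
Proof. by rewrite -[leLHS](powRr0 2); apply: ler_powR; [lra|exact: ltW]. Qed.

Lemma exp_ge2 (p : nat) : (2 ^ s <= p)%N -> 2 <= p%:R `^ eps :> R.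
Proof.
move=> sp; apply: le_trans pow2 _; rewrite -powR_nat_exp//.
have sp' : 2 ^+ s <= p%:R :> R by rewrite -natrX ler_nat.
by apply: ge0_ler_powR; rewrite ?nnegrE ?(ltW eps0) ?exprn_ge0 ?ler0n.
Qed.

(** With integer quotients, a + 1 <= s (a / s + 1) <= s 2^(a / s), and 2 <= 2^(s eps) by the choice
    of [s]. This is valid for every prime, at the cost of the factor [s]. *)
Lemma succ_le_exp (p a : nat) : (2 <= p)%N -> a.+1%:R <= s%:R * (p%:R `^ eps) ^+ a :> R.
Proof.
move=> p2.
have H : 2 ^+ (a %/ s) <= (p%:R `^ eps) ^+ a :> R.
  apply: (@le_trans _ _ ((2 `^ eps) ^+ a)).
    apply: (@le_trans _ _ (((2 `^ eps) ^+ s) ^+ (a %/ s))).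
      by apply: lerXn2r => //; rewrite ?nnegrE ?exprn_ge0 ?powR_ge0.
    by rewrite -exprM; apply: ler_weXn2l => //; rewrite mulnC leq_divM.
  apply: lerXn2r; rewrite ?nnegrE ?powR_ge0//.
  by apply: ge0_ler_powR; rewrite ?nnegrE ?(ltW eps0) ?ler0n ?ler_nat.
apply: (@le_trans _ _ (s%:R * 2 ^+ (a %/ s))); last by rewrite ler_wpM2l.
rewrite -natrX -natrM ler_nat.
apply: leq_trans (_ : s * (a %/ s).+1 <= _)%N.
  by rewrite mulnC; apply: ltn_ceil.
by rewrite leq_mul2l ltn_expl// orbT.
Qed.

Lemma partn_prime_lt (p n : nat) : prime p -> (1 < n)%N -> (p %| n)%N -> (n`_p^' < n)%N.
Proof.
move=> pp n1 pn; have n0 : (0 < n)%N by apply: leq_trans n1.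
rewrite -[X in (_ < X)%N](partnC p n0) -[X in (X < _)%N]mul1n ltn_pmul2r ?part_gt0//.
rewrite p_part -[X in (X < _)%N](expn0 p) ltn_exp2l ?prime_gt1//.
by rewrite logn_gt0 mem_primes pp n0 pn.
Qed.

Lemma natr_part (p n : nat) : (0 < n)%N ->
  n%:R `^ eps = (p%:R `^ eps) ^+ logn p n * (n`_p^')%N%:R `^ eps :> R.
Proof.
move=> n0; rewrite -powR_nat_exp// -powRM ?exprn_ge0// -natrX -natrM.
by rewrite -p_part partnC.
Qed.

(** A prime p >= 2^s has p^eps >= 2, so an exponent a costs nothing: a + 1 <= 2^a <= p^(a eps). *)
Lemma tau_rough (n : nat) : (0 < n)%N ->
  (forall p, prime p -> (p %| n)%N -> (2 ^ s <= p)%N) -> (tau n)%:R <= n%:R `^ eps :> R.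
Proof.
elim/ltn_ind: n => n IH n0 big.
have [n1|n1] := leqP n 1.
  have -> : n = 1%N by apply/eqP; rewrite eqn_leq n1.
  by rewrite powR1.
pose p := pdiv n; have pp : prime p by apply: pdiv_prime.
have pn : (p %| n)%N by apply: pdiv_dvd.
rewrite (natr_part p n0).
apply: le_trans (_ : ((logn p n).+1%:R * (tau (n`_p^')%N)%:R) <= _); first by rewrite -natrM ler_nat tau_prime_split.
apply: ler_pM => //.
  apply: (@le_trans _ _ (2 ^+ logn p n)); first by rewrite -natrX ler_nat ltn_expl.
  by apply: lerXn2r; rewrite ?nnegrE ?powR_ge0//; apply: exp_ge2; apply: big.
apply: IH; rewrite ?part_gt0//; first exact: partn_prime_lt.
by move=> q qp qn; apply: big => //; apply: dvdn_trans qn _; apply: dvdn_part.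
Qed.

Lemma tau_semirough (j n : nat) : (0 < n)%N ->
  (forall p, prime p -> (p %| n)%N -> (2 ^ s - j <= p)%N) ->
  (tau n)%:R <= s%:R ^+ j * n%:R `^ eps :> R.
Proof.
have S1 : 1 <= s%:R :> R by rewrite ler1n.
elim: j n => [|j IH] n n0 big.
  by rewrite mul1r; apply: tau_rough => // p pp pn; have := big p pp pn; rewrite subn0.
pose k := (2 ^ s - j.+1)%N.
case: (boolP (prime k && (k %| n)%N)) => [/andP[kp kn]|nk]; last first.
  apply: (@le_trans _ _ (s%:R ^+ j * n%:R `^ eps)); last first.
    by rewrite ler_wpM2r ?powR_ge0// exprS ler_peMl// exprn_ge0// ler0n.
  apply: IH => // p pp pn; have := big p pp pn; rewrite -/k leq_eqVlt => /orP[/eqP kE|].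
    by move: nk; rewrite kE pp pn.
  by rewrite /k; lia.
have n1 : (1 < n)%N by apply: leq_trans (prime_gt1 kp) _; apply: dvdn_leq.
rewrite (natr_part k n0).
apply: le_trans (_ : ((logn k n).+1%:R * (tau (n`_k^')%N)%:R) <= _); first by rewrite -natrM ler_nat tau_prime_split.
have -> : s%:R ^+ j.+1 * ((k%:R `^ eps) ^+ logn k n * (n`_k^')%N%:R `^ eps)
  = (s%:R * (k%:R `^ eps) ^+ logn k n) * (s%:R ^+ j * (n`_k^')%N%:R `^ eps) by rewrite exprS; ring.
apply: ler_pM => //; first by apply: succ_le_exp; apply: prime_gt1.
apply: IH; rewrite ?part_gt0// => p pp pn.
have := big p pp (dvdn_trans pn (dvdn_part k^' n)); rewrite -/k leq_eqVlt => /orP[/eqP kE|].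
  have : p \in k^'.
    by apply: (pnatPpi (part_pnat k^' n)); rewrite mem_primes pp part_gt0 pn.
  by rewrite !inE -kE eqxx.
by rewrite /k; lia.
Qed.
End Fixed.

Theorem divisor_bound (eps : R) : 0 < eps ->
  exists2 M : R, 1 <= M & forall n : nat, (0 < n)%N -> (tau n)%:R <= M * n%:R `^ eps.
Proof.
move=> e0.
pose s := (Num.truncn (eps^-1)).+1.
have s1 : 1 <= s%:R * eps.
  by rewrite -ler_pdivrMr// div1r ltW// truncnS_gt.
exists (s%:R ^+ (2 ^ s)); first by rewrite exprn_ege1// ler1n.
by move=> n n0; apply: tau_semirough => // p _ _; rewrite subnn.
Qed.
End DivisorBound.

(** * Sums of two squares *)

Section TwoSquares.
Local Open Scope ring_scope.

(** The nonprincipal Dirichlet character modulo 4. *)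
Definition chi (n : nat) : int :=
  if (n %% 4 == 1)%N then 1 else if (n %% 4 == 3)%N then -1 else 0.

Lemma chiM m n : chi (m * n) = chi m * chi n.
Proof.
rewrite /chi -(modnMm m n 4).
have : (m %% 4 < 4)%N by rewrite ltn_mod.
have : (n %% 4 < 4)%N by rewrite ltn_mod.
by move: (m %% 4)%N (n %% 4)%N => [|[|[|[|//]]]] [|[|[|[|//]]]].
Qed.

Definition sigma (n : nat) : int := \sum_(d <- divisors n) chi d.

(** The divisors of [p * n] are those of [n] together with the [p * d] for which [d] divides [n] but
    [p * d] does not. The representation numbers satisfy the same recursion, which is how the two
    functions are identified. *)
Lemma sigma_pM p n : prime p -> (0 < n)%N ->
  sigma (p * n) = (1 + chi p) * sigma n - chi p * (if (p %| n)%N then sigma (n %/ p) else 0).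
Proof.
move=> pp n0.
have p0 := prime_gt0 pp.
have pn0 : (0 < p * n)%N by rewrite muln_gt0 p0.
have E1 : perm_eq (divisors (p * n))
   (divisors n ++ [seq (p * d)%N | d <- [seq d <- divisors n | ~~ (p * d %| n)%N]]).
  apply: uniq_perm; first exact: divisors_uniq.
    rewrite cat_uniq divisors_uniq /= map_inj_uniq; last first.
      by move=> x y /eqP; rewrite eqn_pmul2l// => /eqP.
    rewrite filter_uniq ?divisors_uniq// andbT.
    apply/hasPn => x /mapP[d]; rewrite mem_filter => /andP[h _] ->.
    by rewrite -dvdn_divisors.
  move=> d; rewrite -dvdn_divisors// mem_cat -dvdn_divisors//.
  apply/idP/idP.
    move=> dpn; case: (boolP (d %| n)%N) => //= ndn.
    have pd : (p %| d)%N.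
      apply: contraNT ndn => npd; rewrite -(@Gauss_dvdr d p) //.
      by rewrite coprime_sym prime_coprime.
    apply/mapP; exists (d %/ p)%N; last by rewrite mulnC divnK.
    rewrite mem_filter mulnC divnK// ndn/= -dvdn_divisors//.
    by rewrite -(@dvdn_pmul2l p)// mulnC divnK.
  case/orP => [dn|/mapP[k]]; first exact: dvdn_mull.
  by rewrite mem_filter -dvdn_divisors// => /andP[_ kn] ->; rewrite dvdn_pmul2l.
rewrite /sigma (perm_big _ E1) big_cat big_map big_filter/=.
under [X in _ + X]eq_bigr do rewrite chiM.
rewrite -big_distrr/=.
have -> : \sum_(d <- divisors n | ~~ (p * d %| n)%N) chi d
  = sigma n - (if (p %| n)%N then sigma (n %/ p) else 0).
  rewrite /sigma [X in _ = X - _](bigID (fun d => p * d %| n)%N)/= addrAC.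
  rewrite -[LHS]add0r; congr (_ + _); apply/esym/eqP; rewrite subr_eq0; apply/eqP.
  case: ifP => pn; last first.
    rewrite big1// => d /(dvdn_trans _) H; move: pn.
    by rewrite (H p)// dvdn_mulr.
  rewrite -big_filter; apply: perm_big; apply: uniq_perm.
  - by rewrite filter_uniq ?divisors_uniq.
  - exact: divisors_uniq.
  have np0 : (0 < n %/ p)%N by rewrite divn_gt0// dvdn_leq.
  move=> d; rewrite mem_filter -!dvdn_divisors//.
  rewrite -[X in (p * d %| X)%N](divnK pn) mulnC dvdn_pmul2r//.
  by apply: andb_idr => /dvdn_trans; apply; apply: dvdn_div.
by rewrite /sigma; ring.
Qed.

Definition repr (n : int) := fset_set (two_squares n).

Lemma in_repr n (p : int * int) : (p \in repr n) = (p.1 ^+ 2 + p.2 ^+ 2 == n).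
Proof.
rewrite /repr in_fset_set; last exact: finite_two_squares.
by apply/idP/eqP; rewrite inE.
Qed.

(** Multiplication by the Gaussian integer a + ib, in coordinates. *)
Definition gmul (a b : int) (z : int * int) : int * int :=
  (a * z.1 - b * z.2, a * z.2 + b * z.1).

Lemma gmul_inj (a b p : int) : p != 0 -> a ^+ 2 + b ^+ 2 = p -> injective (gmul a b).
Proof.
move=> p0 abp [x y] [x' y'] [] /= E1 E2.
have e1 : p * (x - x') = 0.
  have -> : p * (x - x') = a * ((a * x - b * y) - (a * x' - b * y')) + b * ((a * y + b * x) - (a * y' + b * x')).
    by rewrite -abp; ring.
  by rewrite E1 E2 !subrr !mulr0 addr0.
have e2 : p * (y - y') = 0.
  have -> : p * (y - y') = a * ((a * y + b * x) - (a * y' + b * x')) - b * ((a * x - b * y) - (a * x' - b * y')).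
    by rewrite -abp; ring.
  by rewrite E1 E2 !subrr !mulr0 subr0.
move/eqP: e1; move/eqP: e2; rewrite !mulf_eq0 (negPf p0)/= !subr_eq0.
by move=> /eqP-> /eqP->.
Qed.

Lemma card_repr0 : #|` repr 1 |%fset = 4.
Proof.
have -> : repr 1 = [fset z in [:: (1, 0); (-1, 0); (0, 1); (0, -1) : int * int]]%fset.
  apply/fsetP => -[x y]; rewrite in_repr !inE /= orbF.
  apply/eqP/idP; last by case/or4P => /eqP[-> ->].
  move=> E.
  have : x = 0 \/ x = 1 \/ x = -1 by nia.
  by case=> [|[]] Ex; rewrite Ex in E *; (have : y = 0 \/ y = 1 \/ y = -1 by nia);
    case=> [|[]] Ey; rewrite Ey in E *.
by rewrite card_fseq.
Qed.

(** Multiplication by 1 + i is a bijection between the two sets: if x^2 + y^2 is even, so is x + y,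
    and then x + iy is divisible by 1 + i. *)
Lemma repr_2M n : #|` repr (2 * n) |%fset = #|` repr n |%fset.
Proof.
have gi := @gmul_inj 1 1 2 isT erefl.
have <- : #|` [fset gmul 1 1 z | z in repr n]%fset |%fset = #|` repr n |%fset.
  by rewrite card_imfset.
congr (size (finmap.enum_fset _)).
apply/fsetP => -[x y]; rewrite in_repr /=; apply/eqP/imfsetP => /=.
  move=> E.
  have x2 : (2 %| (x + y))%Z.
    have : (2 %| (x + y) ^+ 2)%Z.
      have -> : (x + y) ^+ 2 = (n + x * y) * 2 by rewrite sqrrD mulrDl -[n * 2]mulrC -E; ring.
      exact: dvdz_mull.
    by rewrite dvdzE abszX Euclid_dvdX// andbT.
  case/dvdzP: x2 => k Ek.
  exists (k, y - k) => /=; last by rewrite /gmul /=; congr pair; lia.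
  rewrite in_repr /=; apply/eqP.
  have Ex : x = k * 2 - y by rewrite -Ek; ring.
  by rewrite Ex in E; lia.
by case=> -[u v] /=; rewrite in_repr /= => /eqP <- [-> ->]; ring.
Qed.

Lemma scale_inj (p : int) : p != 0 -> injective (fun z : int * int => (p * z.1, p * z.2)).
Proof. by move=> p0 [x y] [x' y'] [] /= /(mulfI p0)-> /(mulfI p0)->. Qed.

Lemma prime_dvdz_sqr (p : nat) (x : int) : prime p -> (p %| x ^+ 2)%Z -> (p %| x)%Z.
Proof. by move=> pp; rewrite !dvdzE abszX Euclid_dvdX// => /andP[]. Qed.

Lemma card_scaled_repr (p n : nat) : (0 < p)%N -> (p %| n)%N ->
  #|` [fset ((p%:Z * z.1, p%:Z * z.2) : int * int) | z in repr (n %/ p)%N%:Z] |%fset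
  = #|` repr (n %/ p)%N%:Z |%fset.
Proof. by move=> p0 pn; rewrite card_imfset//=; apply: scale_inj; lia. Qed.

Lemma repr_scaled (p n : nat) : prime p ->
  [fset z in repr (p * n)%N%:Z | (p %| z.1)%Z && (p %| z.2)%Z]%fset =
  (if (p %| n)%N then [fset ((p%:Z * z.1, p%:Z * z.2) : int * int) | z in repr (n %/ p)%N%:Z]
   else fset0)%fset.
Proof.
move=> pp; have p0 := prime_gt0 pp.
apply/fsetP => -[x y]; rewrite !inE /= in_repr /=.
apply/idP/idP.
  move=> /andP[/eqP E /andP[/dvdzP[u ux] /dvdzP[v vy]]].
  have En : n%:Z = p%:Z * (u ^+ 2 + v ^+ 2).
    have : p%:Z * n%:Z = p%:Z * (p%:Z * (u ^+ 2 + v ^+ 2)) by rewrite -PoszM -E ux vy; ring.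
    by apply: mulfI; lia.
  have pn : (p %| n)%N.
    have : (p%:Z %| n%:Z)%Z by rewrite En dvdz_mulr.
    by [].
  rewrite pn; apply/imfsetP; exists (u, v) => /=; last by rewrite ux vy; congr pair; rewrite mulrC.
  rewrite in_repr /=; apply/eqP; apply: (@mulfI _ p%:Z); first by lia.
  by rewrite -En -PoszM mulnC divnK.
case: ifP => pn; last by rewrite inE.
case/imfsetP => -[u v] /=; rewrite in_repr /= => /eqP E [-> ->].
apply/andP; split; last by rewrite !dvdz_mulr.
apply/eqP; rewrite !exprMn -mulrDr E -[in RHS](divnK pn) !PoszM; ring.
Qed.

(** Here (p - 1) / 2 is odd, so u^2 + v^2 divides u^(p-1) + v^(p-1), which is 2 modulo p if p
    divides neither u nor v. Hence p divides both coordinates of every representation of p n, and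
    these are p times the representations of n / p. *)
Lemma repr_3mod4 (p n : nat) : prime p -> (p %% 4 = 3)%N ->
  #|` repr (p * n)%N%:Z |%fset = (if (p %| n)%N then #|` repr (n %/ p)%N%:Z |%fset else 0%N).
Proof.
move=> pp p3; have p0 := prime_gt0 pp.
have -> : repr (p * n)%N%:Z = [fset z in repr (p * n)%N%:Z | (p %| z.1)%Z && (p %| z.2)%Z]%fset.
  apply/fsetP => -[x y]; rewrite !inE /=; apply/esym/andb_idr.
  rewrite in_repr /= => /eqP E.
  have F : (p %| `|x| ^ 2 + `|y| ^ 2)%N.
    suff -> : (`|x| ^ 2 + `|y| ^ 2)%N = (p * n)%N by rewrite dvdn_mulr.
    by apply/eqP; rewrite -eqz_nat PoszD -!abszX !abszE !ger0_norm ?sqr_ge0// E.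
  suff : (p %| `|x|)%N && (p %| `|y|)%N by [].
  have H (u v : nat) : (p %| u ^ 2 + v ^ 2)%N -> (p %| u)%N.
    move=> D; apply/negPn/negP => npu.
    have npv : ~~ (p %| v)%N.
      apply: contraNN npu => pv; move: D; rewrite dvdn_addl; last by rewrite dvdn_exp.
      by rewrite Euclid_dvdX// => /andP[].
    have cu : (u ^ (p.-1) = 1 %[mod p])%N.
      by rewrite -totient_prime// Euler_exp_totient// coprime_sym prime_coprime.
    have cv : (v ^ (p.-1) = 1 %[mod p])%N.
      by rewrite -totient_prime// Euler_exp_totient// coprime_sym prime_coprime.
    set k := (p %/ 4)%N.
    have pk : (p.-1 = 2 * (2 * k + 1))%N.
      have -> : p = (4 * k + 3)%N by rewrite {1}(divn_eq p 4) p3 mulnC.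
      by rewrite addn3 /=; clear; lia.
    have D2 : (p %| (u ^ 2) ^ (2 * k + 1) + (v ^ 2) ^ (2 * k + 1))%N.
      have PX (m j : nat) : (m ^ j)%N%:Z = m%:Z ^+ j by rewrite -!natz natrX.
      have [w ->] : exists w, ((u ^ 2) ^ (2 * k + 1) + (v ^ 2) ^ (2 * k + 1) = (u ^ 2 + v ^ 2) * w)%N.
        move: (u ^ 2)%N (v ^ 2)%N => s t.
        have : exists w : int, s%:Z ^+ (2 * k + 1) + t%:Z ^+ (2 * k + 1) = (s + t)%N%:Z * w.
          elim: k {pk} => [|k [w IH]]; first by exists 1; rewrite mulr1 !expr1 PoszD.
          exists (s%:Z ^+ 2 * w - (s%:Z - t%:Z) * t%:Z ^+ (2 * k + 1)).
          have -> : (2 * k.+1 + 1 = (2 * k + 1) + 2)%N by lia.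
          rewrite 2!(exprD _ (2 * k + 1) 2) mulrBr [_ * (_ * w)]mulrCA -IH PoszD.
          by move: (s%:Z ^+ (2 * k + 1)) (t%:Z ^+ (2 * k + 1)) => A B; ring.
        case=> w Ew; have [st0|st0] := posnP (s + t)%N.
          by exists 0%N; move: st0; case: s t Ew => [|//] [|//]; rewrite addn1 !exp0n.
        exists `|w|%N; apply/eqP; rewrite -eqz_nat PoszD !PX Ew PoszM abszE ger0_norm//.
        have : 0 <= (s + t)%N%:Z * w by rewrite -Ew addr_ge0// exprn_ge0.
        by rewrite pmulr_rge0.
      by rewrite dvdn_mulr.
    move: D2; rewrite -!expnM -pk /dvdn -modnDm cu cv modnDm => /eqP.
    have p2 : (2 < p)%N.
      by rewrite ltn_neqAle prime_gt1// andbT; apply/eqP => E2; move: p3; rewrite -E2.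
    by rewrite modn_small.
  by rewrite (H _ _ F) (H `|y|%N `|x|%N)// addnC.
rewrite repr_scaled//; case: ifP => pn; last by rewrite cardfs0.
by rewrite card_scaled_repr.
Qed.

(* [w] in [Z[i]] of norm divisible by [p = a^2 + b^2] is a multiple of
   [a + ib] or of [a - ib], and of both only if it is a multiple of [p]. *)
Lemma repr_1mod4 (p n : nat) (a b : int) : prime p -> odd p -> a ^+ 2 + b ^+ 2 = p%:Z ->
  (#|` repr (p * n)%N%:Z |%fset + (if (p %| n)%N then #|` repr (n %/ p)%N%:Z |%fset else 0)
   = 2 * #|` repr n%:Z |%fset)%N.
Proof.
move=> pp po abp; have p0 := prime_gt0 pp.
have pz : p%:Z != 0 by rewrite eqz_nat -lt0n.
have abp' : a ^+ 2 + (- b) ^+ 2 = p%:Z by rewrite sqrrN.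
have i1 := gmul_inj pz abp; have i2 := gmul_inj pz abp'.
have dp (u v : int) : p%:Z * u = v -> (p%:Z %| v)%Z by move=> <-; apply: dvdz_mulr.
have npa (c d : int) : c ^+ 2 + d ^+ 2 = p%:Z -> ~ (p%:Z %| c)%Z.
  move=> E /dvdzP[k ck].
  have pd : (p%:Z %| d)%Z.
    apply: prime_dvdz_sqr => //.
    have -> : d ^+ 2 = p%:Z * (1 - k ^+ 2 * p%:Z) by rewrite mulrBr mulr1 -[X in X - _]E ck; ring.
    exact: dvdz_mulr.
  case/dvdzP: pd => j dj.
  have E1 : p%:Z * (p%:Z * (k ^+ 2 + j ^+ 2)) = p%:Z * 1 by rewrite mulr1 -[RHS]E ck dj; ring.
  move/(mulfI pz): E1 => E1.
  have : (p %| 1)%N by have := dp _ _ E1.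
  by rewrite dvdn1 => /eqP p1; move: pp; rewrite p1.
set A := [fset gmul a b z | z in repr n%:Z]%fset.
set B := [fset gmul a (- b) z | z in repr n%:Z]%fset.
have cA : #|` A |%fset = #|` repr n%:Z |%fset by rewrite card_imfset.
have cB : #|` B |%fset = #|` repr n%:Z |%fset by rewrite card_imfset.
(* Divisibility of x + iy by c + id: the quotient has coordinates (c x + d y) / p and (c y - d x) /
   p. The squares of the two numerators add up to p^2 n, so testing the first one suffices. *)
have inA x y (c d : int) : c ^+ 2 + d ^+ 2 = p%:Z -> x ^+ 2 + y ^+ 2 = (p * n)%N%:Z ->
    (p%:Z %| c * x + d * y)%Z -> (x, y) \in [fset gmul c d z | z in repr n%:Z]%fset.
  move=> cdp E /dvdzP[u Eu].
  have : (p%:Z %| (c * y - d * x) ^+ 2)%Z.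
    have -> : (c * y - d * x) ^+ 2 = p%:Z * (p%:Z * n%:Z - u ^+ 2 * p%:Z).
      have -> : (c * y - d * x) ^+ 2 = (c ^+ 2 + d ^+ 2) * (x ^+ 2 + y ^+ 2) - (c * x + d * y) ^+ 2 by ring.
      by rewrite cdp E Eu PoszM; ring.
    exact: dvdz_mulr.
  move/(prime_dvdz_sqr pp)/dvdzP => [v Ev].
  apply/imfsetP; exists (u, v) => /=.
    rewrite in_repr /=; apply/eqP; apply: (mulfI pz); apply: (mulfI pz).
    have -> : p%:Z * (p%:Z * (u ^+ 2 + v ^+ 2)) = (u * p%:Z) ^+ 2 + (v * p%:Z) ^+ 2 by ring.
    have F : p%:Z * (p%:Z * n%:Z) = (c ^+ 2 + d ^+ 2) * (x ^+ 2 + y ^+ 2) by rewrite cdp E PoszM.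
    by rewrite -Eu -Ev F; ring.
  rewrite /gmul /=; congr pair; apply: (mulfI pz).
    have -> : p%:Z * (c * u - d * v) = c * (u * p%:Z) - d * (v * p%:Z) by ring.
    by rewrite -Eu -Ev -[X in X * x = _]cdp; ring.
  have -> : p%:Z * (c * v + d * u) = c * (v * p%:Z) + d * (u * p%:Z) by ring.
  by rewrite -Eu -Ev -[X in X * y = _]cdp; ring.
have fromA (c d : int) z : c ^+ 2 + d ^+ 2 = p%:Z -> z \in [fset gmul c d z | z in repr n%:Z]%fset ->
    z \in repr (p * n)%N%:Z /\ (p%:Z %| c * z.1 + d * z.2)%Z.
  move=> cdp /imfsetP[[u v]] /=; rewrite in_repr /= => /eqP E -> /=; split.
    rewrite in_repr /=; apply/eqP.
    have -> : (c * u - d * v) ^+ 2 + (c * v + d * u) ^+ 2 = (c ^+ 2 + d ^+ 2) * (u ^+ 2 + v ^+ 2) by ring.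
    by rewrite cdp E PoszM.
  have -> : c * (c * u - d * v) + d * (c * v + d * u) = (c ^+ 2 + d ^+ 2) * u by ring.
  by rewrite cdp dvdz_mulr.
have EU : repr (p * n)%N%:Z = (A `|` B)%fset.
  apply/fsetP => -[x y]; rewrite in_fsetU; apply/idP/orP.
    rewrite in_repr /= => /eqP E.
    have : (p%:Z %| (a * x + b * y) * (a * x + (- b) * y))%Z.
      have -> : (a * x + b * y) * (a * x + (- b) * y) = p%:Z * (x ^+ 2 - b ^+ 2 * n%:Z).
        have -> : (a * x + b * y) * (a * x + (- b) * y) = (a ^+ 2 + b ^+ 2) * x ^+ 2 - b ^+ 2 * (x ^+ 2 + y ^+ 2) by ring.
        by rewrite abp E PoszM; ring.
      exact: dvdz_mulr.
    rewrite !dvdzE abszM Euclid_dvdM// => /orP[H|H].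
      by left; apply: (inA x y a b).
    by right; apply: (inA x y a (- b)).
  case=> H.
    by have [] := fromA _ _ _ abp H.
  by have [] := fromA _ _ _ abp' H.
have EI : (A `&` B)%fset = [fset z in repr (p * n)%N%:Z | (p %| z.1)%Z && (p %| z.2)%Z]%fset.
  apply/fsetP => -[x y]; rewrite in_fsetI !inE /=; apply/andP/andP.
    case=> /(fromA _ _ _ abp)[E1 /= D1] /(fromA _ _ _ abp')[_ /= D2]; split=> //.
    (* Adding and subtracting the two conditions gives that p divides 2 a x and 2 b y, while p is
       odd and divides neither a nor b. *)
    have H (c w : int) : c ^+ 2 + (b ^+ 2 + a ^+ 2 - c ^+ 2) = p%:Z -> (exists d, c ^+ 2 + d ^+ 2 = p%:Z) ->
        (p%:Z %| 2 * (c * w))%Z -> (p%:Z %| w)%Z.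
      move=> _ [d cd]; rewrite !dvdzE !abszM Euclid_dvdM// => /orP[|].
        move=> /dvdn_leq H2; have {}H2 := H2 isT.
        by have := prime_gt1 pp; case: p po H2 {pp p0 pz abp abp' npa inA fromA EU D1 D2 E1 cd dp} => [|[|[|]]].
      by rewrite Euclid_dvdM// => /orP[|//] /(npa _ _ cd).
    apply/andP; split.
      apply: (H a x); [by rewrite -abp; ring|by exists b|].
      have -> : 2 * (a * x) = (a * x + b * y) + (a * x + (- b) * y) by ring.
      exact: rpredD.
    apply: (H b y); [by rewrite -abp; ring|by exists a; rewrite addrC|].
    have -> : 2 * (b * y) = (a * x + b * y) - (a * x + (- b) * y) by ring.
    exact: rpredB.
  case=> E /andP[px py]; move: E; rewrite in_repr /= => /eqP E; split.
    by apply: (inA x y a b) => //; apply: rpredD; apply: dvdz_mull.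
  by apply: (inA x y a (- b)) => //; apply: rpredD; apply: dvdz_mull.
have := cardfsUI A B; rewrite -EU EI repr_scaled// cA cB addnn -mul2n => <-.
by congr (_ + _)%N; case: ifP => pn; rewrite ?cardfs0// card_scaled_repr.
Qed.

(** With p = 4 k + 1, the polynomial X^(2k) - 1 cannot vanish at all 4 k nonzero elements. Where it
    does not vanish, x^(2k) is the other square root of 1, and x^k is the required element. *)
Lemma sqrtN1_Fp (p : nat) : prime p -> (p %% 4 = 1)%N -> exists i : 'F_p, i ^+ 2 = -1.
Proof.
move=> pp p1; have p0 := prime_gt0 pp.
set k := (p %/ 4)%N.
have pk : p = (4 * k + 1)%N by rewrite {1}(divn_eq p 4) p1 mulnC.
have pk1 : (4 * k).+1 = p by rewrite -addn1 -pk.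
have k0 : (0 < k)%N.
  by case: (posnP k) => // kk; move: pp; rewrite pk kk.
have cF : #|'F_p| = p by rewrite card_Fp.
suff [x x0 xn] : exists2 x : 'F_p, x != 0 & x ^+ (2 * k) != 1.
  exists (x ^+ k).
  have : x ^+ (4 * k) = 1.
    apply: (mulfI x0); rewrite mulr1 -exprS pk1.
    by have := expf_card x; rewrite cF.
  have -> : (4 * k = 2 * k * 2)%N by lia.
  rewrite exprM => /eqP; rewrite sqrf_eq1 (negPf xn) /= => /eqP <-.
  by rewrite -exprM mulnC.
apply/exists2P; apply/not_existsP => H.
pose P : {poly 'F_p} := 'X^(2 * k) - 1%:P.
have szP : size P = (2 * k).+1 by rewrite size_XnsubC// muln_gt0.
have Pn0 : P != 0 by rewrite -size_poly_eq0 szP.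
have := max_poly_roots (rs := enum [pred x : 'F_p | x != 0]) Pn0.
rewrite enum_uniq szP -cardE => /(_ _ isT).
have -> : #|[pred x : 'F_p | x != 0]| = (4 * k)%N.
  have := cardC1 (0 : 'F_p); rewrite cF => H1.
  have -> : (4 * k)%N = p.-1 by rewrite -pk1.
  by rewrite -H1; apply: eq_card => x; rewrite !inE.
have -> : all (root P) (enum [pred x : 'F_p | x != 0]).
  apply/allP => x; rewrite mem_enum inE => x0.
  rewrite /root /P !hornerE subr_eq0.
  apply/negPn/negP => xn; apply: (H x); split=> //.
by move=> /(_ isT); rewrite ltnS; lia.
Qed.

Lemma prime_not_square (m : nat) : ~ prime (m ^ 2).
Proof.
move=> pm; have := pm; rewrite -mulnn => /primeP[_ /(_ m)]; rewrite dvdn_mulr// => /(_ isT).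
case/orP => /eqP E; first by move: pm; rewrite E.
by move: pm; rewrite -mulnn -E => pm; move: E (prime_gt1 pm); clear; nia.
Qed.

Lemma dist_le (m u v : nat) : (u <= m)%N -> (v <= m)%N -> (`|u%:Z - v%:Z| <= m)%N.
Proof. lia. Qed.

(* Thue's pigeonhole: two of the [u - i v] with [0 <= u, v <= sqrt p] coincide. *)
Lemma fermat_two_squares (p : nat) : prime p -> (p %% 4 = 1)%N ->
  exists a b : int, a ^+ 2 + b ^+ 2 = p%:Z.
Proof.
move=> pp p1; have p0 := prime_gt0 pp.
have [i i2] := sqrtN1_Fp pp p1.
pose s := trunc_log 1 p.
have [m m1 m2] : exists2 m, (m ^ 2 <= p)%N & (p < m.+1 ^ 2)%N.
  have ex : exists m, (m ^ 2 <= p)%N by exists 0%N.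
  have bd m : (m ^ 2 <= p)%N -> (m <= p)%N.
    by apply: leq_trans; case: m => // m; rewrite expnS expn1 leq_pmulr.
  case: (ex_maxnP ex bd) => m h1 h2; exists m => //.
  by rewrite ltnNge; apply/negP => /h2; rewrite ltnn.
pose f (z : 'I_m.+1 * 'I_m.+1) : 'F_p := (z.1)%:R - i * (z.2)%:R.
have ninj : ~ injective f.
  move=> /leq_card; rewrite card_Fp// card_prod !card_ord leqNgt.
  by rewrite mulnn m2.
have [[u v] [[u' v'] [ne E]]] : exists z w, z != w /\ f z = f w.
  apply: contrapT => H; apply: ninj => z w E.
  by apply: contrapT => /eqP zw; apply: H; exists z, w.
pose a := (u : nat)%:Z - (u' : nat)%:Z; pose b := (v : nat)%:Z - (v' : nat)%:Z.
have Eab : a%:~R = i * b%:~R :> 'F_p.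
  rewrite /a /b !rmorphB /= mulrBr -!pmulrn.
  move/eqP: E; rewrite /f /= subr_eq => /eqP ->; ring.
exists a, b.
have D : (p %| `|a| ^ 2 + `|b| ^ 2)%N.
  rewrite (dvdn_pcharf (pchar_Fp pp)) natrD !natrX.
  have H (c : int) : (`|c|%N)%:R ^+ 2 = c%:~R ^+ 2 :> 'F_p.
    by case: c => n //; rewrite NegzE abszN rmorphN sqrrN.
  by rewrite !H Eab exprMn i2 mulN1r addNr.
have Az : a ^+ 2 + b ^+ 2 = (`|a| ^ 2 + `|b| ^ 2)%N%:Z.
  by rewrite PoszD -!abszX !abszE !ger0_norm ?sqr_ge0.
rewrite Az; congr Posz.
have al : (`|a| <= m)%N by apply: dist_le; rewrite -ltnS.
have bl : (`|b| <= m)%N by apply: dist_le; rewrite -ltnS.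
(* A prime is not a square, so the inequality is strict and a^2 + b^2 < 2 p. Being a positive
   multiple of p, this sum equals p. *)
have mp : (m ^ 2 < p)%N.
  rewrite ltn_neqAle m1 andbT; apply/eqP => E2.
  by apply: (@prime_not_square m); rewrite E2.
have L : (`|a| ^ 2 + `|b| ^ 2 < 2 * p)%N.
  have : (`|a| ^ 2 <= m ^ 2)%N by rewrite leq_sqr.
  have : (`|b| ^ 2 <= m ^ 2)%N by rewrite leq_sqr.
  by move: mp; clear; lia.
have P0 : (0 < `|a| ^ 2 + `|b| ^ 2)%N.
  rewrite lt0n addn_eq0 !expn_eq0 /= !andbT !absz_eq0 !subr_eq0 !eqz_nat.
  by apply: contra ne => /andP[/eqP H1 /eqP H2]; apply/eqP; congr pair; apply/val_inj.
case/dvdnP: D => k Ek; rewrite Ek in L P0 *.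
move: L; rewrite ltn_pmul2r// => L.
by case: k L P0 {Ek} => [|[|]]//; rewrite mul1n.
Qed.

Lemma sigma1 : sigma 1 = 1.
Proof. by rewrite /sigma big_cons big_nil. Qed.

(** Strong induction, removing the least prime factor. This prime ramifies, splits or stays inert in
    the Gaussian integers according to its residue modulo 4, and each case reproduces the recursion
    of [sigma_pM]. *)
Theorem r_sigma (n : nat) : (0 < n)%N -> (r n%:Z)%:Z = 4 * sigma n.
Proof.
rewrite -[r n%:Z]/(#|` repr n%:Z |%fset).
elim/ltn_ind: n => n IH n0.
have [n1|n1] := leqP n 1.
  have -> : n = 1%N by apply/eqP; rewrite eqn_leq n1.
  by rewrite card_repr0 sigma1.
pose p := pdiv n; have pp : prime p by apply: pdiv_prime.
have p0 := prime_gt0 pp.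
set m := (n %/ p)%N.
have nE : n = (p * m)%N by rewrite mulnC divnK// pdiv_dvd.
have m0 : (0 < m)%N by rewrite divn_gt0// dvdn_leq// pdiv_dvd.
have mn : (m < n)%N by rewrite nE -[X in (X < _)%N]mul1n ltn_pmul2r// prime_gt1.
have IHm := IH m mn m0.
have IHp : (p %| m)%N -> (#|` repr (m %/ p)%N%:Z |%fset)%:Z = 4 * sigma (m %/ p).
  move=> pm; apply: IH; last by rewrite divn_gt0// dvdn_leq.
  by apply: leq_ltn_trans mn; apply: leq_div.
rewrite nE sigma_pM//.
have : (p %% 4 < 4)%N by rewrite ltn_mod.
case E4 : (p %% 4)%N => [|[|[|[|//]]]] _.
- have : (2 %| p)%N by rewrite (divn_eq p 4) E4 addn0 dvdn_mull.
  by rewrite dvdn_prime2// => /eqP p2; move: E4; rewrite -p2.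
- have [a [b abp]] := fermat_two_squares pp E4.
  have po : odd p by rewrite (divn_eq p 4) E4 oddD oddM andbF.
  have := repr_1mod4 m pp po abp.
  have -> : chi p = 1 by rewrite /chi E4.
  move/(congr1 Posz); rewrite PoszD (PoszM 2) IHm => /(canRL (addrK _)) ->.
  by case: ifP => pm; rewrite ?IHp//; ring.
- have p2 : p = 2%N.
    have : (2 %| p)%N by rewrite (divn_eq p 4) E4 dvdn_add// dvdn_mull.
    by rewrite dvdn_prime2// => /eqP.
  have -> : chi p = 0 by rewrite /chi E4.
  by rewrite p2 PoszM repr_2M IHm; ring.
- have -> : chi p = -1 by rewrite /chi E4.
  by rewrite repr_3mod4//; case: ifP => pm; rewrite ?IHp//; ring.
Qed.
End TwoSquares.

(** * Additive characters modulo q *)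

Section ModularCounting.
Local Open Scope nat_scope.

Lemma gcdnM_le (m n q : nat) : 0 < q -> gcdn (m * n) q <= gcdn m q * gcdn n q.
Proof.
move=> q0; apply: dvdn_leq; first by rewrite muln_gt0 !gcdn_gt0 q0 !orbT.
rewrite muln_gcdl dvdn_gcd; apply/andP; split.
  rewrite muln_gcdr dvdn_gcd dvdn_gcdl /=.
  by apply: dvdn_trans (dvdn_gcdr _ _) _; apply: dvdn_mull.
rewrite muln_gcdr dvdn_gcd; apply/andP; split.
  by apply: dvdn_trans (dvdn_gcdr _ _) _; apply: dvdn_mulr.
by apply: dvdn_trans (dvdn_gcdr _ _) _; apply: dvdn_mulr.
Qed.

(** Each gcd is at most the sum of the common divisors [f] of [a] and [q], and a divisor [f] of [q]
    divides q / f of the residues. *)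
Lemma sum_gcdn (q : nat) : 0 < q -> \sum_(a < q) gcdn a q <= q * tau q.
Proof.
move=> q0.
apply: (@leq_trans (\sum_(a < q) \sum_(f <- divisors q | f %| a) f)).
  apply: leq_sum => a _.
  rewrite (big_rem (gcdn a q)) /=; last by rewrite -dvdn_divisors// dvdn_gcdr.
  by rewrite dvdn_gcdl leq_addr.
rewrite (exchange_big_dep predT) //=.
apply: (@leq_trans (\sum_(f <- divisors q) q)); last first.
  by rewrite big_const_seq count_predT iter_addn_0 leqnn.
rewrite big_seq [leqRHS]big_seq; apply: leq_sum => f; rewrite -dvdn_divisors// => fq.
rewrite sum_nat_const -cardsE.
have f0 : 0 < f by apply: dvdn_gt0 fq.
rewrite -[leqRHS](divnK fq) leq_mul2r; apply/orP; right.
rewrite -[leqRHS]card_ord.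
have lt (a : 'I_q) : a %/ f < q %/ f.
  by rewrite ltn_divLR// divnK.
rewrite -(@card_in_imset _ _ (fun a : 'I_q => Ordinal (lt a)) [set a : 'I_q | f %| a]).
  exact: max_card.
move=> a b; rewrite !inE => fa fb /(congr1 val) /= E; apply: val_inj => /=.
by rewrite -(divnK fa) E divnK.
Qed.

Lemma tau_split_ge p n : prime p -> 0 < n -> p %| n -> 2 * tau (n`_p^') <= tau n.
Proof.
move=> pp n0 pn.
set m := n`_p^'; have m0 : 0 < m by apply: part_gt0.
have pm : ~~ (p %| m).
  apply/negP => pm; have : p \in p^'.
    by apply: (pnatPpi (part_pnat p^' n)); rewrite mem_primes pp part_gt0 pm.
  by rewrite !inE eqxx.
have p0 := prime_gt0 pp.
have -> : 2 * tau m = size (divisors m ++ [seq p * d | d <- divisors m]).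
  by rewrite size_cat size_map addnn mul2n.
apply: uniq_leq_size.
  rewrite cat_uniq divisors_uniq /= map_inj_uniq ?divisors_uniq ?andbT; last first.
    by move=> x y /eqP; rewrite eqn_pmul2l// => /eqP.
  apply/hasPn => x /mapP[d _ ->]; rewrite /= -dvdn_divisors//.
  by apply: contra pm => /(dvdn_trans _); apply; rewrite dvdn_mulr.
have mn : p * m %| n.
  rewrite -(partnC p n0) dvdn_mul// p_part.
  by rewrite -[X in X %| _]expn1 dvdn_exp2l// logn_gt0 mem_primes pp n0.
move=> d; rewrite mem_cat -!dvdn_divisors// => /orP[dm|/mapP[k]].
  by apply: dvdn_trans dm _; apply: dvdn_part.
rewrite -dvdn_divisors// => km ->; apply: dvdn_trans mn.
by rewrite dvdn_pmul2l.
Qed.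

(** Both sides are built prime by prime: p^k <= 2 phi(p^k), while [tau] at least doubles with each
    new prime. *)
Lemma totient_lower n : 0 < n -> n <= tau n * totient n.
Proof.
elim/ltn_ind: n => n IH n0.
have [n1|n1] := leqP n 1.
  by have -> : n = 1 by apply/eqP; rewrite eqn_leq n1.
pose p := pdiv n; have pp : prime p by apply: pdiv_prime.
have pn : p %| n by apply: pdiv_dvd.
set m := n`_p^'.
have E : n = p ^ logn p n * m by rewrite -p_part partnC.
have l0 : 0 < logn p n by rewrite logn_gt0 mem_primes pp n0.
have cop : coprime (p ^ logn p n) m.
  by rewrite -p_part coprime_partC.
have tE : totient n = totient (p ^ logn p n) * totient m by rewrite {1}E totient_coprime.
have H1 : p ^ logn p n <= 2 * totient (p ^ logn p n).
  rewrite totient_pfactor// -{1}(prednK l0) expnS mulnA leq_mul2r.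
  by apply/orP; right; have := prime_gt1 pp; lia.
have H2 := IH m (partn_prime_lt pp n1 pn) (part_gt0 _ _).
have H3 := tau_split_ge pp n0 pn.
rewrite {1}E tE; apply: leq_trans (leq_mul H1 H2) _.
by rewrite mulnACA leq_mul.

Qed.
End ModularCounting.

Section AdditiveCharacter.
Variable R : realType.
Notation C := (complex R).
Variable q : nat.
Hypothesis q1 : (1 < q)%N.
Notation Zq := 'Z_q.

Let q0 : (0 < q)%N. Proof. exact: ltnW. Qed.
Let qR : q%:R != 0 :> R. Proof. by rewrite pnatr_eq0 -lt0n. Qed.

Lemma ltn_Zp (a : Zq) : (a < q)%N.
Proof. by rewrite -[X in (_ < X)%N](Zp_cast q1) ltn_ord. Qed.

Arguments conjc : simpl never.
Definition ez (a : Zq) : C := e ((a : nat)%:R / q%:R).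

Lemma e_natq (n : nat) : e (n%:R / q%:R : R) = ez n%:R.
Proof.
rewrite /ez val_Zp_nat// {1}(divn_eq n q) natrD natrM mulrDl mulfK// eD.
by rewrite e_nat mul1r.
Qed.

Lemma ezD a b : ez (a + b) = ez a * ez b.
Proof.
rewrite /ez -eD -mulrDl -natrD.
by rewrite [RHS]e_natq natrD !natr_Zp.
Qed.

Lemma ez0 : ez 0 = 1.
Proof. by rewrite /ez /= mul0r e0. Qed.

Lemma ezN a : ez (- a) * ez a = 1.
Proof. by rewrite -ezD addNr ez0. Qed.

Lemma nm_ez a : nm (ez a) = 1.
Proof. exact: nm_e. Qed.

Lemma e_intq (z : int) : e (z%:~R / q%:R : R) = ez z%:~R.
Proof.
case: z => n; first exact: e_natq.
have H := eN (n.+1%:R / q%:R : R).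
have n0 : e (n.+1%:R / q%:R : R) != 0.
  by apply/eqP => E; have := nm_e (n.+1%:R / q%:R : R); rewrite E nm0 => /esym/eqP; rewrite oner_eq0.
apply: (mulIf n0); rewrite NegzE mulrNz mulNr H e_natq mulrNz.
by rewrite ezN.
Qed.

Lemma conj_e (t : R) : conjc (e t) = e (- t).
Proof. by rewrite /e /= mulrN cosN sinN. Qed.

Lemma conj_ez a : conjc (ez a) = ez (- a).
Proof.
have n0 : ez a != 0 by apply/eqP => E; have := nm_ez a; rewrite E nm0 => /esym/eqP; rewrite oner_eq0.
by apply: (mulIf n0); rewrite ezN /ez conj_e eN.
Qed.

Lemma ez_neq1 a : a != 0 -> ez a != 1.
Proof.
move=> a0; apply/eqP => E.
have := nm_one_sub_e ((a : nat)%:R / q%:R : R); rewrite -/(ez a) E subrr nm0.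
have qq : (0 : R) < q%:R by rewrite ltr0n.
have pi0 := pi_gt0 R.
have t0 : 0 < (a : nat)%:R / q%:R :> R by rewrite divr_gt0// ltr0n lt0n; apply: contra a0 => /eqP H; apply/eqP/val_inj.
have t1 : (a : nat)%:R / q%:R < 1 :> R.
  by rewrite ltr_pdivrMr// mul1r ltr_nat ltn_Zp.
have s0 : 0 < sin (pi * ((a : nat)%:R / q%:R)) :> R.
  by apply: sin_gt0_pi; rewrite mulr_gt0//= -[ltRHS]mulr1 ltr_pM2l.
by rewrite gtr0_norm// => H; move: s0; lra.
Qed.

Lemma ez_sum a : \sum_(x : Zq) ez (a * x) = if a == 0 then q%:R else 0.
Proof.
case: eqP => [->|/eqP a0].
  under eq_bigr do rewrite mul0r ez0.
  by rewrite sumr_const card_ord Zp_cast.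
have : \sum_(x : Zq) ez (a * x) = ez a * \sum_(x : Zq) ez (a * x).
  rewrite [LHS](reindex_inj (addrI 1)) /= big_distrr /=; apply: eq_bigr => x _.
  by rewrite mulrDr mulr1 ezD.
move/eqP; rewrite -subr_eq0 -{1}[\sum_x _]mul1r -mulrBl mulf_eq0 subr_eq0 eq_sym.
by rewrite (negPf (ez_neq1 a0)) => /eqP.
Qed.

Lemma nm_sqr (z : C) : (nm z ^+ 2)%:C%C = z * conjc z.
Proof.
case: z => a b; rewrite /nm /= sqr_sqrtr ?addr_ge0 ?sqr_ge0//.
by rewrite -[_ * _]/(Complex _ _) /=; congr Complex; ring.
Qed.

Lemma conj_mul (z w : C) : conjc (z * w) = conjc z * conjc w.
Proof. by case: z w => [a b] [c d]; congr Complex; ring. Qed.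

Lemma conj_sum (I : finType) (P : pred I) (F : I -> C) :
  conjc (\sum_(i | P i) F i) = \sum_(i | P i) conjc (F i).
Proof. by rewrite (big_morph conjc (rmorphD _) (rmorph0 _)). Qed.

(** Once the square is opened, orthogonality in [a] and in [b] keeps exactly the pairs (i, j) with s
    i = s j and t i = t j. *)
Lemma parseval2 (I : finType) (P : pred I) (s t : I -> Zq) (c : I -> R) :
  (forall i, `|c i| <= 1) ->
  \sum_(a : Zq) \sum_(b : Zq) nm (\sum_(i | P i) (c i)%:C%C * ez (a * s i + b * t i)) ^+ 2
  <= q%:R ^+ 2 * #|[set ij : I * I | [&& P ij.1, P ij.2, s ij.1 == s ij.2 & t ij.1 == t ij.2]]|%:R.
Proof.
move=> c1.
have E : (\sum_(a : Zq) \sum_(b : Zq) nm (\sum_(i | P i) (c i)%:C%C * ez (a * s i + b * t i)) ^+ 2)%:C%C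
  = (\sum_(ij : I * I | [&& P ij.1, P ij.2, s ij.1 == s ij.2 & t ij.1 == t ij.2])
       q%:R ^+ 2 * (c ij.1 * c ij.2))%:C%C.
  rewrite rmorph_sum /=.
  under eq_bigr => a _.
    rewrite rmorph_sum /=.
    under eq_bigr => b _.
      rewrite nm_sqr conj_sum big_distrlr /=.
      under eq_bigr => i _.
        under eq_bigr => j _.
          rewrite conj_mul conjc_real conj_ez mulrACA -ezD.
          have -> : a * s i + b * t i - (a * s j + b * t j) = (s i - s j) * a + (t i - t j) * b by ring.
          rewrite ezD; over.
        over.
      rewrite pair_big /=; over.
    rewrite exchange_big /=.
    under eq_bigr => ij _.
      under eq_bigr => b _ do rewrite mulrA.
      rewrite -big_distrr /= ez_sum; over.
    over.
  rewrite exchange_big /=.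
  under eq_bigr => ij _.
    under eq_bigr => a _ do rewrite (mulrAC (_ * _) (ez _)).
    rewrite -big_distrr /= ez_sum; over.
  rewrite rmorph_sum /= [RHS]big_mkcond [LHS]big_mkcond /=; apply: eq_bigr => -[i j] _ /=.
  case: (P i) => //=; case: (P j) => //=.
  rewrite !subr_eq0; case: (s i == s j); rewrite ?mulr0//=.
  case: (t i == t j); rewrite ?mulr0 ?mul0r//=.
  by rewrite !rmorphM /= rmorph_nat; ring.
move: E => /(@complexI _ _ _) ->.
rewrite -big_distrr /= ler_wpM2l ?exprn_ge0//.
apply: (@le_trans _ _ (\sum_(ij : I * I | [&& P ij.1, P ij.2, s ij.1 == s ij.2 & t ij.1 == t ij.2]) 1)).
  apply: ler_sum => ij _; apply: le_trans (ler_norm _) _.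
  by rewrite normrM -[leRHS]mulr1 ler_pM.
by rewrite sumr_const cardsE.
Qed.

(** Two solutions differ by a solution of the homogeneous equation, that is, by a multiple of q /
    gcd(d, q). *)
Lemma card_lin (d c : Zq) : (#|[set x : Zq | (d * x == c)%R]| <= gcdn d q)%N.
Proof.
have [[x0 E0]|H] := pselect (exists x0 : Zq, d * x0 = c); last first.
  rewrite eq_card0// => x; rewrite !inE; apply/negbTE/negP => /eqP E; exact: (H (ex_intro _ x E)).
set g := gcdn d q.
have g0 : (0 < g)%N by rewrite gcdn_gt0 q0 orbT.
have gq : (g %| q)%N by apply: dvdn_gcdr.
rewrite -[leqRHS]card_ord.
have lt (x : Zq) : (((x - x0)%R : Zq) %/ (q %/ g) < g)%N.
  have qg : (0 < q %/ g)%N by rewrite divn_gt0// dvdn_leq.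
  by rewrite ltn_divLR// mulnC divnK// ltn_Zp.
rewrite -(@card_in_imset _ _ (fun x => Ordinal (lt x)) [set x : Zq | (d * x == c)%R]).
  exact: max_card.
have key (x : Zq) : d * x = c -> (q %/ g %| ((x - x0)%R : Zq))%N.
  move=> E; have H : d * (x - x0) = 0 by rewrite mulrBr E E0 subrr.
  have : (q %| (d : nat) * ((x - x0)%R : Zq))%N.
    move: H => /(congr1 (fun z : Zq => nat_of_ord z)) /=.
    by rewrite [X in (_ %% X)%N]Zp_cast// => /eqP.
  have dE : (d : nat) = (g * (d %/ g))%N by rewrite mulnC divnK// dvdn_gcdl.
  rewrite -{1}(divnK gq) mulnC {1}dE -mulnA dvdn_pmul2l// Gauss_dvdr//.
  rewrite coprime_sym /coprime -(eqn_pmul2l g0) muln_gcdr muln1.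
  by rewrite -dE mulnC divnK.
move=> x y; rewrite !inE => /eqP Ex /eqP Ey /(congr1 val) /= E.
have : x - x0 = y - x0.
  by apply: val_inj; rewrite /= -[LHS](divnK (key _ Ex)) E (divnK (key _ Ey)).
by move/addIr.
Qed.
End AdditiveCharacter.

(** * The fourth moment of Kloosterman sums *)

Section KloostermanMoment.
Variable R : realType.
Notation C := (complex R).
Variable q : nat.
Hypothesis q1 : (1 < q)%N.
Notation Zq := 'Z_q.
Variable w : Zq -> R.
Hypothesis wM : forall x t : Zq, x \is a GRing.unit -> t \is a GRing.unit -> w (x * t) = w x * w t.
Hypothesis w1 : forall x : Zq, x \is a GRing.unit -> `|w x| = 1.
Hypothesis wle : forall x : Zq, `|w x| <= 1.

(** The weight [w] will be the constant 1 or the character [chi] read modulo [q], so that plain and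
    twisted sums are treated together. *)
Definition kloosterman (a b : Zq) : C :=
  \sum_(x : Zq | x \is a GRing.unit) (w x)%:C%C * ez R (a * x + b * x^-1).
Notation K := kloosterman.

Let q0 : (0 < q)%N. Proof. exact: ltnW. Qed.

Lemma sum_gcdn_Zp : (\sum_(x : Zq) gcdn x q <= q * tau q)%N.
Proof.
rewrite -(big_mkord xpredT (fun a => gcdn a q)) Zp_cast// big_mkord.
exact: sum_gcdn.
Qed.

(* With [x1 + x2 = x3 + x4], equality of the sums of inverses reads
   [(x1 - x3) (x1 - x4) (x3 + x4) = 0]. *)
Lemma card_inverse_energy :
  (#|[set ij : (Zq * Zq) * (Zq * Zq) |
      [&& (ij.1.1 \is a GRing.unit) && (ij.1.2 \is a GRing.unit),
          (ij.2.1 \is a GRing.unit) && (ij.2.2 \is a GRing.unit),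
          (ij.1.1 + ij.1.2 == ij.2.1 + ij.2.2)%R
        & (ij.1.1^-1 + ij.1.2^-1 == ij.2.1^-1 + ij.2.2^-1)%R]]|
   <= 2 * (q * tau q) ^ 2)%N.
Proof.
(* Coordinates in which the relation is the vanishing of the product of three entries. The entry x1
   has to be kept, since the other three determine only 2 x1 and 2 may fail to be invertible modulo
   q; this is the origin of the factor 2. *)
pose phi (ij : (Zq * Zq) * (Zq * Zq)) : (Zq * Zq) * (Zq * Zq) :=
  ((ij.1.1 - ij.2.1, ij.1.1 - ij.2.2), (ij.2.1 + ij.2.2, ij.1.1))%R.
set S := [set ij | _].
pose T := [set z : (Zq * Zq) * (Zq * Zq) |
   (z.1.1 * z.1.2 * z.2.1 == 0)%R && (2 * z.2.2 == z.1.1 + z.1.2 + z.2.1)%R].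
have inj : {in S &, injective phi}.
  move=> [[x1 x2] [x3 x4]] [[y1 y2] [y3 y4]]; rewrite !inE /=.
  move=> /and4P[_ _ /eqP Ex _] /and4P[_ _ /eqP Ey _] /eqP.
  rewrite !xpair_eqE /= => /andP[/andP[/eqP E1 /eqP E2] /andP[_ /eqP E4]].
  move: E4 E1 E2 Ey => <- /addrI/oppr_inj <- /addrI/oppr_inj <-.
  by rewrite -Ex => /addrI ->.
have sub : (phi @: S \subset T)%SET.
  apply/fintype.subsetP => z /imsetP[[[x1 x2] [x3 x4]]]; rewrite inE /= => /and4P[/andP[u1 u2] /andP[u3 u4] /eqP E /eqP F] ->.
  rewrite inE /=; apply/andP; split; last by apply/eqP; ring.
  have x2E : x2 = x3 + x4 - x1 by rewrite -E; ring.
  have H : (x1 + x2) * (x3 * x4) = (x3 + x4) * (x1 * x2).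
    have I (x y : Zq) : x \is a GRing.unit -> y \is a GRing.unit -> x + y = (x^-1 + y^-1) * (x * y).
      by move=> ux uy; rewrite mulrDl mulKr// [x * y]mulrC mulKr// addrC.
    by rewrite (I x1 x2)// (I x3 x4)// F mulrAC.
  apply/eqP; rewrite E in H.
  have -> : (x1 - x3) * (x1 - x4) * (x3 + x4) = (x3 + x4) * (x3 * x4) - (x3 + x4) * (x1 * x2).
    by rewrite x2E; ring.
  by rewrite H subrr.
rewrite -(card_in_imset inj); apply: leq_trans (subset_leq_card sub) _.
have -> : #|T| = (\sum_(p : Zq * Zq) \sum_(c : Zq | (p.1 * p.2 * c == 0)%R)
     #|[set x : Zq | (2 * x == p.1 + p.2 + c)%R]|)%N.
  rewrite -sum1_card (eq_bigl (fun z => xpredT z.1 && ((z.1.1 * z.1.2 * z.2.1 == 0)%R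
     && (2 * z.2.2 == z.1.1 + z.1.2 + z.2.1)%R))); last by move=> z; rewrite inE.
  rewrite -(pair_big_dep xpredT (fun p r => (p.1 * p.2 * r.1 == 0)%R
     && (2 * r.2 == p.1 + p.2 + r.1)%R) (fun _ _ => 1%N)) /=; apply: eq_bigr => p _.
  rewrite -(pair_big_dep (fun c : Zq => (p.1 * p.2 * c == 0)%R)
     (fun c x => (2 * x == p.1 + p.2 + c)%R) (fun _ _ => 1%N)) /=.
  by apply: eq_bigr => c _; rewrite sum1dep_card.
apply: (@leq_trans (\sum_(p : Zq * Zq) gcdn p.1 q * gcdn p.2 q * 2)%N).
  apply: leq_sum => -[a b] _ /=.
  apply: (@leq_trans (\sum_(c : Zq | (a * b * c == 0)%R) 2)%N).
    apply: leq_sum => c _; apply: leq_trans (card_lin q1 _ _) _.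
    by rewrite val_Zp_nat// gcdn_modl dvdn_leq// dvdn_gcdl.
  rewrite sum_nat_const leq_mul2r /=.
  have := card_lin q1 (a * b) 0; rewrite cardsE => H.
  apply: leq_trans H _.
  have -> : (a * b)%R = ((a : nat) * (b : nat))%N%:R by rewrite natrM !natr_Zp.
  by rewrite val_Zp_nat// gcdn_modl; exact: gcdnM_le.
rewrite -(pair_bigA _ (fun a b : Zq => gcdn a q * gcdn b q * 2)%N) /=.
under eq_bigr do rewrite -big_distrl -big_distrr /=.
rewrite -big_distrl -big_distrl /= mulnC leq_mul2l /= -mulnn.
by apply: leq_mul; exact: sum_gcdn_Zp.
Qed.

(** The fourth power of the norm of K is the squared norm of K^2, a sum over pairs (x, y) with
    frequencies x + y and 1/x + 1/y, so [parseval2] reduces the moment to the count above. *)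
Lemma kloosterman_full_moment :
  \sum_(a : Zq) \sum_(b : Zq) nm (K a b) ^+ 4 <= q%:R ^+ 2 * (2 * (q * tau q) ^ 2)%:R.
Proof.
have E a b : nm (K a b) ^+ 4 = nm (\sum_(i : Zq * Zq | (i.1 \is a GRing.unit) && (i.2 \is a GRing.unit))
   (w i.1 * w i.2)%:C%C * ez R (a * (i.1 + i.2) + b * (i.1^-1 + i.2^-1))) ^+ 2.
  have -> : nm (K a b) ^+ 4 = (nm (K a b * K a b)) ^+ 2 by rewrite nmM; ring.
  congr (nm _ ^+ 2); rewrite /K big_distrlr pair_big /=; apply: eq_bigr => -[x y] _ /=.
  rewrite mulrACA -ezD// rmorphM /=; congr (_ * ez _ _); ring.
under eq_bigr => a _ do under eq_bigr => b _ do rewrite E.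
apply: le_trans (parseval2 q1 _ _ _ _) _.
  by move=> [x y] /=; rewrite normrM -[leRHS]mulr1 ler_pM.
by rewrite ler_wpM2l ?exprn_ge0// ler_nat; exact: card_inverse_energy.
Qed.

Lemma kloosterman_scale (h b t : Zq) : t \is a GRing.unit ->
  nm (K (h * t) (b * t^-1)) = nm (K h b).
Proof.
move=> ut.
have -> : K h b = (w t)%:C%C * K (h * t) (b * t^-1).
  rewrite [LHS](reindex_inj (mulIr ut)) /= big_distrr /=.
  apply: eq_big => [x|x]; first by rewrite unitrMl.
  rewrite unitrMl// => ux.
  rewrite wM// rmorphM /= mulrA [(w t)%:C%C * _]mulrC; congr (_ * _ * ez _ _).
  by rewrite invrM//; ring.
by rewrite nmM nm_real w1// mul1r.
Qed.

Lemma sum_unit_orbit (f : Zq -> R) (b : Zq) : (forall x, 0 <= f x) ->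
  \sum_(t : Zq | t \is a GRing.unit) f (b * t^-1) <= (gcdn b q)%:R * \sum_(x : Zq) f x.
Proof.
move=> f0.
rewrite (partition_big (fun t : Zq => b * t^-1) predT) //= big_distrr /=.
apply: ler_sum => y _.
rewrite (eq_bigr (fun _ => f y)); last by move=> t /andP[_ /eqP ->].
rewrite sumr_const -[f y *+ _]mulr_natl ler_wpM2r// ler_nat.
apply: leq_trans (card_lin q1 b y).
rewrite -(card_imset _ (@invr_inj Zq)).
apply: subset_leq_card; apply/fintype.subsetP => u /imsetP[t]; rewrite !inE => /andP[_ /eqP E] ->.
by rewrite E.
Qed.

Lemma card_units : #|[pred x : Zq | x \is a GRing.unit]| = totient q.
Proof.
rewrite -card_units_Zp// /units_Zp cardsT card_sub.
by apply: eq_card => x; rewrite !inE.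
Qed.

(** Since K (h t) (b / t) has the norm of K h b, the moment at a single [b] may be averaged over the
    units t. As t varies, b / t takes each value at most gcd(b, q) times, so the average is
    controlled by the moment over both arguments; q / phi(q) <= tau(q) accounts for the number of
    units. *)
Theorem kloosterman_fourth_moment (b : Zq) :
  \sum_(h : Zq) nm (K h b) ^+ 4 <= 2 * (gcdn b q)%:R * q%:R ^+ 3 * (tau q)%:R ^+ 3.
Proof.
set S := \sum_(h : Zq) _.
have S0 : 0 <= S by apply: sumr_ge0 => h _; rewrite exprn_ge0 ?nm_ge0.
have H : (totient q)%:R * S <= (gcdn b q)%:R * (q%:R ^+ 2 * (2 * (q * tau q) ^ 2)%:R).
  apply: le_trans (_ : (gcdn b q)%:R * (\sum_(h : Zq) \sum_(x : Zq) nm (K h x) ^+ 4) <= _);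
    last by rewrite ler_wpM2l ?ler0n// kloosterman_full_moment.
  rewrite -card_units mulr_natl -sumr_const /=.
  have E (t : Zq) : t \is a GRing.unit -> S = \sum_(h : Zq) nm (K h (b * t^-1)) ^+ 4.
    move=> ut; rewrite [RHS](reindex_inj (mulIr ut)).
    by apply: eq_bigr => h _; rewrite (kloosterman_scale h b ut).
  rewrite (eq_bigr (fun t : Zq => \sum_(h : Zq) nm (K h (b * t^-1)) ^+ 4)); last by move=> t; rewrite inE; exact: E.
  rewrite exchange_big /= big_distrr /=; apply: ler_sum => h _.
  apply: le_trans (sum_unit_orbit (f := fun x => nm (K h x) ^+ 4) b _).
    by rewrite (eq_bigl (fun t : Zq => t \is a GRing.unit))// => t; rewrite inE.
  by move=> x; rewrite exprn_ge0 ?nm_ge0.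
have qp : 0 < q%:R :> R by rewrite ltr0n.
have T : q%:R <= (tau q)%:R * (totient q)%:R :> R by rewrite -natrM ler_nat totient_lower.
rewrite -(ler_pM2l qp).
apply: le_trans (ler_wpM2r S0 T) _.
rewrite -[(tau q)%:R * _ * S]mulrA; apply: le_trans (ler_wpM2l (ler0n _ _) H) _.
by rewrite natrM natrX natrM le_eqVlt; apply/orP; left; apply/eqP; ring.
Qed.
End KloostermanMoment.

(** * Oscillatory sums *)

Section OscillatorySum.
Variable R : realType.
Notation C := (complex R).
Notation nm := (@nm R).
Notation e := (@e R).

Lemma nm_sum_shift (F : nat -> R) (a b : nat) :
  \sum_(a <= n < b) e (F n + n%:R) = \sum_(a <= n < b) e (F n).
Proof. by apply: eq_bigr => n _; rewrite eD e_nat mulr1. Qed.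

(** Adding n to the phase leaves the terms unchanged and moves all increments up by 1. *)
Lemma kusmin_landau_neg (F : nat -> R) (a b : nat) (D : R) : 0 < D ->
  (forall n, (a <= n < b)%N -> -1 + D <= F n.+1 - F n <= - D) ->
  (forall n, (a <= n)%N -> (n.+1 < b)%N -> F n.+1 - F n <= F n.+2 - F n.+1) ->
  nm (\sum_(a <= n < b) e (F n)) <= 2 / D.
Proof.
move=> D0 gD gm; rewrite -nm_sum_shift; apply: kusmin_landau => //.
  by move=> n /gD /andP[? ?]; rewrite -natr1; apply/andP; split; lra.
by move=> n an nb; have := gm n an nb; rewrite -!natr1; lra.
Qed.

Lemma nm_sum_trivial (F : nat -> R) (a b : nat) :
  nm (\sum_(a <= n < b) e (F n)) <= (b - a)%:R.
Proof.
apply: le_trans (nm_sum _ _ _) _.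
under eq_bigr do rewrite nm_e.
by rewrite sumr_const_nat.
Qed.

Lemma monotone_split (u : nat -> R) (y : R) (a b : nat) : (a <= b)%N ->
  (forall n, (a <= n)%N -> u n.+1 <= u n) ->
  exists m, [/\ (a <= m)%N, (m <= b)%N, (forall n, (a <= n < m)%N -> y <= u n)
     & forall n, (m <= n)%N -> (n < b)%N -> u n < y].
Proof.
move=> ab ud.
have mono n k : (a <= n)%N -> u (n + k)%N <= u n.
  move=> an; elim: k => [|k IH]; first by rewrite addn0.
  by rewrite addnS; apply: le_trans (ud _ _) IH; nlia.
elim: b ab => [|b IH] ab; first by exists a; split=> // n; nlia.
have [ab'|ab'] := leqP a b; last by exists a; split=> // [n|n]; nlia.
have [m [am mb h1 h2]] := IH ab'.
have [yu|uy] := leP y (u b).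
  exists b.+1; split=> // n; last nlia.
  move=> nb; apply: le_trans yu _; have := mono n (b - n)%N ltac:(nlia).
  by rewrite subnKC//; nlia.
exists m; split=> // [|n mn nb]; first nlia.
have [->//|nb'] := eqVneq n b.
by apply: h2 => //; rewrite ltn_neqAle nb' -ltnS.
Qed.

(** * Sums with the phase (V / n + h n) / q *)

Section Phase.
Variables (V : R) (q a b : nat) (h : int).
Hypotheses (V0 : 0 < V) (q1 : (1 < q)%N) (a0 : (0 < a)%N).
Hypothesis aV : 4 * V <= q%:R * a%:R ^+ 2.
Hypothesis bV : (a < b)%N -> b.-1%:R ^+ 2 <= V.
Hypothesis hq : `|h|%:~R *+ 2 <= q%:R :> R.

Let F (n : nat) : R := (V / n%:R + h%:~R * n%:R) / q%:R.
(** The decrease of V / n in one step, so that the phase has increments (h - u n) / q. By [aV] and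
    [bV], u n lies between 1/2 and q / 4 in the range of summation, and |h| <= q / 2 by [hq]; the
    increments therefore stay between -3/4 and 1/2. *)
Let u (n : nat) : R := V / (n%:R * n.+1%:R).

Let q0 : 0 < q%:R :> R. Proof. by rewrite ltr0n; nlia. Qed.

Let dF n : (a <= n)%N -> F n.+1 - F n = (h%:~R - u n) / q%:R.
Proof.
move=> an; rewrite /F /u -natr1.
have n0 : 0 < n%:R :> R by rewrite ltr0n; nlia.
field.
by rewrite !gt_eqF//=; lra.
Qed.

Let uE n : (a <= n)%N -> u n - u n.+1 = 2 * V / (n%:R * n.+1%:R * n.+2%:R).
Proof.
move=> an; rewrite /u -[n.+2%:R]natr1 -natr1.
have n0 : 0 < n%:R :> R by rewrite ltr0n; nlia.
field.
by rewrite !gt_eqF//=; lra.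
Qed.

Let ud n : (a <= n)%N -> u n.+1 <= u n.
Proof.
move=> an; rewrite -subr_ge0 uE// divr_ge0 ?mulr_ge0 ?ler0n//; exact: ltW.
Qed.

Let u_gt0 n : (a <= n)%N -> 0 < u n.
Proof. by move=> an; rewrite divr_gt0// mulr_gt0 ?ltr0n//; nlia. Qed.

Let u_le n : (a <= n)%N -> u n <= q%:R / 4.
Proof.
move=> an; rewrite /u ler_pdivrMr; last by rewrite mulr_gt0 ?ltr0n//; nlia.
have an' : a%:R <= n%:R :> R by rewrite ler_nat.
have a0' : 0 < a%:R :> R by rewrite ltr0n.
have H : a%:R ^+ 2 <= n%:R * n.+1%:R :> R.
  by rewrite expr2; apply: ler_pM; rewrite ?ler0n ?ler_nat//; nlia.
have := ler_wpM2l (ltW q0) H; move: aV; lra.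
Qed.

Let u_ge n : (a <= n)%N -> (n < b)%N -> 1 / 2 <= u n.
Proof.
move=> an nb; rewrite /u ler_pdivlMr; last by rewrite mulr_gt0 ?ltr0n//; nlia.
have nb' : n%:R <= b.-1%:R :> R by rewrite ler_nat; nlia.
have n1 : 1 <= n%:R :> R by rewrite ler1n; nlia.
have := bV (leq_ltn_trans an nb).
have : n%:R ^+ 2 <= b.-1%:R ^+ 2 :> R by rewrite lerXn2r ?nnegrE ?ler0n.
rewrite -[n.+1%:R]natr1 expr2; move: n1; move: (n%:R : R) => N N1.
have : N <= N * N by rewrite ler_peMl//; lra.
lra.
Qed.

Let gmono n : (a <= n)%N -> F n.+1 - F n <= F n.+2 - F n.+1.
Proof.
move=> an; rewrite !dF//; last nlia.
by rewrite ler_pM2r ?invr_gt0// lerD2l lerN2 ud.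
Qed.

Let S := \sum_(a <= n < b) e (F n).

(** There is no stationary point: h - u n <= -(|h| + 1/2). The lower bound 1/2 for u n is what
    provides a gap also for h = 0. *)
Lemma osc_nonpos : h <= 0 -> nm S <= 8 * q%:R / (`|h|%:~R + 1).
Proof.
move=> h0.
set j : R := `|h|%:~R.
have hj : h%:~R = - j by rewrite /j ler0_norm// rmorphN opprK.
have j0 : 0 <= j by rewrite ler0z.
have jq : 2 * j <= q%:R by rewrite mulr_natl.
have q2 : 2 <= q%:R :> R by rewrite ler_nat.
have -> : 8 * q%:R / (j + 1) = 2 / ((j + 1) / (4 * q%:R)).
  by field; rewrite !gt_eqF//; lra.
apply: kusmin_landau_neg; first by rewrite divr_gt0//; lra.
  move=> n /andP[an nb]; rewrite dF// hj.
  have := u_le an; have := u_ge an nb; set w := u n => w1 w2.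
  have iq : 0 <= q%:R^-1 :> R by rewrite invr_ge0 ltW.
  have E : (j + 1) / (4 * q%:R) = (j + 1) / 4 / q%:R by field; rewrite gt_eqF.
  have E2 : q%:R / q%:R = 1 :> R by rewrite divff// gt_eqF.
  have L1 : - q%:R + (j + 1) / 4 <= - j - w by lra.
  have L2 : - j - w <= - ((j + 1) / 4) by lra.
  have := ler_wpM2r iq L1; have := ler_wpM2r iq L2; rewrite E !mulrDl !mulNr E2.
  by move=> ? ?; apply/andP; split; lra.
by move=> n an _; apply: gmono.
Qed.

Section Positive.
Variables eta y0 : R.
Hypotheses (etaE : h%:~R = eta) (eta1 : 1 <= eta) (etaq : 2 * eta <= q%:R).
Hypotheses (y0p : 0 < y0) (y02 : y0 ^+ 2 = 2 * V / eta).

(** On this range u n >= eta / 2, hence n <= y0, and u drops by at least eta / (3 y0) at each step,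
    while its total drop is at most 2 D. *)
Lemma osc_middle (D : R) (n1 n2 : nat) : (a <= n1)%N -> 0 < D -> D <= eta / 2 ->
  (forall n, (n1 <= n)%N -> (n < n2)%N -> eta - D <= u n /\ u n < eta + D) ->
  (n2 - n1)%:R <= 1 + 6 * D * y0 / eta.
Proof.
move=> an1 D0 De mid.
have e0 : 0 < eta by lra.
have [n21|n12] := leqP n2 n1.
  have -> : (n2 - n1 = 0)%N by nlia.
  by apply: addr_ge0 => //; apply: divr_ge0; rewrite ?mulr_ge0// ?ltW.
have ny n : (n1 <= n)%N -> (n < n2)%N -> n%:R * n.+1%:R <= y0 ^+ 2.
  move=> h1 h2; have [m1 _] := mid n h1 h2.
  have n0 : 0 < n%:R * n.+1%:R :> R by rewrite mulr_gt0 ?ltr0n//; nlia.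
  rewrite y02 ler_pdivlMr//.
  have : eta / 2 <= u n by lra.
  by rewrite /u ler_pdivlMr//; lra.
have step n : (n1 <= n)%N -> (n.+1 < n2)%N -> eta / (3 * y0) <= u n - u n.+1.
  move=> h1 h2; rewrite uE; last nlia.
  have n0 : 1 <= n%:R :> R by rewrite ler1n; nlia.
  have ny' := ny n h1 (ltnW h2).
  have nley : n%:R <= y0.
    rewrite -(@ler_pXn2r _ 2)// ?nnegrE ?ler0n ?(ltW y0p)//; apply: le_trans ny'.
    by rewrite expr2 ler_wpM2l ?ler0n// ler_nat.
  have -> : eta / (3 * y0) = 2 * V / (y0 ^+ 2 * (3 * y0)).
    by rewrite y02; field; rewrite !gt_eqF.
  apply: ler_wpM2l; first by rewrite mulr_ge0// ltW.
  have p0 : 0 < n%:R * n.+1%:R :> R by rewrite mulr_gt0 ?ltr0n//; nlia.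
  rewrite lef_pV2 ?posrE ?mulr_gt0 ?exprn_gt0 ?ltr0n//; last nlia.
  by apply: ler_pM; [exact: ltW|exact: ler0n|by []|rewrite -addn2 natrD; lra].
have sum j : (n1 + j < n2)%N -> j%:R * (eta / (3 * y0)) <= u n1 - u (n1 + j)%N.
  elim: j => [|j IH] h1; first by rewrite addn0 subrr mul0r.
  have := IH ltac:(nlia); have := step (n1 + j)%N ltac:(nlia) ltac:(nlia).
  by rewrite addnS -natr1 mulrDl mul1r; lra.
have := sum (n2 - n1).-1 ltac:(nlia).
have [_ m2] := mid n1 (leqnn _) n12.
have [m1 _] := mid (n1 + (n2 - n1).-1)%N ltac:(nlia) ltac:(nlia).
move=> H; have {}H : (n2 - n1).-1%:R * (eta / (3 * y0)) <= 2 * D by lra.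
have l0 : 0 < eta / (3 * y0) by rewrite divr_gt0// mulr_gt0.
move: H; rewrite -ler_pdivlMr// => H.
have -> : (n2 - n1)%:R = 1 + (n2 - n1).-1%:R :> R by rewrite addrC natr1; congr _%:R; nlia.
rewrite lerD2l (le_trans H)// le_eqVlt; apply/orP; left; apply/eqP.
by field; rewrite !gt_eqF.
Qed.

(** The increments change sign where u n passes [eta]. Outside the window of half-width [D] around
    this value the Kusmin-Landau inequality applies on either side with gap D / q; inside it the
    terms are merely counted. *)
Lemma osc_split (D : R) : 0 < D -> D <= eta / 2 ->
  nm S <= 4 * q%:R / D + 1 + 6 * D * y0 / eta.
Proof.
move=> D0 De.
have e0 : 0 < eta by lra.
have rhs0 : 0 <= 4 * q%:R / D + 1 + 6 * D * y0 / eta.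
  by apply: addr_ge0; [apply: addr_ge0 => //|]; rewrite divr_ge0 ?mulr_ge0 ?ltW.
have iq : 0 <= q%:R^-1 :> R by rewrite invr_ge0 ltW.
have E2 : q%:R / q%:R = 1 :> R by rewrite divff// gt_eqF.
have [ba|ab] := leqP b a; first by rewrite /S big_geq// nm0.
have [n1 [an1 n1b A1 B1]] := monotone_split (eta + D) (ltnW ab) ud.
have [|n2 [n12 n2b A2 B2]] := @monotone_split u (eta - D) n1 b n1b.
  by move=> n hn; apply: ud; nlia.
rewrite /S (big_cat_nat (n := n1))//= (big_cat_nat (n := n2) (m := n1))//=.
apply: le_trans (nmD _ _) _.
have H1 : nm (\sum_(a <= i < n1) e (F i)) <= 2 / (D / q%:R).
  apply: kusmin_landau_neg; first by rewrite divr_gt0.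
    move=> n hn; rewrite dF; last by case/andP: hn.
    have := A1 n hn; have := u_le (n := n) ltac:(nlia).
    rewrite etaE; move: (u n) => w w1 w2.
    have L1 : - q%:R + D <= eta - w by lra.
    have L2 : eta - w <= - D by lra.
    have := ler_wpM2r iq L1; have := ler_wpM2r iq L2; rewrite !mulrDl !mulNr E2.
    by move=> ? ?; apply/andP; split; lra.
  by move=> n an _; apply: gmono.
have H2 : nm (\sum_(n1 <= i < n2) e (F i)) <= 1 + 6 * D * y0 / eta.
  apply: le_trans (nm_sum_trivial _ _ _) _; apply: osc_middle => // n h1 h2.
  by split; [apply: A2; rewrite h1|apply: B1 => //; nlia].
have H3 : nm (\sum_(n2 <= i < b) e (F i)) <= 2 / (D / q%:R).
  apply: kusmin_landau; first by rewrite divr_gt0.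
    move=> n hn; rewrite dF; last nlia.
    have w1 : u n < eta - D by apply: B2; nlia.
    have w2 : 0 < u n by apply: u_gt0; nlia.
    rewrite etaE; move: (u n) w1 w2 => w w1 w2.
    have L1 : D <= eta - w by lra.
    have L0 : eta + D <= q%:R by apply: le_trans etaq; lra.
    have L2 : eta - w <= q%:R - D by lra.
    have := ler_wpM2r iq L1; have := ler_wpM2r iq L2; rewrite !mulrDl !mulNr E2.
    by move=> ? ?; apply/andP; split; lra.
  by move=> n an _; apply: gmono; nlia.
apply: le_trans (lerD H1 (le_trans (nmD _ _) (lerD H2 H3))) _.
have -> : 2 / (D / q%:R) = 2 * q%:R / D by field; rewrite !gt_eqF.
lra.
Qed.

Lemma osc_pos : nm S <= 21 * q%:R / eta + 10 * Num.sqrt (q%:R * y0 / eta).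
Proof.
have eta1' := eta1; have etaq' := etaq.
have e0 : 0 < eta by lra.
set T := Num.sqrt _.
have T0 : 0 < T by rewrite sqrtr_gt0 divr_gt0 ?mulr_gt0.
have T2 : T ^+ 2 = q%:R * y0 / eta by rewrite sqr_sqrtr// divr_ge0 ?mulr_ge0 ?ltW.
have qe : 1 <= q%:R / eta by rewrite ler_pdivlMr//; lra.
have y0E : y0 = eta * T ^+ 2 / q%:R by rewrite T2; field; rewrite !gt_eqF.
have [c|c] := leP (q%:R / T) (eta / 2).
  have := osc_split (divr_gt0 q0 T0) c.
  rewrite y0E.
  have -> : 4 * q%:R / (q%:R / T) + 1 + 6 * (q%:R / T) * (eta * T ^+ 2 / q%:R) / eta = 10 * T + 1.
    by field; rewrite !gt_eqF.
  by rewrite -mulrA; lra.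
have := @osc_split (eta / 2) ltac:(lra) (lexx _).
have -> : 4 * q%:R / (eta / 2) + 1 + 6 * (eta / 2) * y0 / eta = 8 * (q%:R / eta) + 1 + 3 * y0.
  by field; rewrite !gt_eqF.
have yq : y0 <= 4 * (q%:R / eta).
  have Tq : T <= 2 * (q%:R / eta).
    have cT : eta / 2 * T <= q%:R by move: c; rewrite ltr_pdivlMr// => /ltW.
    by rewrite mulrA ler_pdivlMr//; lra.
  rewrite y0E ler_pdivrMr// expr2.
  have : T * T <= 2 * (q%:R / eta) * (2 * (q%:R / eta)) by apply: ler_pM => //; exact: ltW.
  move/(ler_wpM2l (ltW e0)) => /le_trans; apply.
  by rewrite le_eqVlt; apply/orP; left; apply/eqP; field; rewrite gt_eqF.
by rewrite -[21 * _ / _]mulrA; lra.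
Qed.
End Positive.

(** For h > 0 the square root in [osc_pos] is of order q^(1/2) V^(1/4) h^(-3/4). Hence the weight
    H^(3/4), written as sqrt (H sqrt H), in which all signs of [h] are covered by one bound. *)
Lemma osc_sum (H : R) : H = `|h|%:~R + 1 ->
  nm S <= (42 * q%:R + 20 * Num.sqrt (q%:R * Num.sqrt V)) / Num.sqrt (H * Num.sqrt H).
Proof.
move=> HE0; have qp := ltW q0.
have j0 : 0 <= `|h|%:~R :> R by rewrite ler0z.
have H1 : 1 <= H by rewrite HE0; lra.
have sH1 : 1 <= Num.sqrt H by rewrite -(@sqrtr1 R) ler_wsqrtr.
have sH2 : Num.sqrt H ^+ 2 = H by rewrite sqr_sqrtr//; lra.
set w := Num.sqrt (H * Num.sqrt H).
have w0 : 0 < w by rewrite sqrtr_gt0 mulr_gt0//; lra.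
have w2 : w ^+ 2 = H * Num.sqrt H by rewrite sqr_sqrtr// mulr_ge0//; lra.
have wH : w <= H.
  rewrite -(@ler_pXn2r _ 2)// ?nnegrE; try lra.
  by rewrite w2 expr2 ler_wpM2l//; [lra|rewrite -[leRHS]sH2 expr2 ler_peMl//; lra].
have sV0 : 0 <= Num.sqrt (q%:R * Num.sqrt V) by exact: sqrtr_ge0.
have [h0|h0] := leP h 0.
  apply: le_trans (osc_nonpos h0) _; rewrite -HE0.
  apply: (@le_trans _ _ (8 * q%:R / w)).
    by rewrite ler_wpM2l ?mulr_ge0 ?ler0n// lef_pV2 ?posrE//; lra.
  by rewrite ler_pM2r ?invr_gt0//; lra.
have [eta etaE] : exists eta : R, h%:~R = eta by exists h%:~R.
have eta1 : 1 <= eta by rewrite -etaE (ler_int _ 1)// gtz0_ge1.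
have etaq : 2 * eta <= q%:R by rewrite mulr_natl -etaE; move: hq; rewrite gtr0_norm.
have HE : H = eta + 1 by rewrite HE0 gtr0_norm// etaE.
have y0p : 0 < Num.sqrt (2 * V / eta).
  by rewrite sqrtr_gt0 divr_gt0 ?mulr_gt0//; exact: lt_le_trans eta1.
have y02 : Num.sqrt (2 * V / eta) ^+ 2 = 2 * V / eta.
  by rewrite sqr_sqrtr// divr_ge0 ?mulr_ge0// ?(ltW V0)//; lra.
apply: le_trans (osc_pos etaE eta1 etaq y0p y02) _.
have L1 : 21 * q%:R / eta <= 42 * q%:R / w.
  rewrite ler_pdivrMr; last lra.
  rewrite mulrAC ler_pdivlMr//.
  have : w * q%:R <= 2 * eta * q%:R by rewrite ler_wpM2r ?ler0n//; lra.
  lra.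
rewrite [leRHS]mulrDl; apply: (lerD L1).
set T := Num.sqrt _.
have T2 : T ^+ 2 = q%:R * Num.sqrt (2 * V / eta) / eta.
  by rewrite sqr_sqrtr// divr_ge0 ?mulr_ge0 ?sqrtr_ge0 ?ler0n//; lra.
have sV2 : Num.sqrt (q%:R * Num.sqrt V) ^+ 2 = q%:R * Num.sqrt V.
  by rewrite sqr_sqrtr// mulr_ge0 ?sqrtr_ge0 ?ler0n.
suff Tw : T * w <= 2 * Num.sqrt (q%:R * Num.sqrt V).
  by rewrite ler_pdivlMr//; lra.
have T0 : 0 <= T by apply: sqrtr_ge0.
rewrite -(@ler_pXn2r _ 2)// ?nnegrE ?mulr_ge0//; last exact: ltW.
rewrite !exprMn T2 w2 sV2.
have e0 : 0 < eta by lra.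
have -> : q%:R * Num.sqrt (2 * V / eta) / eta * (H * Num.sqrt H)
   = q%:R * ((Num.sqrt (2 * V / eta) * Num.sqrt H) * (H / eta)) by field; rewrite gt_eqF.
have -> : 2 ^+ 2 * (q%:R * Num.sqrt V) = q%:R * (2 * Num.sqrt V * 2) by ring.
rewrite ler_wpM2l ?ler0n//.
have He : H / eta <= 2 by rewrite ler_pdivrMr//; lra.
have A1 : Num.sqrt (2 * V / eta) * Num.sqrt H <= 2 * Num.sqrt V.
  rewrite -sqrtrM; last by rewrite divr_ge0 ?mulr_ge0// ltW.
  have -> : 2 * Num.sqrt V = Num.sqrt (2 ^+ 2 * V).
    by rewrite sqrtrM ?exprn_ge0// sqrtr_sqr ger0_norm.
  apply: ler_wsqrtr.
  have -> : 2 * V / eta * H = 2 * V * (H / eta) by ring.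
  have -> : 2 ^+ 2 * V = 2 * V * 2 by ring.
  by rewrite ler_wpM2l// mulr_ge0// ltW.
by apply: ler_pM; [rewrite mulr_ge0 ?sqrtr_ge0|rewrite divr_ge0//; lra|exact: A1|exact: He].
Qed.
End Phase.
End OscillatorySum.

Lemma centered_aux (z q : nat) : (z < q)%N ->
  `|if (2 * z <= q)%N then z%:Z else z%:Z - q%:Z| * 2 <= q%:Z.
Proof.
move=> zq; case: leqP => H /=.
  by rewrite ger0_norm// -[2]/(Posz 2) -PoszM lez_nat mulnC.
rewrite distrC subzn ?(ltnW zq)// ger0_norm// -[2]/(Posz 2) -PoszM lez_nat.
by move: H zq; clear; lia.
Qed.

(** * Representatives of least absolute value *)

Section Centered.
Variable R : realType.
Variable q : nat.
Hypothesis q1 : (1 < q)%N.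
Notation Zq := 'Z_q.

Definition centered (z : Zq) : int := if (2 * z <= q)%N then (z : nat)%:Z else (z : nat)%:Z - q%:Z.

Lemma centeredK (z : Zq) : (centered z)%:~R = z :> Zq.
Proof.
rewrite /centered; case: ifP => _; first by rewrite -pmulrn natr_Zp.
by rewrite rmorphB /= -!pmulrn natr_Zp pchar_Zp// subr0.
Qed.

Lemma centered_le (z : Zq) : `|centered z|%:~R *+ 2 <= q%:R :> R.
Proof.
have zq := ltn_Zp q1 z.
have -> : `|centered z|%:~R *+ 2 = (`|centered z| * 2)%:~R :> R by rewrite rmorphM /= mulr_natr.
rewrite [q%:R]pmulrn ler_int /centered.
exact: centered_aux.
Qed.

End Centered.

(** * Completion *)

Section CauchySchwarz.
Variable R : realType.

Lemma cauchy_schwarz (I : finType) (f g : I -> R) :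
  (\sum_i f i * g i) ^+ 2 <= (\sum_i f i ^+ 2) * (\sum_i g i ^+ 2).
Proof.
have H : 0 <= \sum_i \sum_j (f i * g j - f j * g i) ^+ 2.
  by apply: sumr_ge0 => i _; apply: sumr_ge0 => j _; apply: sqr_ge0.
have E : \sum_i \sum_j (f i * g j - f j * g i) ^+ 2
  = 2 * ((\sum_i f i ^+ 2) * (\sum_i g i ^+ 2)) - 2 * (\sum_i f i * g i) ^+ 2.
  transitivity (\sum_i \sum_j f i ^+ 2 * g j ^+ 2 + \sum_i \sum_j f j ^+ 2 * g i ^+ 2
     - 2 * \sum_i \sum_j (f i * g i) * (f j * g j)).
    rewrite -big_split /= mulr_sumr -sumrB; apply: eq_bigr => i _.
    rewrite -big_split /= mulr_sumr -sumrB; apply: eq_bigr => j _; ring.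
  by rewrite [X in _ + X - _]exchange_big -!big_distrlr /= expr2; ring.
by move: H; rewrite E; lra.
Qed.

Definition harm (N : nat) : R := \sum_(1 <= j < N.+1) j%:R^-1.

Lemma harm_ge0 N : 0 <= harm N.
Proof. by apply: sumr_ge0 => j _; rewrite invr_ge0. Qed.
End CauchySchwarz.

Section Completion.
Variable R : realType.
Notation C := (complex R).
Notation nm := (@nm R).
Notation e := (@e R).
Variable q : nat.
Hypothesis q1 : (1 < q)%N.
Notation Zq := 'Z_q.
Notation ez := (@ez R q).
Variable w : Zq -> R.
Hypothesis wM : forall x t : Zq, x \is a GRing.unit -> t \is a GRing.unit -> w (x * t) = w x * w t.
Hypothesis w1 : forall x : Zq, x \is a GRing.unit -> `|w x| = 1.
Hypothesis wle : forall x : Zq, `|w x| <= 1.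
Notation K := (kloosterman w).

Let q0 : (0 < q)%N. Proof. exact: ltnW. Qed.
Let qR : q%:R != 0 :> R. Proof. by rewrite pnatr_eq0 -lt0n. Qed.

Definition wt (z : Zq) : R := `|centered z|%:~R + 1.

Lemma wt_ge1 z : 1 <= wt z.
Proof. by rewrite /wt lerDr ler0z. Qed.

Lemma sum_inv_wt : \sum_(z : Zq) (wt z)^-1 <= 2 * harm R q.
Proof.
have H (z : Zq) : (wt z)^-1 <= (z.+1)%:R^-1 + (q - z)%:R^-1 :> R.
  have zq := ltn_Zp q1 z.
  have a0 : 0 <= (z.+1)%:R^-1 :> R by rewrite invr_ge0.
  have b0 : 0 <= (q - z)%:R^-1 :> R by rewrite invr_ge0.
  rewrite /wt /centered; case: ifP => _.
    by rewrite /= natr1 lerDl.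
  have -> : `|(z : nat)%:Z - q%:Z|%:~R = (q - z)%:R :> R.
    by rewrite distrC subzn ?(ltnW zq)// ger0_norm.
  have c0 : 0 < (q - z)%:R :> R by rewrite ltr0n subn_gt0.
  apply: (@le_trans _ _ ((q - z)%:R^-1)); last by rewrite lerDr.
  by rewrite lef_pV2 ?posrE ?lerDl// addr_gt0.
apply: le_trans (ler_sum _ (fun z _ => H z)) _.
rewrite big_split /= -(big_mkord xpredT (fun z => (z.+1)%:R^-1 : R)) -(big_mkord xpredT (fun z => (q - z)%:R^-1 : R)).
rewrite Zp_cast// mulr_natl mulr2n /harm.
rewrite [X in _ <= X + _]big_add1 /= lerD2l.
rewrite big_nat_rev /= big_add1 /=; apply: ler_sum_nat => j /andP[_ jq].
by rewrite add0n subKn.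
Qed.

(** The power q^(3/4) that results from the fourth moment, written with square roots so that its
    fourth power is q^3 by algebra alone. *)
Definition q34 : R := Num.sqrt (q%:R * Num.sqrt q%:R).

Lemma q34_4 : q34 ^+ 4 = q%:R ^+ 3.
Proof.
have -> : q34 ^+ 4 = (q34 ^+ 2) ^+ 2 by rewrite -exprM.
rewrite sqr_sqrtr ?mulr_ge0 ?sqrtr_ge0// exprMn sqr_sqrtr//; ring.
Qed.

Lemma q34_ge0 : 0 <= q34. Proof. exact: sqrtr_ge0. Qed.

Variable th : R.
Hypotheses (th_harm : harm R q <= th) (th_tau : (tau q)%:R <= th).

Lemma th1 : 1 <= th.
Proof. by apply: le_trans th_tau; rewrite ler1n tau_gt0. Qed.

(* Two applications of Cauchy-Schwarz reduce to the fourth moment. *)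
Lemma weighted_kloosterman (h0 b : Zq) :
  \sum_(z : Zq) nm (K (h0 - z) b) / Num.sqrt (wt z * Num.sqrt (wt z))
  <= 2 * th ^+ 2 * (gcdn b q)%:R * q34.
Proof.
have th1' := th1.
set S := \sum_(z : Zq) _.
pose k z := nm (K (h0 - z) b).
have k0 z : 0 <= k z by apply: nm_ge0.
have W1 z := wt_ge1 z.
have sW1 z : 1 <= Num.sqrt (wt z) by rewrite -(@sqrtr1 R) ler_wsqrtr.
have sW2 z : Num.sqrt (wt z) ^+ 2 = wt z by rewrite sqr_sqrtr//; have := W1 z; lra.
have ssW2 z : Num.sqrt (Num.sqrt (wt z)) ^+ 2 = Num.sqrt (wt z) by rewrite sqr_sqrtr// sqrtr_ge0.
have sW0 z : Num.sqrt (wt z) != 0 by apply: lt0r_neq0; have := sW1 z; lra.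
have ssW0 z : Num.sqrt (Num.sqrt (wt z)) != 0.
  by apply: lt0r_neq0; rewrite sqrtr_gt0; have := sW1 z; lra.
pose M := \sum_(z : Zq) k z ^+ 4.
have ME : M <= 2 * (gcdn b q)%:R * q%:R ^+ 3 * (tau q)%:R ^+ 3.
  apply: le_trans (kloosterman_fourth_moment q1 wM w1 wle b).
  rewrite /M /k (reindex_inj (inv_inj (subKr h0))) /=.
  by under eq_bigr do rewrite subKr.
have M0 : 0 <= M by apply: sumr_ge0 => z _; rewrite exprn_ge0.
pose A := \sum_(z : Zq) (wt z)^-1.
have A0 : 0 <= A by apply: sumr_ge0 => z _; rewrite invr_ge0; have := W1 z; lra.
have AE : A <= 2 * th by apply: le_trans sum_inv_wt _; rewrite ler_wpM2l.
pose Q := \sum_(z : Zq) k z ^+ 2 / Num.sqrt (wt z).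
have S1 : S ^+ 2 <= A * Q.
  have -> : S = \sum_(z : Zq) (Num.sqrt (wt z))^-1 * (k z / Num.sqrt (Num.sqrt (wt z))).
    apply: eq_bigr => z _; rewrite -/(k z) sqrtrM; last by have := W1 z; lra.
    by rewrite invfM; ring.
  apply: le_trans (cauchy_schwarz _ _) _.
  rewrite le_eqVlt; apply/orP; left; apply/eqP; congr (_ * _); apply: eq_bigr => z _.
    by rewrite exprVn sW2.
  by rewrite exprMn exprVn ssW2.
have S2 : Q ^+ 2 <= A * M.
  have -> : Q = \sum_(z : Zq) (Num.sqrt (wt z))^-1 * (k z ^+ 2).
    by apply: eq_bigr => z _; rewrite mulrC.
  apply: le_trans (cauchy_schwarz _ _) _.
  rewrite le_eqVlt; apply/orP; left; apply/eqP; congr (_ * _); apply: eq_bigr => z _.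
    by rewrite exprVn sW2.
  by rewrite -exprM.
have S0 : 0 <= S by apply: sumr_ge0 => z _; rewrite divr_ge0 ?sqrtr_ge0 ?nm_ge0.
have g1 : 1 <= (gcdn b q)%:R :> R by rewrite ler1n gcdn_gt0 q0 orbT.
have S4 : S ^+ 4 <= A ^+ 3 * M.
  have -> : S ^+ 4 = (S ^+ 2) ^+ 2 by rewrite -exprM.
  apply: (@le_trans _ _ ((A * Q) ^+ 2)); first by rewrite lerXn2r ?nnegrE ?sqr_ge0// (le_trans _ S1)// sqr_ge0.
  rewrite exprMn; apply: le_trans (ler_wpM2l (sqr_ge0 A) S2) _.
  by rewrite le_eqVlt; apply/orP; left; apply/eqP; ring.
rewrite -(@ler_pXn2r _ 4)// ?nnegrE//; last by rewrite !mulr_ge0 ?exprn_ge0 ?q34_ge0 ?ler0n//; lra.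
apply: le_trans S4 _.
rewrite !exprMn q34_4.
have t0 : 0 <= (tau q)%:R :> R by rewrite ler0n.
have Q3 : 0 <= q%:R ^+ 3 :> R by rewrite exprn_ge0.
set g := (gcdn b q)%:R in g1 ME *; set Q3' := q%:R ^+ 3 in Q3 ME *.
have A3 : A ^+ 3 <= (2 * th) ^+ 3 by rewrite lerXn2r ?nnegrE//; lra.
have T3 : (tau q)%:R ^+ 3 <= th ^+ 3 by rewrite lerXn2r ?nnegrE//; lra.
have M1 : M <= 2 * g * Q3' * th ^+ 3.
  by apply: le_trans ME _; rewrite ler_wpM2l// !mulr_ge0//; lra.
apply: le_trans (ler_pM _ _ A3 M1) _ => //; first by rewrite exprn_ge0.
have -> : (2 * th) ^+ 3 * (2 * g * Q3' * th ^+ 3) = 16 * th ^+ 6 * Q3' * g by ring.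
rewrite [leRHS](_ : _ = 16 * th ^+ 6 * Q3' * (th ^+ 2 * g ^+ 4)); last by rewrite /Q3' /g; ring.
apply: ler_wpM2l; first by rewrite !mulr_ge0 ?exprn_ge0//; lra.
have : 1 <= th ^+ 2 by rewrite exprn_ege1.
have : g <= g ^+ 4 by rewrite -[leLHS]expr1 ler_weXn2l.
have : 0 <= g ^+ 4 by rewrite exprn_ge0//; lra.
nra.
Qed.

Lemma fourier_inversion (b y : Zq) :
  (if y \is a GRing.unit then (w y)%:C%C * ez (b * y^-1) else 0)
  = (q%:R^-1)%:C%C * \sum_(h : Zq) K h b * ez (- (h * y)).
Proof.
have qC : (q%:R : C) != 0 by rewrite -(rmorph_nat (real_complex R)) /= fmorph_eq0.
apply: (mulfI qC); rewrite mulrA fmorphV /= rmorph_nat divff// mul1r.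
rewrite /kloosterman; under [RHS]eq_bigr do rewrite big_distrl /=.
rewrite exchange_big /=.
have off x : x != y -> \sum_(h : Zq) (w x)%:C%C * ez (h * x + b * x^-1) * ez (- (h * y)) = 0.
  move=> xy; under eq_bigr => h _.
    rewrite -mulrA -ezD//.
    have -> : h * x + b * x^-1 - h * y = b * x^-1 + (x - y) * h by ring.
    rewrite ezD// mulrA; over.
  by rewrite -big_distrr /= ez_sum// subr_eq0 (negPf xy) mulr0.
case: ifP => uy; last first.
  rewrite mulr0 big1// => x ux; apply: off.
  by apply: contraTneq ux => ->; rewrite uy.
rewrite (bigD1 y)//= [X in _ + X]big1 ?addr0; last by move=> x /andP[_]; exact: off.
under eq_bigr => h _.
  rewrite -mulrA -ezD//.
  have -> : h * y + b * y^-1 - h * y = b * y^-1 by ring.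
  over.
by rewrite sumr_const card_ord Zp_cast// mulr_natl.
Qed.

(* Fourier inversion in ['Z_q] turns the incomplete sum into an average over [h]
   of a Kloosterman sum times an oscillatory sum without arithmetic weight. *)
Lemma completion (b h0 : Zq) (f : nat -> C) (m n : nat) (T : R) : 0 <= T ->
  (forall z : Zq, nm (\sum_(m <= x < n) e ((centered z)%:~R * x%:R / q%:R) * f x)
     <= T / Num.sqrt (wt z * Num.sqrt (wt z))) ->
  nm (\sum_(m <= x < n | coprime q x)
        (w x%:R)%:C%C * ez (b * (x%:R)^-1) * (ez (h0 * x%:R) * f x))
  <= T / q%:R * (2 * th ^+ 2 * (gcdn b q)%:R * q34).
Proof.
move=> T0 HT.
have -> : \sum_(m <= x < n | coprime q x)
     (w x%:R)%:C%C * ez (b * (x%:R)^-1) * (ez (h0 * x%:R) * f x)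
  = (q%:R^-1)%:C%C * \sum_(h : Zq) K h b * \sum_(m <= x < n) ez ((h0 - h) * x%:R) * f x.
  transitivity (\sum_(m <= x < n) (if (x%:R : Zq) \is a GRing.unit then
     (w x%:R)%:C%C * ez (b * (x%:R)^-1) else 0) * (ez (h0 * x%:R) * f x)).
    rewrite big_mkcond /=; apply: eq_bigr => x _.
    by rewrite unitZpE//; case: ifP; rewrite ?mul0r.
  under eq_bigr => x _.
    rewrite fourier_inversion -mulrA big_distrl /=.
    under eq_bigr => h _.
      rewrite -mulrA [ez (- _) * _]mulrA -ezD//.
      have -> : - (h * x%:R) + h0 * x%:R = (h0 - h) * x%:R by ring.
      over.
    over.
  rewrite -big_distrr /= exchange_big /=; congr (_ * _).
  by apply: eq_bigr => h _; rewrite -big_distrr.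
rewrite nmM nm_real ger0_norm ?invr_ge0//.
have qi : 0 <= q%:R^-1 :> R by rewrite invr_ge0.
have -> : T / q%:R * (2 * th ^+ 2 * (gcdn b q)%:R * q34)
   = q%:R^-1 * (T * (2 * th ^+ 2 * (gcdn b q)%:R * q34)) by ring.
apply: ler_wpM2l => //.
apply: le_trans (nm_sum _ _ _) _.
rewrite (reindex_inj (inv_inj (subKr h0))) /=.
apply: le_trans (ler_wpM2l T0 (weighted_kloosterman h0 b)).
rewrite big_distrr /=; apply: ler_sum => z _.
rewrite nmM subKr mulrCA; apply: ler_wpM2l; first exact: nm_ge0.
rewrite (eq_bigr (fun x : nat => e ((centered z)%:~R * x%:R / q%:R) * f x)); first exact: HT.
move=> x _; congr (_ * _).
have -> : (centered z)%:~R * x%:R = (centered z * x%:Z)%:~R :> R by rewrite rmorphM.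
by rewrite e_intq// rmorphM /= (centeredK q1).
Qed.

Lemma omega_le (H : R) : 1 <= H ->
  0 < Num.sqrt (H * Num.sqrt H) /\ Num.sqrt (H * Num.sqrt H) <= H.
Proof.
move=> H1; have sH1 : 1 <= Num.sqrt H by rewrite -(@sqrtr1 R) ler_wsqrtr.
have sH2 : Num.sqrt H ^+ 2 = H by rewrite sqr_sqrtr//; lra.
split; first by rewrite sqrtr_gt0 mulr_gt0//; lra.
rewrite -(@ler_pXn2r _ 2)// ?nnegrE ?sqrtr_ge0//; last lra.
rewrite sqr_sqrtr ?mulr_ge0 ?sqrtr_ge0//; last lra.
rewrite [leRHS]expr2 ler_wpM2l//; first lra.
by rewrite -[leRHS]sH2 expr2 ler_peMl ?sqrtr_ge0.
Qed.

Lemma nm_term_le1 (x : Zq) (u v : R) (c : Zq) :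
  nm ((w x)%:C%C * ez c * e u) <= 1.
Proof. by rewrite !nmM nm_real nm_ez nm_e !mulr1. Qed.

(** For x up to about 2 sqrt (k W / q) the phase varies too fast for [osc_sum], and the terms are
    counted, which gives the first summand. Beyond this point 4 k W <= q x^2, as [osc_sum] requires,
    and completion applies. *)
Theorem hyperbola_sum (W : R) (A k b : nat) : 0 < W -> (0 < k)%N ->
  ((1 < b)%N -> b.-1%:R ^+ 2 <= W) ->
  nm (\sum_(1 <= x < b | coprime q x)
        (w x%:R)%:C%C * ez ((k * A)%:R * (x%:R)^-1) * e (k%:R * W / x%:R / q%:R))
  <= 2 * Num.sqrt (k%:R * W / q%:R)
     + (42 + 20 * Num.sqrt (q%:R * Num.sqrt (k%:R * W)) / q%:R)
       * (2 * th ^+ 2 * (gcdn (k * A) q)%:R * q34).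
Proof.
move=> W0 k0 bW.
set V := k%:R * W.
have kR : 1 <= k%:R :> R by rewrite ler1n.
have WV : W <= V by rewrite ler_peMl// ltW.
have V0 : 0 < V by lra.
have q0R : 0 < q%:R :> R by rewrite ltr0n.
set s := 2 * Num.sqrt (V / q%:R).
have s0 : 0 <= s by rewrite mulr_ge0 ?sqrtr_ge0.
pose a := (Num.truncn s).+1.
have as1 : s < a%:R by apply: truncnS_gt.
have as2 : a.-1%:R <= s by rewrite /a /=; have /andP[] := truncn_itv s0.
have aV : 4 * V <= q%:R * a%:R ^+ 2.
  have : s ^+ 2 <= a%:R ^+ 2 by apply: lerXn2r; rewrite ?nnegrE ?ler0n// ltW.
  rewrite /s exprMn sqr_sqrtr; last by rewrite divr_ge0// ltW.
  move=> H.
  have := ler_wpM2l (ltW q0R) H.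
  have -> : q%:R * (2 ^+ 2 * (V / q%:R)) = 4 * V by field; rewrite gt_eqF.
  by [].
set g := (gcdn _ _)%:R.
have g0 : 0 <= g by apply: ler0n.
have th1' := th1.
have E0 : 0 <= 2 * th ^+ 2 * g * q34 by rewrite !mulr_ge0 ?exprn_ge0 ?q34_ge0//; lra.
have E1 : 0 <= (42 + 20 * Num.sqrt (q%:R * Num.sqrt V) / q%:R) * (2 * th ^+ 2 * g * q34).
  by rewrite mulr_ge0// addr_ge0// divr_ge0// mulr_ge0// sqrtr_ge0.
have triv m : nm (\sum_(1 <= x < m | coprime q x)
    (w x%:R)%:C%C * ez ((k * A)%:R * (x%:R)^-1) * e (V / x%:R / q%:R)) <= m.-1%:R.
  apply: le_trans (nm_sum _ _ _) _.
  apply: le_trans (ler_sum _ (fun x _ => nm_term_le1 _ _ 0 _)) _.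
  apply: le_trans (_ : \sum_(1 <= x < m) 1 <= _).
    by rewrite [leLHS]big_mkcond; apply: ler_sum => x _; case: ifP.
  by rewrite sumr_const_nat subn1.
have [ba|ab] := leqP b a.
  apply: le_trans (triv b) _.
  have : b.-1%:R <= a.-1%:R :> R by rewrite ler_nat; case: b ba {bW}.
  by lra.
rewrite (@big_cat_nat _ _ _ a)//=; last exact: ltnW.
apply: le_trans (nmD _ _) _; apply: lerD; first by apply: le_trans (triv a) _.
have T0 : 0 <= 42 * q%:R + 20 * Num.sqrt (q%:R * Num.sqrt V).
  by rewrite addr_ge0 ?mulr_ge0 ?sqrtr_ge0 ?ler0n.
have := @completion (k * A)%:R 0 (fun x => e (V / x%:R / q%:R)) a b _ T0.
have -> : (42 * q%:R + 20 * Num.sqrt (q%:R * Num.sqrt V)) / q%:R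
   = 42 + 20 * Num.sqrt (q%:R * Num.sqrt V) / q%:R by field; rewrite gt_eqF.
have -> : gcdn ((k * A)%:R : Zq) q = gcdn (k * A) q.
  by rewrite val_Zp_nat// gcdn_modl.
have E : \sum_(a <= x < b | coprime q x)
     (w x%:R)%:C%C * ez ((k * A)%:R * (x%:R)^-1) * (ez (0 * x%:R) * e (V / x%:R / q%:R))
  = \sum_(a <= x < b | coprime q x)
        (w x%:R)%:C%C * ez ((k * A)%:R * (x%:R)^-1) * e (V / x%:R / q%:R).
  by apply: eq_bigr => x _; rewrite mul0r ez0 mul1r.
rewrite -/g E; apply => z.
have -> : \sum_(a <= x < b) e ((centered z)%:~R * x%:R / q%:R) * e (V / x%:R / q%:R)
   = \sum_(a <= x < b) e ((V / x%:R + (centered z)%:~R * x%:R) / q%:R).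
  by apply: eq_bigr => x _; rewrite -eD -mulrDl addrC.
apply: osc_sum => //; last exact: (centered_le R q1).
by move=> _; apply: le_trans WV; apply: bW; apply: leq_ltn_trans ab.
Qed.

Lemma geometric_sum (z : Zq) (a b : nat) :
  nm (\sum_(a <= x < b) e ((centered z)%:~R * x%:R / q%:R)) <= ((b - a)%:R + 4 * q%:R) / wt z.
Proof.
have q0R : 0 < q%:R :> R by rewrite ltr0n.
have L0 : 0 <= (b - a)%:R :> R by rewrite ler0n.
have W1 := wt_ge1 z; have cz := centered_le R q1 z.
have W0 : 0 < wt z by lra.
rewrite mulr2n in cz.
rewrite ler_pdivlMr//.
have dF c n : c * n.+1%:R / q%:R - c * n%:R / q%:R = c / q%:R :> R.
  by rewrite -natr1; field; rewrite gt_eqF.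
have [c0|c0|c0] := ltrgtP (centered z) 0.
- have C1 : 1 <= `|centered z|%:~R :> R by rewrite (ler_int _ 1) -gtz0_ge1 normr_gt0 lt_eqF.
  have hc : (centered z)%:~R = - `|centered z|%:~R :> R by rewrite ltr0_norm// rmorphN opprK.
  rewrite hc /wt; move: C1 cz; set j : R := `|centered z|%:~R => j1 jq.
  apply: le_trans (_ : (2 / (j / q%:R)) * (j + 1) <= _); last first.
    have -> : 2 / (j / q%:R) * (j + 1) = 2 * q%:R * ((j + 1) / j) by field; rewrite !gt_eqF//; lra.
    have : (j + 1) / j <= 2 by rewrite ler_pdivrMr; lra.
    move/(ler_wpM2l (ltW (mulr_gt0 (ltr0n R 2) q0R))); lra.
  apply: ler_wpM2r; first lra.
  apply: kusmin_landau_neg; first by rewrite divr_gt0//; lra.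
    move=> n _; rewrite dF mulNr lexx andbT.
    have : j / q%:R <= 1 / 2 by rewrite ler_pdivrMr//; lra.
    lra.
  by move=> n _ _; rewrite !dF.
- have C1 : 1 <= `|centered z|%:~R :> R by rewrite (ler_int _ 1) -gtz0_ge1 normr_gt0 gt_eqF.
  have hc : (centered z)%:~R = `|centered z|%:~R :> R by rewrite gtr0_norm.
  rewrite hc /wt; move: C1 cz; set j : R := `|centered z|%:~R => j1 jq.
  apply: le_trans (_ : (2 / (j / q%:R)) * (j + 1) <= _); last first.
    have -> : 2 / (j / q%:R) * (j + 1) = 2 * q%:R * ((j + 1) / j) by field; rewrite !gt_eqF//; lra.
    have : (j + 1) / j <= 2 by rewrite ler_pdivrMr; lra.
    move/(ler_wpM2l (ltW (mulr_gt0 (ltr0n R 2) q0R))); lra.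
  apply: ler_wpM2r; first lra.
  apply: kusmin_landau; first by rewrite divr_gt0//; lra.
    move=> n _; rewrite dF lexx /=.
    have : j / q%:R <= 1 / 2 by rewrite ler_pdivrMr//; lra.
    lra.
  by move=> n _ _; rewrite !dF.
rewrite /wt c0 normr0 add0r mulr1.
by apply: le_trans (nm_sum_trivial _ _ _) _; lra.
Qed.

(** A linear phase only shifts the frequency of the completed sums by k s, and what remains is a
    geometric sum. This serves the range of x on which the lower limit for n is the one imposed by
    x. *)
Theorem linear_sum (A k s a b : nat) :
  nm (\sum_(a <= x < b | coprime q x)
        (w x%:R)%:C%C * ez ((k * A)%:R * (x%:R)^-1) * e (k%:R * (s * x)%:R / q%:R))
  <= ((b - a)%:R / q%:R + 4) * (2 * th ^+ 2 * (gcdn (k * A) q)%:R * q34).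
Proof.
have q0R : 0 < q%:R :> R by rewrite ltr0n.
have T0 : 0 <= (b - a)%:R + 4 * q%:R :> R by rewrite addr_ge0 ?mulr_ge0 ?ler0n.
have := @completion (k * A)%:R (k * s)%:R (fun x => 1) a b _ T0.
have -> : ((b - a)%:R + 4 * q%:R) / q%:R = (b - a)%:R / q%:R + 4 :> R by field; rewrite gt_eqF.
have -> : gcdn ((k * A)%:R : Zq) q = gcdn (k * A) q.
  by rewrite val_Zp_nat// gcdn_modl.
have E : \sum_(a <= x < b | coprime q x)
     (w x%:R)%:C%C * ez ((k * A)%:R * (x%:R)^-1) * (ez ((k * s)%:R * x%:R) * 1)
  = \sum_(a <= x < b | coprime q x)
        (w x%:R)%:C%C * ez ((k * A)%:R * (x%:R)^-1) * e (k%:R * (s * x)%:R / q%:R).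
  by apply: eq_bigr => x _; rewrite mulr1 -natrM -mulnA -natrM e_natq.
rewrite E; apply => z.
under eq_bigr do rewrite mulr1.
have [W1 W2] := omega_le (wt_ge1 z).
apply: le_trans (geometric_sum z a b) _.
by rewrite ler_wpM2l// lef_pV2 ?posrE//; apply: lt_le_trans (wt_ge1 z).
Qed.
End Completion.

(** * The half divisor sum *)

Section HalfDivisorSum.
Local Open Scope nat_scope.

(* For odd [d]: [n = 2 ^ c * d * e] with [d < e] and [d = e] modulo 4. *)
Definition rep (c d n : nat) : bool :=
  [&& odd d, 2 ^ c * d ^ 2 < n & n == 2 ^ c * d ^ 2 %[mod 2 ^ (c + 2) * d]].

Definition diag (c d n : nat) : bool := odd d && (n == 2 ^ c * d ^ 2).

Lemma odd_part_unique i j a b : odd a -> odd b -> 2 ^ i * a = 2 ^ j * b -> i = j /\ a = b.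
Proof.
move=> oa ob E.
have L k u : odd u -> logn 2 (2 ^ k * u) = k.
  move=> ou; rewrite lognM ?expn_gt0//; last by case: u ou.
  by rewrite pfactorK// logn_coprime ?addn0// coprime2n.
have ij : i = j by rewrite -(L i a oa) E L.
by split=> //; move: E; rewrite ij => /eqP; rewrite eqn_pmul2l ?expn_gt0// => /eqP.
Qed.

Lemma odd_sqr_mod4 d : odd d -> d ^ 2 %% 4 = 1.
Proof.
move=> od; rewrite -modnXm.
have : d %% 4 < 4 by rewrite ltn_mod.
have : odd (d %% 4) by rewrite odd_mod.
by case: (d %% 4) => [|[|[|[|]]]].
Qed.

Lemma mulmod4_eq1 d e : odd d -> (d * e %% 4 == 1) = (e %% 4 == d %% 4).
Proof.
move=> od; rewrite -modnMm.
have : d %% 4 < 4 by rewrite ltn_mod.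
have : e %% 4 < 4 by rewrite ltn_mod.
have : odd (d %% 4) by rewrite odd_mod.
by case: (d %% 4) => [|[|[|[|]]]] //; case: (e %% 4) => [|[|[|[|]]]].
Qed.

(** In 2^c m with m odd the exponent of 2 is determined, and for m = d e the congruence d = e modulo
    4 amounts to m = 1 modulo 4, because d is odd. *)
Lemma rep_charE c m c' d : odd m -> 0 < d ->
  rep c' d (2 ^ c * m) = [&& c' == c, odd d, d %| m, d ^ 2 < m & m %% 4 == 1].
Proof.
move=> om d0; rewrite /rep; have [od|] := boolP (odd d); last by rewrite andbF.
rewrite /=; apply/idP/idP => [/andP[lt]|].
  rewrite eqn_mod_dvd; last exact: ltnW.
  move=> /dvdnP[j Ej].
  have E : 2 ^ c * m = 2 ^ c' * (d * (d + 4 * j)).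
    by rewrite -(subnK (ltnW lt)) Ej expnD; ring.
  have ode : odd (d * (d + 4 * j)) by rewrite oddM oddD od oddM.
  have [cc mm] := odd_part_unique om ode E.
  move: lt; rewrite cc eqxx mm dvdn_mulr// ltn_pmul2l ?expn_gt0// => -> /=.
  by rewrite mulmod4_eq1// -modnDmr modnMr addn0.
move=> /and4P[/eqP-> /dvdnP[e Em] lt m1].
rewrite ltn_pmul2l ?expn_gt0// lt /= eqn_mod_dvd; last first.
  by rewrite leq_pmul2l ?expn_gt0// ltnW.
have de : d < e by move: lt; rewrite Em -mulnn ltn_pmul2r.
move: m1; rewrite Em [e * d]mulnC mulmod4_eq1// eqn_mod_dvd; last exact: ltnW.
move=> /dvdnP[j Ej]; apply/dvdnP; exists j.
by rewrite -mulnBr -mulnn -mulnBr Ej expnD; ring.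
Qed.

Lemma diag_charE c m c' d : odd m ->
  diag c' d (2 ^ c * m) = [&& c' == c, odd d & m == d ^ 2].
Proof.
move=> om; rewrite /diag; have [od|] := boolP (odd d); last by rewrite andbF.
apply/eqP/idP => [E|/and3P[/eqP-> _ /eqP->]//].
have od2 : odd (d ^ 2) by rewrite oddX od orbT.
by have [-> ->] := odd_part_unique om od2 E; rewrite !eqxx.
Qed.

Lemma chi_even d : ~~ odd d -> chi d = 0%R.
Proof.
move=> od; rewrite /chi.
have : d %% 4 < 4 by rewrite ltn_mod.
have : ~~ odd (d %% 4) by rewrite odd_mod.
by case: (d %% 4) => [|[|[|[|]]]].
Qed.

Lemma chi_add d e : odd (d * e) ->
  (chi d + chi e = 2 * (chi d *+ ((d * e)%N %% 4 == 1)%N))%R.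
Proof.
rewrite oddM => /andP[od oe]; rewrite mulmod4_eq1// /chi.
have : d %% 4 < 4 by rewrite ltn_mod.
have : e %% 4 < 4 by rewrite ltn_mod.
have : odd (d %% 4) by rewrite odd_mod.
have : odd (e %% 4) by rewrite odd_mod.
by case: (d %% 4) => [|[|[|[|]]]] //; case: (e %% 4) => [|[|[|[|]]]].
Qed.

Local Open Scope ring_scope.

Lemma collapse_cofactor (V : nmodType) (d m P : nat) (G : nat -> V) : (0 < d)%N -> (0 < m < P)%N ->
  \sum_(1 <= e < P | (d * e == m)%N) G e = if (d %| m)%N then G (m %/ d)%N else 0.
Proof.
move=> d0 /andP[m0 mP]; case: ifP => dm; last first.
  by rewrite big1// => e /eqP E; rewrite -E dvdn_mulr in dm.
have k1 : (m %/ d)%N \in index_iota 1 P.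
  by rewrite mem_index_iota divn_gt0// dvdn_leq// (leq_ltn_trans (leq_div m d)).
have iE e : (d * e == m)%N = (e == m %/ d)%N.
  by rewrite eqn_div// mulnC.
rewrite (eq_bigl (fun e => e == m %/ d)%N) //.
by rewrite big_mkcond (bigD1_seq _ k1 (iota_uniq _ _))/= eqxx big1 ?addr0// => e /negPf ->.
Qed.

Lemma sum_divisors (V : nmodType) (n P : nat) (F : nat -> V) : (0 < n < P)%N ->
  \sum_(d <- divisors n) F d = \sum_(1 <= d < P | (d %| n)%N) F d.
Proof.
move=> /andP[n0 nP]; rewrite -[RHS]big_filter; apply: perm_big; apply: uniq_perm.
- exact: divisors_uniq.
- by rewrite filter_uniq// iota_uniq.
move=> d; rewrite -dvdn_divisors// mem_filter mem_index_iota.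
by case dn: (d %| n)%N => //=; rewrite (dvdn_gt0 n0 dn) (leq_ltn_trans (dvdn_leq n0 dn)).
Qed.

(** [B] and [P] cut off the exponent of 2 and the divisor. All choices with 2^B and P above n give
    the same value, so one choice serves a whole range of n and summations can be exchanged. *)
Definition halfsum (B P n : nat) : int :=
  \sum_(0 <= c < B) \sum_(1 <= d < P) chi d *+ rep c d n.

Definition diagsum (B P n : nat) : int :=
  \sum_(0 <= c < B) \sum_(1 <= d < P) chi d *+ diag c d n.

Lemma sum_delta (V : nmodType) (B c : nat) (F : nat -> V) : (c < B)%N ->
  \sum_(0 <= i < B) (F i *+ (i == c)) = F c.
Proof.
move=> cB; rewrite (bigD1_seq c) ?mem_index_iota ?iota_uniq//= eqxx big1 ?addr0//.
by move=> i /negPf->.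
Qed.

(* With [n = 2 ^ c * m] and [m] odd, pair [d] with [m / d]: the two values of
   [chi] agree if [m = 1] modulo 4 and cancel if [m = 3] modulo 4. *)
Lemma sigma_halfsum (B P n : nat) : (0 < n < P)%N -> (n < 2 ^ B)%N ->
  sigma n = 2 * halfsum B P n + diagsum B P n.
Proof.
move=> /andP[n0 nP] nB.
have [c [m om En]] : exists c, exists2 m, odd m & n = (2 ^ c * m)%N.
  exists (logn 2 n), (n`_2^')%N; last by rewrite -p_part partnC.
  by have : (2^'.-nat n`_2^')%N := part_pnat _ _; rewrite p'natE// dvdn2 negbK.
have m0 : (0 < m)%N by case: (m) om.
have mn : (m <= n)%N by rewrite En leq_pmull// expn_gt0.
have mP : (0 < m < P)%N by rewrite m0 (leq_ltn_trans mn).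
have cB : (c < B)%N.
  by rewrite -(@ltn_exp2l 2)//; apply: leq_ltn_trans nB; rewrite En leq_pmulr.
pose m1 := (m %% 4 == 1)%N.
have hE : halfsum B P n = \sum_(1 <= d < P) \sum_(1 <= e < P | (d * e == m)%N) chi d *+ ((d < e)%N && m1).
  rewrite /halfsum exchange_big_nat/=; apply: eq_big_nat => d /andP[d0 _].
  rewrite collapse_cofactor//.
  rewrite (eq_bigr (fun i => (chi d *+ [&& odd d, (d %| m)%N, (d ^ 2 < m)%N & (m %% 4 == 1)%N]) *+ (i == c))); last first.
    by move=> i _; rewrite En rep_charE//; case: (i == c); rewrite ?mulr1n ?mulr0n.
  rewrite sum_delta//; case dm: (d %| m)%N; rewrite ?andbF//=.
  have -> : odd d by move/dvdnP: dm om => [k ->]; rewrite oddM => /andP[].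
  by rewrite ltn_divRL// mulnn.
have dE : diagsum B P n = \sum_(1 <= d < P) \sum_(1 <= e < P | (d * e == m)%N) chi d *+ (d == e).
  rewrite /diagsum exchange_big_nat/=; apply: eq_big_nat => d /andP[d0 _].
  rewrite collapse_cofactor//.
  rewrite (eq_bigr (fun i => (chi d *+ (odd d && (m == d ^ 2)%N)) *+ (i == c))); last first.
    by move=> i _; rewrite En diag_charE//; case: (i == c); rewrite ?mulr1n ?mulr0n.
  rewrite sum_delta//; case dm: (d %| m)%N; last first.
    case: eqP => [E|]; last by rewrite andbF.
    by rewrite E -mulnn dvdn_mulr in dm.
  have -> : odd d by move/dvdnP: dm om => [k ->]; rewrite oddM => /andP[].
  by move/dvdnP: dm => [k ->]; rewrite mulnK//= -mulnn eqn_pmul2r// eq_sym.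
have sE : sigma n = \sum_(1 <= d < P) \sum_(1 <= e < P | (d * e == m)%N) chi d.
  rewrite /sigma (@sum_divisors _ n P) ?n0// big_mkcond; apply: eq_big_nat => d /andP[d0 _].
  rewrite collapse_cofactor// En.
  have [od|ed] := boolP (odd d); last by rewrite chi_even// !if_same.
  by rewrite Gauss_dvdr// coprimeXr// coprimen2.
have third : \sum_(1 <= d < P) \sum_(1 <= e < P | (d * e == m)%N) chi d *+ (e < d)%N
   = \sum_(1 <= d < P) \sum_(1 <= e < P | (d * e == m)%N) chi e *+ (d < e)%N.
  under eq_bigr do rewrite big_mkcond; rewrite exchange_big_nat/=.
  by apply: eq_bigr => d _; rewrite -big_mkcond; apply: eq_bigl => e; rewrite mulnC.
have -> : sigma n = \sum_(1 <= d < P) \sum_(1 <= e < P | (d * e == m)%N) (chi d *+ (d < e)%N)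
   + \sum_(1 <= d < P) \sum_(1 <= e < P | (d * e == m)%N) chi e *+ (d < e)%N + diagsum B P n.
  rewrite sE -third dE -!big_split /=; apply: eq_bigr => d _; rewrite -!big_split /=.
  by apply: eq_bigr => e _; case: ltngtP => _; rewrite ?mulr1n ?mulr0n ?addr0 ?add0r.
congr (_ + _); rewrite hE mulr_sumr -big_split /=; apply: eq_bigr => d _.
rewrite mulr_sumr -big_split /=; apply: eq_bigr => e /eqP de.
case: (d < e)%N => /=; last by rewrite !mulr0n mulr0 addr0.
by rewrite !mulr1n chi_add ?de.
Qed.

Variable R : realType.

Lemma chi_le1 n : `|(chi n)%:~R| <= 1 :> R.
Proof.
rewrite /chi; case: ifP => _; first by rewrite normr1.
by case: ifP => _; rewrite ?rmorphN ?normrN ?normr1 ?normr0.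
Qed.

Lemma sigma_le_tau n : `|(sigma n)%:~R| <= (tau n)%:R :> R.
Proof.
rewrite /sigma rmorph_sum /=; apply: le_trans (ler_norm_sum _ _ _) _.
apply: le_trans (ler_sum _ (fun d _ => chi_le1 d)) _.
by rewrite big_const_seq count_predT iter_addr_0 /tau.
Qed.

Lemma count_squares_le (P N : nat) :
  (\sum_(1 <= d < P) (d ^ 2 <= N)%N)%:R <= Num.sqrt (N%:R) :> R.
Proof.
pose s := Num.truncn (Num.sqrt (N%:R : R)).
have /andP[s1 s2] := truncn_itv (sqrtr_ge0 (N%:R : R)).
apply: le_trans s1; rewrite ler_nat -/s.
apply: (@leq_trans (\sum_(1 <= d < P | (d < s.+1)%N) 1)%N).
  rewrite [X in (_ <= X)%N]big_mkcond /=; apply: leq_sum => d _.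
  case: (leqP (d ^ 2) N) => //= dN; rewrite ifT//.
  rewrite -(ltr_nat R); apply: le_lt_trans s2.
  by rewrite -[leLHS]ger0_norm// -sqrtr_sqr ler_wsqrtr// -natrX ler_nat.
rewrite sum1_count -size_filter -[X in (_ <= X)%N](size_iota 1 s).
apply: uniq_leq_size; first by rewrite filter_uniq// iota_uniq.
by move=> d; rewrite mem_filter mem_index_iota mem_iota add1n => /and3P[-> ->].
Qed.

Lemma sum_indicator_le1 (P k : nat) (D : nat -> bool) (g : nat -> nat) : injective g ->
  (\sum_(1 <= d < P) (D d && (k == g d)) <= 1)%N.
Proof.
move=> gi; rewrite (eq_bigr (fun d => if D d && (k == g d) then 1 else 0)%N); last by move=> d _; case: (_ && _).
rewrite -big_mkcond sum1_count -size_filter.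
have : uniq [seq d <- index_iota 1 P | D d && (k == g d)] by rewrite filter_uniq// iota_uniq.
have : all (fun d => k == g d) [seq d <- index_iota 1 P | D d && (k == g d)].
  by apply/allP => d; rewrite mem_filter => /andP[/andP[]].
case: (seq.filter _ _) => [//|u [//|v s]] /= /and3P[/eqP-> /eqP/gi uv _].
by rewrite inE uv eqxx.
Qed.

Definition diagcount (B P n : nat) : nat := \sum_(0 <= c < B) \sum_(1 <= d < P) diag c d n.

Lemma diagsum_le_count B P n : `|(diagsum B P n)%:~R| <= (diagcount B P n)%:R :> R.
Proof.
rewrite /diagsum /diagcount rmorph_sum natr_sum /=; apply: le_trans (ler_norm_sum _ _ _) _.
apply: ler_sum => c _; rewrite rmorph_sum natr_sum /=; apply: le_trans (ler_norm_sum _ _ _) _.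
by apply: ler_sum => d _; case: diag; rewrite ?mulr1n ?mulr0n ?normr0//; exact: chi_le1.
Qed.

Lemma diagcount_le B P n : (diagcount B P n <= B)%N.
Proof.
rewrite /diagcount; apply: (@leq_trans (\sum_(0 <= c < B) 1)%N); last by rewrite sum_nat_const_nat muln1 subn0.
apply: leq_sum => c _; apply: (@sum_indicator_le1 P n odd (fun d => 2 ^ c * d ^ 2)%N).
by move=> u v /eqP; rewrite eqn_pmul2l ?expn_gt0// => /eqP /eqP; rewrite eqn_exp2r// => /eqP.
Qed.

(** For given c and d at most one n is counted, and only the d with d^2 <= N + l occur. *)
Lemma sum_diagcount_le B P N l : \sum_(1 <= n < N.+1) (diagcount B P (n + l))%:R <= B%:R * Num.sqrt (N + l)%:R :> R.
Proof.
rewrite -natr_sum /diagcount exchange_big_nat/= natr_sum.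
apply: (@le_trans _ _ (\sum_(0 <= c < B) Num.sqrt (N + l)%:R)); last by rewrite sumr_const_nat subn0 mulr_natl.
apply: ler_sum => c _; apply: le_trans (count_squares_le P (N + l)).
rewrite ler_nat exchange_big_nat/=; apply: leq_sum => d _.
case: (leqP (d ^ 2) (N + l)) => [_|dN] /=.
  rewrite /diag; case: (odd d); last by rewrite big1.
  under eq_bigr do rewrite eq_sym.
  apply: (@sum_indicator_le1 N.+1 (2 ^ c * d ^ 2)%N (fun=> true) (fun n => n + l)%N).
  exact: addIn.
rewrite big_nat big1// => n /andP[_ nN]; rewrite /diag; case: (odd d) => //=.
case: eqP => // E; exfalso; move: nN; rewrite ltnS; apply/negP; rewrite -ltnNge.
rewrite -(ltn_add2r l) E; apply: leq_trans dN _.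
by rewrite leq_pmull// expn_gt0.
Qed.

(** Off the diagonal r is 8 [halfsum], whence 64. If s, s' are the values of sigma and i, j the
    diagonal parts at n and n + l, the difference of the two terms is 16 (s j + i s' - i j); every
    summand contains a diagonal part, and these add up to O(B sqrt (X + l)). *)
Lemma correlation_halfsum (th : R) (l X B P : nat) : (0 < X)%N ->
  (X + l < 2 ^ B)%N -> (X + l < P)%N -> (forall m, (0 < m <= X + l)%N -> (tau m)%:R <= th) ->
  B%:R <= th ->
  `|\sum_(1 <= n < X.+1) (r n%:Z)%:R * (r (n%:Z + l%:Z))%:R
    - 64 * \sum_(1 <= n < X.+1) (halfsum B P n)%:~R * (halfsum B P (n + l))%:~R|
  <= 48 * th ^+ 2 * Num.sqrt (X + l)%:R.
Proof.
move=> X0 XB XP Hth Bth.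
have rE n : (0 < n)%N -> (r n%:Z)%:R = 4 * (sigma n)%:~R :> R.
  by move=> n0; rewrite pmulrn r_sigma// rmorphM.
have th0 : 0 <= th by apply: le_trans Bth; rewrite ler0n.
pose io n : R := (diagcount B P n)%:R.
have sE n : (0 < n <= X + l)%N -> exists i : R, [/\ `|i| <= io n, `|i| <= th, `|(sigma n)%:~R| <= th &
    2 * (halfsum B P n)%:~R = (sigma n)%:~R - i].
  move=> /andP[n0 nX]; exists (diagsum B P n)%:~R; split.
  - exact: diagsum_le_count.
  - apply: le_trans (diagsum_le_count _ _ _) (le_trans _ Bth); rewrite ler_nat; exact: diagcount_le.
  - by apply: le_trans (sigma_le_tau n) (Hth n _); rewrite n0.
  rewrite (@sigma_halfsum B P n) ?n0 ?(leq_ltn_trans nX)//.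
  by rewrite rmorphD rmorphM /=; ring.
rewrite mulr_sumr -sumrB; apply: le_trans (ler_norm_sum _ _ _) _.
apply: (@le_trans _ _ (\sum_(1 <= n < X.+1) 16 * th * (io (n + l)%N + 2 * io (n + 0)%N))).
  apply: ler_sum_nat => n /andP[n1 nX].
  have nl : (0 < n + l <= X + l)%N by rewrite addn_gt0 n1 leq_add2r -ltnS.
  have n0 : (0 < n <= X + l)%N by rewrite n1 -(addn0 n) leq_add// -ltnS.
  have [i [i1 i2 i3 i4]] := sE n n0; have [j [j1 j2 j3 j4]] := sE (n + l)%N nl.
  rewrite -PoszD !rE ?addn_gt0 ?n1// addn0.
  have -> : 64 * ((halfsum B P n)%:~R * (halfsum B P (n + l))%:~R)
    = 16 * ((2 * (halfsum B P n)%:~R) * (2 * (halfsum B P (n + l))%:~R)) :> R by ring.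
  rewrite i4 j4; set s := (sigma n)%:~R in i3 *; set s' := (sigma (n + l))%:~R in j3 *.
  have -> : 4 * s * (4 * s') - 16 * ((s - i) * (s' - j)) = 16 * (s * j + i * s' - i * j) by ring.
  rewrite normrM ger0_norm// -mulrA ler_wpM2l//.
  apply: le_trans (ler_normB _ _) _; apply: le_trans (lerD (ler_normD _ _) (lexx _)) _.
  rewrite !normrM.
  have a1 : `|s| * `|j| <= th * io (n + l)%N by apply: ler_pM.
  have a2 : `|i| * `|s'| <= th * io n by rewrite mulrC; apply: ler_pM.
  have a3 : `|i| * `|j| <= th * io n by rewrite mulrC; apply: ler_pM.
  lra.
rewrite -mulr_sumr big_split /= -mulr_sumr.
have S1 := sum_diagcount_le B P X l; have S2 := sum_diagcount_le B P X 0.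
have sq : Num.sqrt (X + 0)%:R <= Num.sqrt (X + l)%:R :> R by rewrite ler_wsqrtr// ler_nat leq_add2l.
have T1 : \sum_(1 <= n < X.+1) io (n + l)%N <= th * Num.sqrt (X + l)%:R.
  by apply: le_trans S1 _; rewrite ler_wpM2r ?sqrtr_ge0.
have T2 : \sum_(1 <= n < X.+1) io (n + 0)%N <= th * Num.sqrt (X + l)%:R.
  by apply: le_trans S2 _; apply: ler_pM; rewrite ?sqrtr_ge0 ?ler0n.
have -> : 48 * th ^+ 2 * Num.sqrt (X + l)%:R = 16 * th * (th * Num.sqrt (X + l)%:R + 2 * (th * Num.sqrt (X + l)%:R)) by ring.
apply: ler_wpM2l; first by rewrite mulr_ge0.
lra.
Qed.

End HalfDivisorSum.

(** * The singular series *)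

Section CharacterSums.
Variable R : realType.
Notation ch x := ((chi x)%:~R : R).

Lemma chi_sum D : \sum_(0 <= x < D) chi x = ((D %% 4 == 2) || (D %% 4 == 3))%N%:Z.
Proof.
elim: D => [|D IH]; first by rewrite big_geq.
rewrite big_nat_recr//= IH /chi -[in RHS]addn1 -modnDml.
have : (D %% 4 < 4)%N by rewrite ltn_mod.
by case: (D %% 4)%N => [|[|[|[|]]]].
Qed.

(** The bound [(D + p.-1) %/ p] is the ceiling of D / p, the number of multiples of p in [0, D). *)
Lemma sum_multiples (V : nmodType) (p D : nat) (Q : pred nat) (F : nat -> V) : (0 < p)%N ->
  \sum_(0 <= x < D | Q x && (p %| x)%N) F x = \sum_(0 <= y < (D + p.-1) %/ p | Q (p * y)%N) F (p * y)%N.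
Proof.
move=> p0; elim: D => [|D IH].
  by rewrite add0n divn_small ?prednK// !big_geq.
have E : ((D.+1 + p.-1) %/ p = (p %| D) + (D + p.-1) %/ p)%N.
  by rewrite addSn divnS// -addnS prednK// dvdn_addl.
rewrite big_mkcond big_nat_recr//= -big_mkcond IH E; case: ifP => [/andP[QD pD]|].
  have [k Dk] := dvdnP pD; rewrite pD add1n.
  have -> : ((D + p.-1) %/ p = k)%N by rewrite Dk divnMDl// divn_small ?addn0// prednK.
  by rewrite [RHS]big_mkcond big_nat_recr//= -big_mkcond -[(p * k)%N]mulnC -Dk QD.
case pD: (p %| D)%N; rewrite ?andbT ?addr0//= add1n => QD.
have [k Dk] := dvdnP pD.
have -> : ((D + p.-1) %/ p = k)%N by rewrite Dk divnMDl// divn_small ?addn0// prednK.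
by rewrite [RHS]big_mkcond big_nat_recr//= -big_mkcond -[(p * k)%N]mulnC -Dk QD addr0.
Qed.

(** Removing one prime p from m: the sum for m is the sum for its part prime to p, minus chi p times
    a sum of the same kind over x / p. The bound doubles with each prime, and [tau] at least doubles
    too. *)
Lemma chi_coprime_sum m D : (0 < m)%N -> `|\sum_(0 <= x < D | coprime x m) ch x| <= (tau m)%:R.
Proof.
elim/ltn_ind: m D => m IH D m0.
have [m1|m1] := leqP m 1.
  have -> : m = 1%N by apply/eqP; rewrite eqn_leq m1.
  under eq_bigl do rewrite coprimen1.
  rewrite -rmorph_sum chi_sum /=.
  have t1 : 1 <= (tau 1)%:R :> R by rewrite ler1n tau_gt0.
  by case: (_ || _) => /=; rewrite ?normr0 ?normr1// (le_trans ler01).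
set p := pdiv m; have pp : prime p by apply: pdiv_prime.
have pm : (p %| m)%N by apply: pdiv_dvd.
have lt := partn_prime_lt pp m1 pm; set m' := (m`_p^')%N in lt.
have m'0 : (0 < m')%N by apply: part_gt0.
have cop x : coprime x m = coprime x m' && ~~ (p %| x)%N.
  rewrite -{1}(partnC p m0) coprimeMr p_part coprime_pexpr ?logn_gt0 ?mem_primes ?pp ?m0//.
  by rewrite [coprime x p]coprime_sym prime_coprime// andbC.
have S : \sum_(0 <= x < D | coprime x m) ch x = \sum_(0 <= x < D | coprime x m') ch x
   - ch p * \sum_(0 <= y < (D + p.-1) %/ p | coprime y m') ch y.
  under eq_bigl do rewrite cop.
  rewrite [X in _ = X - _](bigID (fun x => p %| x)%N)/= sum_multiples ?prime_gt0// mulr_sumr.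
  have -> : \sum_(0 <= y < (D + p.-1) %/ p | coprime (p * y) m') ch (p * y)%N
     = \sum_(0 <= y < (D + p.-1) %/ p | coprime y m') ch p * ch y.
    apply: eq_big => [y|y _]; last by rewrite chiM rmorphM.
    rewrite coprimeMl; suff -> : coprime p m' by [].
    by rewrite prime_coprime//; have := part_pnat p^' m; rewrite p'natE.
  by rewrite addrAC subrr add0r.
rewrite S; apply: le_trans (ler_normB _ _) _; rewrite normrM.
have H1 := IH m' lt D m'0; have H2 := IH m' lt ((D + p.-1) %/ p)%N m'0.
have H3 : `|ch p| * `|\sum_(0 <= y < (D + p.-1) %/ p | coprime y m') ch y| <= 1 * (tau m')%:R.
  by apply: ler_pM => //; exact: chi_le1.
have H4 : 2 * (tau m')%:R <= (tau m)%:R :> R by rewrite -natrM ler_nat tau_split_ge.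
lra.
Qed.

(** A condition on n modulo d and one on n + l modulo x are compatible only if gcd(d, x) divides l,
    and they then hold together with density gcd(d, x) / (d x), powers of 2 apart. *)
Definition gam (d l x : nat) : nat := if (gcdn d x %| l)%N then gcdn d x else 0.

Lemma gam_sum (d l D : nat) (th : R) : (0 < d)%N -> (0 < l)%N ->
  (forall m, (0 < m <= d)%N -> (tau m)%:R <= th) ->
  `|\sum_(0 <= x < D) ch x * (gam d l x)%:R| <= th ^+ 2 * (gcdn d l)%:R.
Proof.
move=> d0 l0 Hth.
have G0 : (0 < gcdn d l)%N by rewrite gcdn_gt0 d0.
have Gd : (gcdn d l <= d)%N by rewrite dvdn_leq// dvdn_gcdl.
have th0 : 0 <= th by apply: le_trans (Hth 1%N _); rewrite ?ler0n.
pose F g x : R := if (g %| l)%N then ch x * g%:R else 0.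
have E : \sum_(0 <= x < D) ch x * (gam d l x)%:R
   = \sum_(0 <= g < d.+1) \sum_(0 <= x < D) F g x *+ (g == gcdn d x).
  rewrite exchange_big_nat/=; apply: eq_bigr => x _.
  rewrite sum_delta; first by rewrite /F /gam; case: ifP; rewrite ?mulr0.
  by rewrite ltnS dvdn_leq// dvdn_gcdl.
have inner g : `|\sum_(0 <= x < D) F g x *+ (g == gcdn d x)| <= if (g %| gcdn d l)%N then th * (gcdn d l)%:R else 0.
  rewrite dvdn_gcd; case gd: (g %| d)%N => /=; last first.
    rewrite big1 ?normr0// => x _; case: eqP => // H.
    by rewrite H dvdn_gcdl in gd.
  rewrite /F; case gl: (g %| l)%N; last by rewrite big1 ?normr0// => x _; rewrite mul0rn.
  have [d' dE] := dvdnP gd.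
  have g0 : (0 < g)%N by case: (g) gd dE d0 => // _ ->; rewrite muln0.
  have d'0 : (0 < d')%N by move: d0; rewrite dE muln_gt0 => /andP[].
  have -> : \sum_(0 <= x < D) (ch x * g%:R) *+ (g == gcdn d x)
    = g%:R * (ch g * \sum_(0 <= y < (D + g.-1) %/ g | coprime y d') ch y).
    rewrite (eq_bigr (fun x => if (g == gcdn d x) && (g %| x)%N then ch x * g%:R else 0)); last first.
      move=> x _; case: eqP => /= [H|]; last by rewrite mulr0n.
      by have -> : (g %| x)%N; [rewrite H dvdn_gcdr | rewrite mulr1n].
    rewrite -big_mkcond sum_multiples// !mulr_sumr.
    apply: eq_big => [y|y _]; last by rewrite chiM rmorphM /=; ring.
    by rewrite dE mulnC -muln_gcdr -{1}(muln1 g) eqn_pmul2l// eq_sym gcdnC.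
  rewrite !normrM normr_nat.
  have gG : (g <= gcdn d l)%N by rewrite dvdn_leq// dvdn_gcd gd.
  rewrite mulrC; apply: ler_pM; rewrite ?mulr_ge0// ?ler_nat//.
  rewrite -[leRHS]mul1r; apply: ler_pM => //; first exact: chi_le1.
  apply: le_trans (chi_coprime_sum _ d'0) (Hth d' _).
  by rewrite d'0 dE leq_pmulr.
rewrite E; apply: le_trans (ler_norm_sum _ _ _) _.
apply: le_trans (ler_sum _ (fun g _ => inner g)) _.
rewrite -big_mkcond /= big_mkcond big_ltn//= dvd0n gtn_eqF// add0r -big_mkcond.
rewrite -(@sum_divisors _ (gcdn d l) d.+1 (fun=> th * (gcdn d l)%:R)) ?G0 ?ltnS//.
rewrite big_const_seq count_predT iter_addr_0 expr2 -mulrA -[leLHS]mulr_natl.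
apply: ler_wpM2r; first by rewrite mulr_ge0// ler0n.
by apply: Hth; rewrite G0 Gd.
Qed.

Lemma abel_tail (f u : nat -> R) (A : R) (a b : nat) :
  (forall D, `|\sum_(0 <= x < D) f x| <= A) ->
  (forall x, (a <= x)%N -> 0 <= u x) -> (forall x, (a <= x)%N -> u x.+1 <= u x) ->
  `|\sum_(a <= x < b) f x * u x| <= 2 * A * u a.
Proof.
move=> HA u0 u1.
have A0 : 0 <= A by apply: le_trans (HA 0%N).
have [ba|ab] := leqP b a; first by rewrite big_geq// normr0 !mulr_ge0// u0.
pose s n := \sum_(a <= x < n) f x.
have s2 n : (a <= n)%N -> `|s n| <= 2 * A.
  move=> an; have E : \sum_(0 <= x < n) f x = \sum_(0 <= x < a) f x + s n by rewrite -big_cat_nat.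
  have -> : s n = \sum_(0 <= x < n) f x - \sum_(0 <= x < a) f x by rewrite E addrAC subrr add0r.
  by apply: le_trans (ler_normB _ _) _; have := HA n; have := HA a; lra.
have H n : (a <= n)%N -> `|\sum_(a <= x < n) f x * u x - s n * u n| <= 2 * A * (u a - u n).
  elim: n => [|n IH]; first by rewrite leqn0 => /eqP a0; rewrite /s a0 !big_geq// mul0r !subrr normr0 mulr0.
  rewrite leq_eqVlt => /predU1P[<-|an].
    by rewrite /s !big_geq// mul0r !subrr normr0 mulr0.
  have sn : s n.+1 = s n + f n by rewrite /s big_nat_recr.
  rewrite big_nat_recr//=.
  have -> : \sum_(a <= i < n) f i * u i + f n * u n - s n.+1 * u n.+1
    = (\sum_(a <= i < n) f i * u i - s n * u n) + s n.+1 * (u n - u n.+1) by rewrite sn; ring.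
  apply: le_trans (ler_normD _ _) _.
  have K1 := IH an; have K2 := s2 n.+1 (ltnW an).
  have K3 := u1 n an.
  rewrite normrM (@ger0_norm _ (u n - _)) ?subr_ge0//.
  have K4 : `|s n.+1| * (u n - u n.+1) <= 2 * A * (u n - u n.+1) by apply: ler_wpM2r; rewrite ?subr_ge0.
  lra.
have ab' := ltnW ab.
have -> : \sum_(a <= x < b) f x * u x = (\sum_(a <= x < b) f x * u x - s b * u b) + s b * u b by ring.
apply: le_trans (ler_normD _ _) _; rewrite normrM (ger0_norm (u0 b ab')).
have := H b ab'; have := ler_wpM2r (u0 b ab') (s2 b ab'); lra.
Qed.

Lemma sum_window (V : nmodType) (a a' P : nat) (G : nat -> V) : (0 < a)%N ->
  \sum_(1 <= x < P) G x *+ ((a <= x)%N && (x < a')%N) = \sum_(a <= x < minn P a') G x.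
Proof.
move=> a0; have [le|lt] := leqP (minn P a') a.
  rewrite [RHS]big_geq// big_nat big1// => x /andP[_ xP].
  have -> // : (a <= x < a')%N = false.
  apply/negbTE/negP => /andP[ax xa'].
  have : (x < minn P a')%N by rewrite leq_min xP.
  by rewrite ltnNge (leq_trans le ax).
have MP : (minn P a' <= P)%N by apply: geq_minl.
rewrite (@big_cat_nat _ _ _ a)//=; last by apply: leq_trans MP; exact: ltnW.
rewrite big_nat big1 ?add0r; last by move=> x /andP[_ xa]; rewrite leqNgt xa.
rewrite (@big_cat_nat _ _ _ (minn P a'))//=; last exact: ltnW.
rewrite [X in _ + X]big_nat [X in _ + X]big1 ?addr0; last first.
  move=> x /andP[Mx xP]; case: (ltnP x a') => xa; last by rewrite andbF.
  by move: Mx; rewrite leqNgt leq_min xP xa.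
by apply: eq_big_nat => x /andP[-> ]; rewrite leq_min => /andP[_ ->].
Qed.

Lemma square_cutoff (k N : nat) : (0 < k)%N -> (0 < N)%N ->
  exists2 a, (0 < a)%N & (forall x, (k * x ^ 2 < N)%N = (x < a)%N) /\ (N <= k * a ^ 2)%N.
Proof.
move=> k0 N0; have ex : exists a, (N <= k * a ^ 2)%N.
  by exists N; rewrite (leq_trans (_ : _ <= N ^ 2)%N) ?leq_pmull// -mulnn leq_pmulr.
case: (ex_minnP ex) => a aN amin; exists a; first by case: a aN {amin} => //; rewrite muln0 leqNgt N0.
split=> // x; apply/idP/idP => [H|xa].
  rewrite ltnNge; apply/negP => ax; move: H; rewrite ltnNge (leq_trans aN)//.
  by rewrite leq_pmul2l// leq_exp2r.
by rewrite ltnNge; apply/negP => /amin; rewrite leqNgt xa.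
Qed.

(** The terms gained when N grows to N' have x^2 >= N / k, and Abel summation plays the bounded
    partial sums of [f] against 1 / x. *)
Lemma box_tail (f : nat -> R) (A : R) (k N N' P : nat) :
  (forall D, `|\sum_(0 <= x < D) f x| <= A) -> (0 < k)%N -> (0 < N <= N')%N ->
  `|\sum_(1 <= x < P) f x / x%:R * ((k * x ^ 2 < N')%N%:R - (k * x ^ 2 < N)%N%:R)|
   <= 2 * A * Num.sqrt (k%:R / N%:R).
Proof.
move=> HA k0 /andP[N0 NN].
have A0 : 0 <= A by apply: le_trans (HA 0%N).
have [a a0 [aE aN]] := square_cutoff k0 N0.
have [a' a'0 [a'E _]] := square_cutoff k0 (leq_trans N0 NN).
have aa : (a <= a')%N.
  rewrite leqNgt; apply/negP; rewrite -aE => H.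
  by have := leq_trans H NN; rewrite a'E ltnn.
have -> : \sum_(1 <= x < P) f x / x%:R * ((k * x ^ 2 < N')%N%:R - (k * x ^ 2 < N)%N%:R)
  = \sum_(1 <= x < P) (f x / x%:R) *+ ((a <= x)%N && (x < a')%N).
  apply: eq_bigr => x _; rewrite aE a'E; case: (leqP a x) => ax /=.
    by rewrite subr0; case: (x < a')%N; rewrite ?mulr1 ?mulr0.
  by rewrite (leq_trans ax aa) subrr mulr0.
rewrite sum_window//; apply: le_trans (@abel_tail f (fun x => x%:R^-1) A a _ HA _ _) _.
- by move=> x _; rewrite invr_ge0.
- move=> x ax; have x0 := leq_trans a0 ax.
  by rewrite lef_pV2 ?posrE ?ltr0n// ler_nat.
apply: ler_wpM2l; first by rewrite mulr_ge0.
have aR : 0 < a%:R :> R by rewrite ltr0n.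
have NR : 0 < N%:R :> R by rewrite ltr0n.
rewrite -[leLHS]ger0_norm ?invr_ge0// -sqrtr_sqr ler_wsqrtr//.
rewrite ler_pdivlMr// exprVn mulrC ler_pdivrMr ?exprn_gt0//.
by rewrite -natrX -natrM ler_nat.
Qed.

Lemma harm_le (M N : nat) : (M <= N)%N -> harm R M <= harm R N.
Proof.
move=> MN; rewrite /harm (@big_cat_nat _ _ _ M.+1 1%N N.+1)//= lerDl.
by apply: sumr_ge0 => j _; rewrite invr_ge0.
Qed.

Lemma sum_gcd_div (l P : nat) : (0 < l)%N ->
  \sum_(1 <= d < P) (gcdn d l)%:R / d%:R <= (tau l)%:R * harm R P.
Proof.
move=> l0.
apply: (@le_trans _ _ (\sum_(1 <= d < P) \sum_(g <- divisors l) (if (g %| d)%N then g%:R / d%:R else 0))).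
  apply: ler_sum_nat => d /andP[d0 _].
  have Gl : (gcdn d l) \in divisors l by rewrite -dvdn_divisors// dvdn_gcdr.
  rewrite (bigD1_seq _ Gl (divisors_uniq l))/= dvdn_gcdl lerDl.
  by apply: sumr_ge0 => g _; case: ifP => // _; rewrite divr_ge0 ?ler0n.
rewrite exchange_big /= /tau.
apply: (@le_trans _ _ (\sum_(g <- divisors l) harm R P)); last first.
  by rewrite big_const_seq count_predT iter_addr_0 mulr_natl.
rewrite big_seq [leRHS]big_seq; apply: ler_sum => g; rewrite -dvdn_divisors// => gl.
have g0 : (0 < g)%N by apply: dvdn_gt0 gl.
have [->|P0] := posnP P; first by rewrite big_geq// harm_ge0.
rewrite -[leLHS]add0r.
have -> : 0 + \sum_(1 <= i < P) (if (g %| i)%N then g%:R / i%:R else 0)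
   = \sum_(0 <= i < P | xpredT i && (g %| i)%N) g%:R / i%:R :> R.
  by rewrite [RHS]big_mkcond [RHS]big_ltn//= invr0 mulr0 if_same.
rewrite sum_multiples//.
have M : ((P + g.-1) %/ g <= P)%N.
  rewrite -ltnS ltn_divLR//; case: (g) g0 => // g' _ /=.
  by rewrite mulSn mulnS; move: P0; clear; nia.
have [M0|M0] := posnP ((P + g.-1) %/ g)%N; first by rewrite M0 big_geq// harm_ge0.
rewrite big_ltn// muln0 invr0 mulr0 add0r /harm.
apply: le_trans (_ : \sum_(1 <= y < (P + g.-1) %/ g) y%:R^-1 <= _).
  apply: ler_sum => y _; rewrite natrM invfM mulrA divff ?mul1r// pnatr_eq0 -lt0n//.
rewrite (@big_cat_nat _ _ _ ((P + g.-1) %/ g)%N 1%N P.+1)//=; last exact: leq_trans M (leqnSn P).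
by rewrite lerDl; apply: sumr_ge0 => j _; rewrite invr_ge0.
Qed.
End CharacterSums.

(** * Variation of the truncated singular series *)

Section SingularSeries.
Variable R : realType.
Notation ch x := ((chi x)%:~R : R).
Variables (l P B : nat) (th : R) (kp : nat -> nat -> R).
Hypotheses (l0 : (0 < l)%N) (Hth : forall m, (0 < m <= P + l)%N -> (tau m)%:R <= th).
Hypotheses (Hh : harm R P <= th) (HB : B%:R <= th).
Hypotheses (kp0 : forall b c, 0 <= kp b c)
  (kpb : forall b c, kp b c * Num.sqrt (2 ^ b)%:R <= 1) (kpc : forall b c, kp b c * Num.sqrt (2 ^ c)%:R <= 1).

Definition box (c d n : nat) : R := (2 ^ c * d ^ 2 < n)%N%:R.

(* Partial sums of the singular series: [box] keeps the pairs [(d, x)] which can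
   contribute to the count at [n]. *)
Definition sing2 (b c n : nat) : R :=
  \sum_(1 <= d < P) \sum_(1 <= x < P) ch d * ch x * (gam d l x)%:R / (d%:R * x%:R) * (box c d n * box b x (n + l)).

Definition sing (n : nat) : R := \sum_(0 <= b < B) \sum_(0 <= c < B) kp b c * sing2 b c n.

Let th0 : 0 <= th. Proof. by apply: le_trans HB; rewrite ler0n. Qed.

Lemma gamC d x : gam d l x = gam x l d.
Proof. by rewrite /gam gcdnC. Qed.

(** The change of a product of two boxes is split into the changes of its factors. The variable
    whose box moves is summed first, with cancellation from [chi]; the other is summed with absolute
    values, where gcd(d, l) / d costs only [th ^+ 2]. The square roots of powers of 2 will be
    absorbed by [kp]. *)
Lemma sing2_diff b c n n' : (0 < n <= n')%N ->
  `|sing2 b c n' - sing2 b c n| <= 2 * th ^+ 4 * (Num.sqrt (2 ^ b)%:R + Num.sqrt (2 ^ c)%:R) / Num.sqrt n%:R.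
Proof.
move=> /andP[n0 nn].
have th0' := th0.
have bx01 k d m : 0 <= box k d m <= 1 by rewrite /box; case: (_ < _)%N; rewrite /= ?lexx ?ler01.
pose U d := \sum_(1 <= x < P) ch x * (gam d l x)%:R / x%:R * (box b x (n' + l) - box b x (n + l)).
pose V x := \sum_(1 <= d < P) ch d * (gam x l d)%:R / d%:R * (box c d n' - box c d n).
have E : sing2 b c n' - sing2 b c n = \sum_(1 <= d < P) ch d / d%:R * box c d n' * U d
   + \sum_(1 <= x < P) ch x / x%:R * box b x (n + l) * V x.
  rewrite /U /V; under [X in _ = X + _]eq_bigr do rewrite mulr_sumr.
  under [X in _ = _ + X]eq_bigr do rewrite mulr_sumr.
  rewrite [X in _ = _ + X]exchange_big_nat/= /sing2 -sumrB -big_split /=.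
  apply: eq_bigr => d _; rewrite -sumrB -big_split /=; apply: eq_bigr => x _.
  by rewrite [gam x l d]gamC invfM; ring.
have sub m : (0 < m < P)%N -> forall j, (0 < j <= m)%N -> (tau j)%:R <= th.
  move=> /andP[_ mP] j /andP[j0 jm]; apply: Hth; rewrite j0 /=.
  by apply: leq_trans jm (leq_trans (ltnW mP) (leq_addr _ _)).
have UB d : (0 < d < P)%N -> `|U d| <= 2 * (th ^+ 2 * (gcdn d l)%:R) * (Num.sqrt (2 ^ b)%:R / Num.sqrt n%:R).
  move=> dP; have d0 : (0 < d)%N by case/andP: dP.
  apply: le_trans (box_tail P (fun D => gam_sum D d0 l0 (sub d dP)) _ _) _; rewrite ?expn_gt0//.
    by rewrite addn_gt0 n0 leq_add2r.
  apply: ler_wpM2l; first by rewrite !mulr_ge0 ?exprn_ge0.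
  rewrite -sqrtrV ?ler0n// -sqrtrM ?ler0n// ler_wsqrtr// ler_wpM2l ?ler0n//.
  by rewrite lef_pV2 ?posrE ?ltr0n ?addn_gt0 ?n0// ler_nat leq_addr.
have VB x : (0 < x < P)%N -> `|V x| <= 2 * (th ^+ 2 * (gcdn x l)%:R) * (Num.sqrt (2 ^ c)%:R / Num.sqrt n%:R).
  move=> xP; have x0 : (0 < x)%N by case/andP: xP.
  apply: le_trans (box_tail P (fun D => gam_sum D x0 l0 (sub x xP)) _ _) _; rewrite ?expn_gt0 ?n0//.
  apply: ler_wpM2l; first by rewrite !mulr_ge0 ?exprn_ge0.
  by rewrite -sqrtrV ?ler0n// -sqrtrM ?ler0n.
have gs : \sum_(1 <= d < P) (gcdn d l)%:R / d%:R <= th ^+ 2 :> R.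
  apply: le_trans (sum_gcd_div R P l0) _; rewrite expr2; apply: ler_pM; rewrite ?ler0n ?harm_ge0//.
  by apply: Hth; rewrite l0 leq_addl.
have gen (W : nat -> R) (k m : nat) (s : R) : 0 <= s ->
    (forall d, (0 < d < P)%N -> `|W d| <= 2 * (th ^+ 2 * (gcdn d l)%:R) * s) ->
    `|\sum_(1 <= d < P) ch d / d%:R * box k d m * W d| <= 2 * th ^+ 4 * s.
  move=> s0 HW; apply: le_trans (ler_norm_sum _ _ _) _.
  apply: (@le_trans _ _ (\sum_(1 <= d < P) 2 * th ^+ 2 * s * ((gcdn d l)%:R / d%:R))); last first.
    rewrite -mulr_sumr.
    have -> : 2 * th ^+ 4 * s = 2 * th ^+ 2 * s * th ^+ 2 by ring.
    by apply: ler_wpM2l => //; rewrite !mulr_ge0 ?exprn_ge0.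
  apply: ler_sum_nat => d dP; rewrite !normrM.
  have -> : 2 * th ^+ 2 * s * ((gcdn d l)%:R / d%:R) = d%:R^-1 * (2 * (th ^+ 2 * (gcdn d l)%:R) * s) by ring.
  apply: ler_pM => //; last exact: HW.
  rewrite -[leRHS]mulr1; apply: ler_pM => //.
    by rewrite normfV normr_nat ler_piMl ?invr_ge0 ?ler0n// chi_le1.
  by have /andP[b0 b1] := bx01 k d m; rewrite ger0_norm.
rewrite E; apply: le_trans (ler_normD _ _) _.
have s0 k : 0 <= Num.sqrt k%:R / Num.sqrt n%:R :> R by rewrite divr_ge0 ?sqrtr_ge0.
have := gen U c n' _ (s0 _) UB; have := gen V b (n + l)%N _ (s0 _) VB; lra.
Qed.

Lemma sing_diff n n' : (0 < n <= n')%N -> `|sing n' - sing n| <= 4 * th ^+ 6 / Num.sqrt n%:R.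
Proof.
move=> nn; have th0' := th0.
have s0 : 0 <= (Num.sqrt n%:R)^-1 :> R by rewrite invr_ge0 sqrtr_ge0.
apply: (@le_trans _ _ (\sum_(0 <= b < B) \sum_(0 <= c < B) 4 * th ^+ 4 / Num.sqrt n%:R)); last first.
  rewrite !sumr_const_nat subn0 -mulrnA -[leLHS]mulr_natl natrM.
  have -> : 4 * th ^+ 6 / Num.sqrt n%:R = th * th * (4 * th ^+ 4 / Num.sqrt n%:R) by ring.
  by apply: ler_pM; rewrite ?mulr_ge0 ?ler0n ?exprn_ge0//; apply: ler_pM; rewrite ?ler0n.
rewrite /sing -sumrB; apply: le_trans (ler_norm_sum _ _ _) _; apply: ler_sum => b _.
rewrite -sumrB; apply: le_trans (ler_norm_sum _ _ _) _; apply: ler_sum => c _.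
rewrite -mulrBr normrM (ger0_norm (kp0 b c)).
apply: le_trans (ler_wpM2l (kp0 b c) (sing2_diff b c nn)) _.
have K0 : 0 <= 2 * th ^+ 4 / Num.sqrt n%:R by rewrite !mulr_ge0 ?exprn_ge0.
have := ler_wpM2r K0 (lerD (kpb b c) (kpc b c)); lra.
Qed.

Lemma sum_inv_sqrt (X : nat) : \sum_(1 <= n < X.+1) (Num.sqrt n%:R)^-1 <= 2 * Num.sqrt X%:R :> R.
Proof.
elim: X => [|X IH]; first by rewrite big_geq// mulr_ge0// sqrtr_ge0.
rewrite big_nat_recr//=; apply: le_trans (lerD IH (lexx _)) _.
set a := Num.sqrt X%:R; set b := Num.sqrt X.+1%:R.
have b0 : 0 < b by rewrite sqrtr_gt0.
have a0 : 0 <= a by apply: sqrtr_ge0.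
have E : b ^+ 2 = a ^+ 2 + 1 by rewrite !sqr_sqrtr ?ler0n// -natr1.
rewrite -(ler_pM2r b0) mulrDl mulVf ?gt_eqF//.
have : 0 <= (b - a) ^+ 2 by apply: sqr_ge0.
lra.
Qed.

(** Both means are compared with the value at Y, the largest index in either range; the deviations 1
    / sqrt n sum to O(sqrt X) and O(sqrt Y). *)
Theorem mean_sing (X Y : nat) : (0 < X <= Y)%N ->
  `|(\sum_(1 <= n < X.+1) sing n) / X%:R - (\sum_(1 <= n < Y.+1) sing n) / Y%:R| <= 16 * th ^+ 6 / Num.sqrt X%:R.
Proof.
move=> /andP[X0 XY]; have th0' := th0.
have main Z : (0 < Z <= Y)%N -> `|(\sum_(1 <= n < Z.+1) sing n) / Z%:R - sing Y| <= 8 * th ^+ 6 / Num.sqrt Z%:R.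
  move=> /andP[Z0 ZY].
  have ZR : 0 < Z%:R :> R by rewrite ltr0n.
  have sZ : 0 < Num.sqrt Z%:R :> R by rewrite sqrtr_gt0.
  have -> : (\sum_(1 <= n < Z.+1) sing n) / Z%:R - sing Y = (\sum_(1 <= n < Z.+1) (sing n - sing Y)) / Z%:R.
    by rewrite sumrB sumr_const_nat subSS subn0 mulrBl -(mulr_natr (sing Y)) mulfK ?gt_eqF.
  rewrite normrM normfV (gtr0_norm ZR) ler_pdivrMr//.
  apply: le_trans (ler_norm_sum _ _ _) _.
  apply: (@le_trans _ _ (\sum_(1 <= n < Z.+1) 4 * th ^+ 6 * (Num.sqrt n%:R)^-1)).
    apply: ler_sum_nat => n /andP[n0 nZ]; rewrite distrC; apply: sing_diff.
    by rewrite n0 (leq_trans _ ZY).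
  rewrite -mulr_sumr.
  apply: le_trans (ler_wpM2l _ (sum_inv_sqrt Z)) _; first by rewrite mulr_ge0 ?exprn_ge0.
  have E : Z%:R / Num.sqrt Z%:R = Num.sqrt Z%:R :> R.
    by rewrite -[X in X / _](sqr_sqrtr (ltW ZR)) expr2 mulfK ?gt_eqF.
  have -> : 8 * th ^+ 6 / Num.sqrt Z%:R * Z%:R = 8 * th ^+ 6 * (Z%:R / Num.sqrt Z%:R) by ring.
  by rewrite E; lra.
have H1 := main X; rewrite X0 XY in H1; have H2 := main Y; rewrite leqnn (leq_trans X0 XY) in H2.
have -> a b : a / X%:R - b / Y%:R = (a / X%:R - sing Y) - (b / Y%:R - sing Y) by ring.
apply: le_trans (ler_normB _ _) _.
have H3 : (Num.sqrt Y%:R)^-1 <= (Num.sqrt X%:R)^-1 :> R.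
  by rewrite lef_pV2 ?posrE ?sqrtr_gt0 ?ltr0n ?(leq_trans X0 XY)// ler_wsqrtr// ler_nat.
have K0 : 0 <= 8 * th ^+ 6 by rewrite mulr_ge0 ?exprn_ge0.
have := ler_wpM2l K0 H3; have := H1 isT; have := H2 isT; lra.
Qed.
End SingularSeries.

(** * The sawtooth function *)

Section Sawtooth.
Variable R : realType.
Notation C := (complex R).
Notation nm := (@nm R).
Notation e := (@e R).

Definition saw (t : R) : R := t - (Num.floor t)%:~R - 1 / 2.

Lemma sin_le (x : R) : `|sin x| <= `|x|.
Proof.
have H (y : R) : 0 < y -> `|sin y| <= y.
  move=> y0; have [|c _] := @MVT_segment R sin cos 0 y (ltW y0).
    by apply: continuous_subspaceT => z; exact: continuous_sin.
  rewrite sin0 !subr0 => ->; rewrite normrM (gtr0_norm y0).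
  by rewrite ler_piMl ?cos_max// ltW.
have [x0|x0|->] := ltrgtP x 0; last by rewrite sin0 normr0.
  by rewrite -(normrN (sin x)) -sinN -(normrN x) (gtr0_norm (x := - x)) ?oppr_gt0// H// oppr_gt0.
by rewrite (gtr0_norm x0) H.
Qed.

Lemma nm_one_sub_e_le (t : R) : nm (1 - e t) <= 8 * `|t|.
Proof.
rewrite nm_one_sub_e; have := sin_le (pi * t).
rewrite normrM (gtr0_norm (pi_gt0 R)) => H.
have : pi <= 4 :> R by have := pihalf_lt2 R; lra.
have := normr_ge0 t; nra.
Qed.

Lemma nm_e_sub (s t : R) : nm (e s - e t) <= 8 * `|s - t|.
Proof.
have -> : e s - e t = e s * (1 - e (t - s)).
  by rewrite mulrBr mulr1 -eD; congr (_ - e _); ring.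
rewrite nmM nm_e mul1r (le_trans (nm_one_sub_e_le _))// distrC.
exact: lexx.
Qed.

Lemma nm_one_sub_e_ge (t : R) : `|t| <= 1 / 2 -> 2 * `|t| <= nm (1 - e t).
Proof.
move=> t1; rewrite nm_one_sub_e ler_wpM2l//.
have H (y : R) : 0 <= y -> y <= 1 / 2 -> y <= `|sin (pi * y)|.
  move=> y0 y1; apply: le_trans (ler_norm _).
  apply: le_trans (sinpi_lower _); last by apply/andP; split; lra.
  by rewrite le_min lexx /=; lra.
have [t0|t0] := leP 0 t; first by rewrite (ger0_norm t0) in t1 *; exact: H.
rewrite (ltr0_norm t0) in t1 *.
have -> : pi * t = - (pi * - t) by ring.
rewrite sinN normrN.
by apply: H => //; rewrite oppr_ge0 ltW.
Qed.

Lemma nm_geometric (z : C) (m : nat) : nm z = 1 -> nm (1 - z) * nm (\sum_(u < m) z ^+ u) <= 2.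
Proof.
move=> z1; rewrite -nmM.
have -> : (1 - z) * \sum_(u < m) z ^+ u = 1 - z ^+ m by rewrite -[1 in RHS](expr1n _ m) subrXX; congr (_ * _); apply: eq_bigr => i _; rewrite expr1n mul1r.
have zm : nm (z ^+ m) = 1 by elim: m => [|m IH]; rewrite ?expr0 ?nm1// exprS nmM z1 IH mulr1.
by apply: le_trans (nmD _ _) _; rewrite nmN zm nm1.
Qed.

Section Finite.
Variable L : nat.
Hypothesis L1 : (1 < L)%N.
Notation ZL := 'Z_L.
Notation ez := (@ez R L).
Let L0 : (0 < L)%N. Proof. exact: ltnW. Qed.
Let L0R : 0 < L%:R :> R. Proof. by rewrite ltr0n. Qed.

Lemma ez_centered (h : ZL) (n : int) : ez (h * n%:~R) = e ((centered h)%:~R * n%:~R / L%:R).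
Proof.
have -> : (centered h)%:~R * n%:~R = (centered h * n)%:~R :> R by rewrite rmorphM.
by rewrite e_intq// rmorphM /= centeredK.
Qed.

Lemma ez_gap (h : ZL) : 2 * (`|centered h|%:~R / L%:R) <= nm (1 - ez h).
Proof.
have -> : ez h = e ((centered h)%:~R / L%:R).
  by have := ez_centered h 1; rewrite !mulr1.
have E : `|(centered h)%:~R / L%:R| = `|centered h|%:~R / L%:R :> R.
  by rewrite normrM normfV (gtr0_norm L0R) intr_norm.
rewrite -E; apply: nm_one_sub_e_ge; rewrite E ler_pdivrMr//.
by have := @centered_le R _ L1 h; rewrite mulr2n; lra.
Qed.

Lemma centered_neq0 (h : ZL) : h != 0 -> 1 <= `|centered h|%:~R :> R.
Proof.
move=> h0; rewrite (ler_int _ 1) -gtz0_ge1 normr_gt0.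
by apply: contra h0 => /eqP H; rewrite -(centeredK L1 h) H.
Qed.

(* The sawtooth at [y / L], shifted by [1 / (2 L)] so that it has mean zero over [ZL]. *)
Definition dsaw (y : ZL) : R := (y : nat)%:R / L%:R - (1 / 2 - 1 / (2 * L%:R)).

Definition dsaw_coef (h : ZL) : C :=
  if h == 0 then 0 else - (L%:R^-1)%:C%C / (1 - ez (- h)).

(* Both sides have the same differences and mean zero. *)
Lemma dsaw_fourier (y : ZL) : (dsaw y)%:C%C = \sum_(h : ZL) dsaw_coef h * ez (h * y).
Proof.
pose P (y : ZL) := \sum_(h : ZL) dsaw_coef h * ez (h * y).
have LC : (L%:R : C) != 0 by rewrite -(rmorph_nat (real_complex R)) /= fmorph_eq0 gt_eqF.
have LV : (L%:R^-1)%:C%C = (L%:R : C)^-1 by rewrite fmorphV /= rmorph_nat.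
have step (x : ZL) : P x - P (x - 1) = (L%:R : C)^-1 - (if x == 0 then 1 else 0).
  rewrite /P -sumrB.
  transitivity (\sum_(h : ZL) (if h == 0 then 0 else - (L%:R : C)^-1 * ez (x * h))).
    apply: eq_bigr => h _; rewrite /dsaw_coef; case: eqP => [|/eqP h0]; first by rewrite !mul0r subrr.
    rewrite LV mulrBr mulr1 ezD// -mulrBr -{1}[ez (h * x)]mulr1 -mulrBr [ez (h * x) * _]mulrC.
    rewrite [LHS]mulrA divfK; first by rewrite [x * h]mulrC.
    by rewrite subr_eq0 eq_sym; apply: ez_neq1; rewrite ?oppr_eq0.
  rewrite (bigD1 0)//= add0r.
  rewrite (eq_bigr (fun h : ZL => - (L%:R : C)^-1 * ez (x * h))); last by move=> h /negPf ->.
  have := ez_sum R L1 x; rewrite (bigD1 0)//= mulr0 ez0 => E.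
  rewrite -big_distrr /=.
  have -> : \sum_(i : ZL | i != 0) ez (x * i) = (if x == 0 then L%:R else 0) - 1.
    by rewrite -E [1 + _]addrC addrK.
  case: eqP => _; first by rewrite mulNr mulrBr mulVf// mulr1 opprB.
  by rewrite sub0r mulrN1 opprK subr0.
have val n : (n < L)%N -> P n%:R = P 0 + n%:R / L%:R.
  elim: n => [|n IH] nL; first by rewrite mul0r addr0.
  have := step n.+1%:R; rewrite -natr1 addrK IH ?(ltnW nL)//.
  have -> : (n%:R + 1 == 0 :> ZL) = false.
    apply/negbTE; rewrite natr1; apply/eqP => /(congr1 (fun z : ZL => z : nat)) /=.
    by rewrite val_Zp_nat// modn_small.
  move/(canRL (subrK _)); rewrite subr0 => ->.
  by rewrite -natr1 mulrDl mul1r; ring.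
have P0 : P 0 = - (L%:R - 1) / 2 / L%:R.
  have tot : \sum_(x : ZL) P x = 0.
    rewrite exchange_big big1//= => h _; rewrite -big_distrr /= ez_sum//.
    by rewrite /dsaw_coef; case: eqP; rewrite ?mul0r ?mulr0.
  have E : \sum_(x : ZL) P x = L%:R * P 0 + (L%:R - 1) / 2.
    rewrite (eq_bigr (fun x : ZL => P 0 + (x : nat)%:R / L%:R)); last first.
      by move=> x _; rewrite -{1}[x]natr_Zp val// ltn_Zp.
    rewrite big_split /= sumr_const card_ord Zp_cast// mulr_natl; congr (_ + _).
    rewrite -(big_mkord xpredT (fun x => x%:R / L%:R : C)).
    rewrite -big_distrl /=.
    have -> : \sum_(0 <= x < L) x%:R = L%:R * (L%:R - 1) / 2 :> C.
      elim: (L) => [|n IH]; first by rewrite big_geq// mul0r mul0r.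
      by rewrite big_nat_recr//= IH -natr1; field.
    by field.
  apply: (mulfI LC); move: tot; rewrite E => /eqP; rewrite addr_eq0 => /eqP ->.
  by field.
rewrite -[RHS]/(P y).
have -> : P y = P 0 + (y : nat)%:R / L%:R by rewrite -{1}[y]natr_Zp val// ltn_Zp.
rewrite P0 /dsaw.
rewrite !(rmorphB, rmorphD, rmorphM, fmorphV) /= !(rmorph_nat, rmorph1).
have C2 : (2 : C) != 0 by rewrite pnatr_eq0.
by field; rewrite LC.
Qed.

Lemma nm_one_sub_ezN (h : ZL) : nm (1 - ez (- h)) = nm (1 - ez h).
Proof.
have -> : 1 - ez (- h) = - (ez (- h) * (1 - ez h)) by rewrite mulrBr ezN// mulr1 opprB.
by rewrite nmN nmM nm_ez mul1r.
Qed.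

Lemma dsaw_coef_le (h : ZL) : h != 0 -> nm (dsaw_coef h) <= (2 * `|centered h|%:~R)^-1.
Proof.
move=> h0; rewrite /dsaw_coef (negPf h0).
have j1 := centered_neq0 h0; set j : R := `|centered h|%:~R in j1 *.
have G : 2 * (j / L%:R) <= nm (1 - ez h) := ez_gap h.
have G0 : 0 < 2 * (j / L%:R) by rewrite mulr_gt0// divr_gt0//; lra.
have nz : 1 - ez (- h) != 0.
  apply/eqP => E; have : nm (1 - ez (- h)) = 0 by rewrite E nm0.
  by rewrite nm_one_sub_ezN; lra.
have nV : nm ((1 - ez (- h))^-1) * nm (1 - ez h) = 1.
  by rewrite -nm_one_sub_ezN -nmM mulVf// nm1.
rewrite nmM nmN nm_real ger0_norm ?invr_ge0 ?ler0n//.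
have V0 := nm_ge0 ((1 - ez (- h))^-1).
have H : nm ((1 - ez (- h))^-1) * (2 * (j / L%:R)) <= 1 by rewrite -[leRHS]nV; apply: ler_wpM2l.
rewrite -[leRHS]mul1r ler_pdivlMr; last by rewrite mulr_gt0//; lra.
by apply: le_trans H; rewrite le_eqVlt; apply/orP; left; apply/eqP; field; rewrite gt_eqF.
Qed.

Lemma ezX (a : ZL) (u : nat) : ez (a * u%:R) = ez a ^+ u.
Proof.
elim: u => [|u IH]; first by rewrite mulr0 ez0 expr0.
by rewrite -natr1 mulrDr mulr1 ezD// IH exprSr.
Qed.

Lemma dsaw_shift (a : ZL) (u : nat) : dsaw (a + u%:R) <= dsaw a + u%:R / L%:R.
Proof.
rewrite /dsaw addrAC lerD2r -mulrDl ler_pM2r ?invr_gt0// -natrD ler_nat /=.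
by apply: leq_trans (leq_mod _ _) _; rewrite leq_add2l val_Zp_nat// leq_mod.
Qed.

Lemma sum_centered (G : nat -> R) : (forall j, 0 <= G j) ->
  \sum_(h : ZL | h != 0) G `|centered h|%N <= 2 * \sum_(1 <= j < L) G j.
Proof.
move=> G0.
have H (h : ZL) : h != 0 -> G `|centered h|%N <= G h + G (L - h)%N.
  move=> _; have hL := ltn_Zp L1 h; rewrite /centered; case: ifP => _; first by rewrite lerDl.
  by rewrite distnC distnEl ?(ltnW hL)// lerDr.
apply: le_trans (ler_sum _ H) _.
have conv (F : nat -> R) : \sum_(h : ZL | h != 0) F h = \sum_(1 <= j < L) F j.
  rewrite (eq_bigl (fun h : ZL => (h : nat) != 0%N)); last by move=> h; rewrite -val_eqE.
  rewrite -(big_mkord (fun h => h != 0%N) F) Zp_cast// big_mkcond big_ltn//= add0r.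
  by apply: eq_big_nat => j /andP[]; case: j.
rewrite big_split /= (conv G) (conv (fun h => G (L - h)%N)) mulr_natl mulr2n lerD2l.
rewrite big_nat_rev /= le_eqVlt; apply/orP; left; apply/eqP; apply: eq_big_nat => j /andP[j1 jL].
by rewrite add1n subSS subKn// ltnW.
Qed.

Section Averaging.
Variables (I : Type) (s : seq I) (v : I -> R) (y : I -> ZL) (N : R).
Hypotheses (v0 : forall i, 0 <= v i) (vN : \sum_(i <- s) v i <= N).
Variables (eta : R) (m : nat).
Hypotheses (eta0 : 0 < eta) (m0 : (0 < m)%N) (mL : eta * L%:R <= m%:R).

Let mR : 0 < m%:R :> R. Proof. by rewrite ltr0n. Qed.

Definition avg (sg : ZL) : R := m%:R^-1 * \sum_(u < m) \sum_(i <- s) v i * dsaw (y i + sg * u%:R).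

(** Averaging over [m] shifts multiplies the coefficient at h by a normalized geometric sum. This is
    at most 1, and at most L / (m |h|) <= 1 / (eta |h|) because 1 - e(h / L) is at least 2 |h| /
    L. *)
Lemma avg_le (sg : ZL) : sg = 1 \/ sg = -1 ->
  `|avg sg| <= \sum_(h : ZL | h != 0) (2 * `|centered h|%:~R)^-1 * Num.min 1 (`|centered h|%:~R * eta)^-1
     * nm (\sum_(i <- s) (v i)%:C%C * ez (h * y i)).
Proof.
move=> sg1; have mR' := mR; have eta0' := eta0; have mL' := mL.
have -> : `|avg sg| = nm ((avg sg)%:C%C) by rewrite nm_real.
have -> : (avg sg)%:C%C = \sum_(h : ZL) dsaw_coef h * ((m%:R^-1)%:C%C * \sum_(u < m) ez (h * sg) ^+ u)
    * \sum_(i <- s) (v i)%:C%C * ez (h * y i).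
  have E (u : 'I_m) : (\sum_(i <- s) v i * dsaw (y i + sg * u%:R))%:C%C
     = \sum_(h : ZL) dsaw_coef h * ez (h * sg) ^+ u * \sum_(i <- s) (v i)%:C%C * ez (h * y i).
    rewrite rmorph_sum /=.
    transitivity (\sum_(i <- s) \sum_(h : ZL) dsaw_coef h * ez (h * sg) ^+ u * ((v i)%:C%C * ez (h * y i))).
      apply: eq_bigr => i _; rewrite rmorphM /= dsaw_fourier mulr_sumr; apply: eq_bigr => h _.
      have -> : h * (y i + sg * u%:R) = h * y i + h * sg * u%:R by ring.
      by rewrite ezD// ezX; ring.
    by rewrite exchange_big /=; apply: eq_bigr => h _; rewrite mulr_sumr.
  transitivity (\sum_(u < m) \sum_(h : ZL) (m%:R^-1)%:C%C * (dsaw_coef h * ez (h * sg) ^+ u * \sum_(i <- s) (v i)%:C%C * ez (h * y i))).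
    rewrite /avg mulr_sumr rmorph_sum; apply: eq_bigr => u _.
    by rewrite -mulr_sumr -E -rmorphM.
  rewrite exchange_big /=; apply: eq_bigr => h _.
  set W := \sum_(i <- s) _.
  transitivity (\sum_(u < m) ((m%:R^-1)%:C%C * dsaw_coef h * W) * ez (h * sg) ^+ u).
    by apply: eq_bigr => u _; ring.
  by rewrite -mulr_sumr; ring.
apply: le_trans (nm_sum _ _ _) _.
rewrite (bigD1 0)//= {1}/dsaw_coef eqxx !mul0r nm0 add0r.
apply: ler_sum => h h0; rewrite nmM; apply: ler_wpM2r; first exact: nm_ge0.
rewrite nmM; apply: ler_pM; rewrite ?nm_ge0//; first exact: dsaw_coef_le.
have j1 := centered_neq0 h0; set j : R := `|centered h|%:~R in j1 *.
have G : 2 * (j / L%:R) <= nm (1 - ez (h * sg)).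
  by case: sg1 => ->; rewrite ?mulr1 ?mulrN1 ?nm_one_sub_ezN; exact: ez_gap.
rewrite nmM nm_real ger0_norm ?invr_ge0 ?ler0n// le_min; apply/andP; split.
  rewrite mulrC ler_pdivrMr// mul1r; apply: le_trans (nm_sum _ _ _) _.
  apply: (@le_trans _ _ (\sum_(u < m) 1)); last by rewrite sumr_const card_ord.
  by apply: ler_sum => u _; rewrite -ezX nm_ez.
have nmS := nm_geometric m (nm_ez R (h * sg)).
set S := nm (\sum_(u < m) _) in nmS *.
have S0 : 0 <= S := nm_ge0 _.
have H : 2 * (j / L%:R) * S <= 2 by apply: le_trans nmS; exact: ler_wpM2r.
have je : 0 < j * eta by rewrite mulr_gt0//; lra.
rewrite ler_pdivrMl// ler_pdivlMr//; apply: le_trans mL'.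
have -> : S * (j * eta) = eta * L%:R * (j / L%:R * S) by field; rewrite gt_eqF.
rewrite -[leRHS]mulr1; apply: ler_wpM2l; last lra.
by rewrite mulr_ge0 ?ler0n// ltW.
Qed.

(* [dsaw] increases by at most [u / L] over [u] steps, so it is bounded by its
   averages over short windows, whose Fourier coefficients decay twice as fast. *)
Lemma dsaw_sum_le : `|\sum_(i <- s) v i * dsaw (y i)| <= m%:R / L%:R * N + Num.max `|avg 1| `|avg (-1)|.
Proof.
have mR' := mR; have vN' := vN.
have mL0 : 0 <= m%:R / L%:R :> R by rewrite divr_ge0 ?ler0n.
have key (sg : R) (z : ZL) (F : I -> R) : (forall u : 'I_m, forall i, F i <= sg * dsaw (y i + z * u%:R) + m%:R / L%:R) ->
   \sum_(i <- s) v i * F i <= m%:R / L%:R * N + sg * avg z.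
  move=> H; rewrite /avg.
  have -> : sg * (m%:R^-1 * \sum_(u < m) \sum_(i <- s) v i * dsaw (y i + z * u%:R))
    = m%:R^-1 * \sum_(u < m) \sum_(i <- s) v i * (sg * dsaw (y i + z * u%:R)).
    rewrite mulrCA mulr_sumr; congr (_ * _); apply: eq_bigr => u _.
    by rewrite mulr_sumr; apply: eq_bigr => i _; ring.
  have -> : \sum_(i <- s) v i * F i = m%:R^-1 * \sum_(u < m) \sum_(i <- s) v i * F i.
    by rewrite sumr_const card_ord -[X in _ = _ * X]mulr_natl mulKf// gt_eqF.
  have -> : m%:R / L%:R * N = m%:R^-1 * \sum_(u < m) (m%:R / L%:R * N).
    by rewrite sumr_const card_ord -[X in _ = _ * X]mulr_natl mulKf// gt_eqF.
  rewrite -mulrDr -big_split /=; apply: ler_wpM2l; first by rewrite invr_ge0 ltW.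
  apply: ler_sum => u _.
  apply: (@le_trans _ _ (\sum_(i <- s) (v i * (m%:R / L%:R) + v i * (sg * dsaw (y i + z * u%:R))))).
    apply: ler_sum => i _; rewrite -mulrDr; apply: ler_wpM2l; first exact: v0.
    by rewrite addrC; exact: H.
  rewrite big_split /= lerD2r -mulr_suml mulrC; exact: ler_wpM2l.
have um (u : 'I_m) : u%:R / L%:R <= m%:R / L%:R :> R by rewrite ler_pM2r ?invr_gt0// ler_nat ltnW.
have a1 : 1 * avg (-1) <= Num.max `|avg 1| `|avg (-1)|.
  by rewrite mul1r; apply: le_trans (ler_norm _) _; rewrite le_max lexx orbT.
have a2 : -1 * avg 1 <= Num.max `|avg 1| `|avg (-1)|.
  by rewrite mulN1r; apply: le_trans (ler_norm _) _; rewrite normrN le_max lexx.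
rewrite ler_norml; apply/andP; split.
  have K := @key (-1) 1 (fun i => - dsaw (y i)) _.
  rewrite lerNl -sumrN; apply: le_trans (_ : \sum_(i <- s) v i * - dsaw (y i) <= _).
    by apply: ler_sum => i _; rewrite mulrN.
  apply: le_trans (K _) _; last by rewrite lerD2l.
  move=> u i; have := dsaw_shift (y i) u; rewrite mul1r mulN1r; have := um u; lra.
have K := @key 1 (-1) (fun i => dsaw (y i)) _.
apply: le_trans (K _) _; last by rewrite lerD2l.
move=> u i; have := dsaw_shift (y i + -1 * u%:R) u; rewrite mulN1r subrK mul1r; have := um u; lra.
Qed.

End Averaging.
End Finite.

Lemma tail_inv_sqr (K M : nat) : (0 < K)%N -> \sum_(K.+1 <= j < M) (j%:R ^+ 2)^-1 <= K%:R^-1 :> R.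
Proof.
move=> K0; have KR : 0 < K%:R :> R by rewrite ltr0n.
have [le|lt] := leqP M K.+1; first by rewrite big_geq// invr_ge0 ltW.
suff H : \sum_(K.+1 <= j < M) (j%:R ^+ 2)^-1 <= K%:R^-1 - M.-1%:R^-1 :> R.
  by apply: le_trans H _; rewrite gerBl invr_ge0.
move: (ltnW lt) => {}lt; elim: M lt => // M IH; rewrite ltnS leq_eqVlt => /predU1P[<-|lt].
  by rewrite big_geq//= subrr.
have M1 : (1 < M)%N := leq_ltn_trans K0 lt.
have M0 : 0 < M%:R :> R by rewrite ltr0n ltnW.
have Mp : 0 < M.-1%:R :> R by rewrite ltr0n; case: (M) M1 => [|[]].
have E : M%:R = M.-1%:R + 1 :> R by rewrite natr1 prednK//; case: (M) lt.
rewrite big_nat_recr//=; apply: le_trans (lerD (IH lt) (lexx _)) _.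
have : (M%:R ^+ 2)^-1 <= M.-1%:R^-1 - M%:R^-1 :> R.
  have -> : M.-1%:R^-1 - M%:R^-1 = (M.-1%:R * M%:R)^-1 :> R.
    by rewrite E; field; rewrite -E !gt_eqF.
  by rewrite lef_pV2 ?posrE ?mulr_gt0 ?exprn_gt0// expr2 ler_pM2r// E; lra.
lra.
Qed.

Lemma nm_conj (z : C) : nm (conjc z) = nm z.
Proof.
apply/eqP; rewrite -(@eqrXn2 _ 2)// ?nm_ge0//; apply/eqP.
by apply: (@fmorph_inj _ _ (real_complex R)); rewrite /= !nm_sqr conjcK mulrC.
Qed.

(** The points are rounded to a grid of mesh 1 / L. Frequencies up to [K] are moved back to the true
    points at a total cost O(K N / L); for the larger ones the exponential sum is bounded by [N],
    and the coefficients 1 / (eta h^2) leave a tail N / (eta K) <= eta N. *)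
Theorem sawtooth_bound (I : Type) (s : seq I) (v th : I -> R) (N eta : R) (K : nat) :
  (forall i, 0 <= v i) -> \sum_(i <- s) v i <= N -> 0 < eta <= 1 -> 1 <= eta ^+ 2 * K%:R ->
  `|\sum_(i <- s) v i * saw (th i)| <= 5 * eta * N
    + \sum_(1 <= k < K.+1) k%:R^-1 * Num.min 1 (k%:R * eta)^-1
        * nm (\sum_(i <- s) (v i)%:C%C * e (k%:R * th i)).
Proof.
move=> v0 vN /andP[e0 e1] eK.
have N0 : 0 <= N by apply: le_trans vN; apply: sumr_ge0.
have K0 : (0 < K)%N by case: K eK => //; rewrite mulr0 ler10.
have KR : 1 <= K%:R :> R by rewrite ler1n.
have Ke0 : 0 <= 16 * K%:R / eta by rewrite divr_ge0 ?mulr_ge0 ?ler0n// ltW.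
(* With 16 K <= eta L, both the mesh and the rounding of all frequencies up to [K] cost less than
   [eta] relative to [N]. *)
have [L L1 LK] : exists2 L, (1 < L)%N & 16 * K%:R <= eta * L%:R.
  exists (Num.truncn (16 * K%:R / eta)).+2 => //.
  rewrite -ler_pdivrMl// [leLHS]mulrC; apply: ltW; apply: lt_le_trans (truncnS_gt _) _.
  by rewrite ler_nat.
have LR : 0 < L%:R :> R by rewrite ltr0n ltnW.
have eL0 : 0 <= eta * L%:R by rewrite mulr_ge0// ltW.
have [m [m0 mL mL2]] : exists m, [/\ (0 < m)%N, eta * L%:R <= m%:R & m%:R <= eta * L%:R + 1].
  exists (Num.truncn (eta * L%:R)).+1; split=> //; first by apply: ltW; apply: truncnS_gt.
  by rewrite -natr1 lerD2r; have /andP[] := truncn_itv eL0.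
pose fr i := th i - (Num.floor (th i))%:~R.
have fr01 i : 0 <= fr i < 1.
  by have := floor_itv (th i); rewrite /fr rmorphD /= => /andP[]; rewrite subr_ge0 ltrBlDl => -> ->.
pose n i := Num.truncn (L%:R * fr i).
have n_itv i : (n i)%:R <= L%:R * fr i < (n i)%:R + 1.
  by rewrite natr1; apply: truncn_itv; have /andP[f0 _] := fr01 i; rewrite mulr_ge0 ?ler0n.
have nL i : (n i < L)%N.
  rewrite -(ltr_nat R); have /andP[a _] := n_itv i; apply: le_lt_trans a _.
  by rewrite gtr_pMr//; have /andP[] := fr01 i.
pose y i : 'Z_L := (n i)%:R.
have yE i : (y i : nat) = n i by rewrite val_Zp_nat// modn_small.
have close i : `|saw (th i) - dsaw (y i)| <= 1 / L%:R.
  rewrite /saw /dsaw yE -/(fr i).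
  have -> : fr i - 1 / 2 - ((n i)%:R / L%:R - (1 / 2 - 1 / (2 * L%:R)))
     = ((L%:R * fr i - (n i)%:R) - 1 / 2) / L%:R by field; rewrite gt_eqF.
  rewrite normrM normfV (gtr0_norm LR) ler_pM2r ?invr_gt0//.
  by have /andP[a b] := n_itv i; rewrite ler_norml; apply/andP; split; lra.
pose V k := nm (\sum_(i <- s) (v i)%:C%C * e (k%:R * th i)).
have V0 k : 0 <= V k by apply: nm_ge0.
have W_le (h : 'Z_L) : nm (\sum_(i <- s) (v i)%:C%C * @ez R L (h * y i)) <= N.
  apply: le_trans (nm_sum _ _ _) _; apply: le_trans vN; apply: ler_sum => i _.
  by rewrite nmM nm_real nm_ez mulr1 ger0_norm.
have W_close (h : 'Z_L) : nm (\sum_(i <- s) (v i)%:C%C * @ez R L (h * y i))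
    <= V `|centered h|%N + 8 * `|centered h|%N%:R / L%:R * N.
  pose U := \sum_(i <- s) (v i)%:C%C * e ((centered h)%:~R * th i).
  have UV : nm U = V `|centered h|%N.
    rewrite /U /V; have [h0|h0] := leP 0 (centered h).
      by congr nm; apply: eq_bigr => i _; rewrite pmulrn gez0_abs.
    rewrite -[LHS]nm_conj (big_morph conjc (rmorphD _) (rmorph0 _)); congr nm; apply: eq_bigr => i _.
    have vr : conjc (v i)%:C%C = (v i)%:C%C by rewrite /conjc /= oppr0.
    rewrite conj_mul vr conj_e; congr (_ * e _).
    by rewrite pmulrn ltz0_abs// rmorphN mulNr.
  have -> : \sum_(i <- s) (v i)%:C%C * @ez R L (h * y i) = U + \sum_(i <- s) (v i)%:C%C * (@ez R L (h * y i) - e ((centered h)%:~R * th i)).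
    by rewrite /U -big_split /=; apply: eq_bigr => i _; rewrite -mulrDr addrC subrK.
  apply: le_trans (nmD _ _) _; rewrite UV lerD2l; apply: le_trans (nm_sum _ _ _) _.
  apply: (@le_trans _ _ (\sum_(i <- s) 8 * `|centered h|%N%:R / L%:R * v i)); last first.
    by rewrite -mulr_sumr; apply: ler_wpM2l => //; rewrite mulr_ge0 ?invr_ge0 ?mulr_ge0 ?ler0n.
  apply: ler_sum => i _; rewrite nmM nm_real ger0_norm// mulrC; apply: ler_wpM2r => //.
  have -> : @ez R L (h * y i) = e ((centered h)%:~R * (n i)%:R / L%:R).
    by have := ez_centered L1 h (n i); rewrite -!pmulrn.
  have -> : e ((centered h)%:~R * th i) = e ((centered h)%:~R * fr i).
    rewrite /fr mulrBr -[e (_ * th i)](mulr1 _).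
    have <- : e (- ((centered h)%:~R * (Num.floor (th i))%:~R)) = 1.
      by rewrite -rmorphM -rmorphN /= e_int.
    by rewrite -eD.
  apply: le_trans (nm_e_sub _ _) _.
  have -> : (centered h)%:~R * (n i)%:R / L%:R - (centered h)%:~R * fr i = (centered h)%:~R * ((n i)%:R / L%:R - fr i) :> R by ring.
  rewrite normrM -[leRHS]mulrA ler_pM2l// -intr_norm.
  have -> : `|centered h|%:~R = `|centered h|%N%:R :> R by rewrite [RHS]pmulrn abszE.
  apply: ler_wpM2l; first exact: ler0n.
  have -> : (n i)%:R / L%:R - fr i = ((n i)%:R - L%:R * fr i) / L%:R by field; rewrite gt_eqF.
  rewrite normrM normfV (gtr0_norm LR) -[leRHS]mul1r ler_pM2r ?invr_gt0//.
  by have /andP[a b] := n_itv i; rewrite ler_norml; apply/andP; split; lra.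
pose mn k : R := Num.min 1 (k%:R * eta)^-1.
have mn0 k : 0 <= mn k by rewrite le_min ler01 invr_ge0 mulr_ge0 ?ler0n// ltW.
pose G (j : nat) : R := (2 * j%:R)^-1 * mn j * (if (j <= K)%N then V j + 8 * j%:R / L%:R * N else N).
have G0 j : 0 <= G j.
  rewrite /G mulr_ge0// ?mulr_ge0// ?invr_ge0 ?mulr_ge0 ?ler0n//; case: ifP => // _.
  by rewrite addr_ge0// !mulr_ge0 ?invr_ge0 ?ler0n.
have AG (sg : 'Z_L) : sg = 1 \/ sg = -1 -> `|avg s v y m sg| <= 2 * \sum_(1 <= j < L) G j.
  move=> sg1; have H := @avg_le L L1 I s v y eta m e0 m0 mL sg sg1; apply: (le_trans H).
  apply: le_trans (sum_centered L1 G0); apply: ler_sum => h _.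
  have -> : `|centered h|%:~R = `|centered h|%N%:R :> R by rewrite [RHS]pmulrn abszE.
  rewrite /G; apply: ler_wpM2l; first by apply: mulr_ge0; [rewrite invr_ge0 mulr_ge0 ?ler0n | exact: mn0].
  by case: ifP => _; [exact: W_close | exact: W_le].
have GS : 2 * \sum_(1 <= j < L) G j <= \sum_(1 <= k < K.+1) k%:R^-1 * mn k * V k + 8 * K%:R / L%:R * N + eta^-1 * K%:R^-1 * N.
  have KL : (K.+1 <= L)%N.
    rewrite -(ler_nat R) -natr1; have : eta * L%:R <= L%:R by rewrite ger_pMl.
    lra.
  rewrite mulr_sumr (@big_cat_nat _ _ _ K.+1)//=; apply: lerD.
    apply: (@le_trans _ _ (\sum_(1 <= k < K.+1) (k%:R^-1 * mn k * V k + 8 / L%:R * N))).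
      apply: ler_sum_nat => k /andP[k0 kK]; rewrite /G -ltnS kK.
      have kR : k%:R != 0 :> R by rewrite pnatr_eq0 -lt0n.
      have -> : 2 * ((2 * k%:R)^-1 * mn k * (V k + 8 * k%:R / L%:R * N)) = k%:R^-1 * mn k * V k + mn k * (8 / L%:R * N).
        by field; rewrite kR gt_eqF.
      rewrite lerD2l ler_piMl ?mulr_ge0 ?invr_ge0 ?ler0n//.
      by rewrite /mn ge_min lexx.
    rewrite big_split /= lerD2l sumr_const_nat subSS subn0 -[leLHS]mulr_natl.
    by rewrite le_eqVlt; apply/orP; left; apply/eqP; ring.
  apply: (@le_trans _ _ (\sum_(K.+1 <= j < L) eta^-1 * N * (j%:R ^+ 2)^-1)).
    apply: ler_sum_nat => j /andP[Kj _]; rewrite /G leqNgt Kj /=.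
    have jR : 0 < j%:R :> R by rewrite ltr0n (leq_trans _ Kj).
    have H : mn j <= (j%:R * eta)^-1 by rewrite /mn ge_min lexx orbT.
    have -> : eta^-1 * N * (j%:R ^+ 2)^-1 = 2 * ((2 * j%:R)^-1 * (j%:R * eta)^-1 * N) by field; rewrite !gt_eqF.
    rewrite ler_pM2l// ler_wpM2r// ler_wpM2l// invr_ge0 mulr_ge0// ltW.
  rewrite -mulr_sumr.
  have -> : eta^-1 * K%:R^-1 * N = eta^-1 * N * K%:R^-1 by ring.
  by apply: ler_wpM2l (tail_inv_sqr L K0); rewrite mulr_ge0// invr_ge0 ltW.
have D := dsaw_sum_le L1 y v0 vN m0.
have Dmax : Num.max `|avg s v y m 1| `|avg s v y m (-1)| <= 2 * \sum_(1 <= j < L) G j.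
  rewrite ge_max; apply/andP; split; apply: AG; [by left | by right].
have S1 : `|\sum_(i <- s) v i * saw (th i) - \sum_(i <- s) v i * dsaw (y i)| <= 1 / L%:R * N.
  rewrite -sumrB; apply: le_trans (ler_norm_sum _ _ _) _.
  apply: (@le_trans _ _ (\sum_(i <- s) 1 / L%:R * v i)); last first.
    by rewrite -mulr_sumr; apply: ler_wpM2l => //; rewrite divr_ge0 ?ler0n.
  by apply: ler_sum => i _; rewrite -mulrBr normrM (ger0_norm (v0 i)) mulrC ler_wpM2r.
have L16 : 16 * K%:R / L%:R <= eta by rewrite ler_pdivrMr.
have c1 : 1 / L%:R <= eta / 16.
  have : 1 / L%:R <= K%:R / L%:R :> R by rewrite ler_pM2r ?invr_gt0.
  lra.
have c2 : m%:R / L%:R <= eta + eta / 16.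
  apply: le_trans (_ : (eta * L%:R + 1) / L%:R <= _); first by rewrite ler_pM2r ?invr_gt0.
  by rewrite mulrDl mulfK ?gt_eqF//; lra.
have c3 : eta^-1 * K%:R^-1 <= eta.
  rewrite -invfM -[leLHS]mul1r ler_pdivrMr ?mulr_gt0//; last lra.
  by rewrite mulrA -expr2.
have := ler_wpM2r N0 c1; have := ler_wpM2r N0 c2; have := ler_wpM2r N0 c3.
have c4 : 8 * K%:R / L%:R <= eta by have : 0 < eta := e0; lra.
have := ler_wpM2r N0 c4.
rewrite -/(mn _) in GS *.
have -> : \sum_(i <- s) v i * saw (th i) = (\sum_(i <- s) v i * saw (th i) - \sum_(i <- s) v i * dsaw (y i)) + \sum_(i <- s) v i * dsaw (y i) by rewrite subrK.
move=> b1 b2 b3 b4; apply: le_trans (ler_normD _ _) _.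
have eN : 0 <= eta * N by rewrite mulr_ge0// ltW.
have GS' : 2 * \sum_(1 <= j < L) G j <= \sum_(1 <= k < K.+1) k%:R^-1 * Num.min 1 (k%:R * eta)^-1 * V k + 8 * K%:R / L%:R * N + eta^-1 * K%:R^-1 * N := GS.
rewrite /V in GS'; lra.
Qed.
End Sawtooth.

(** * Congruences *)

Section Congruences.
Local Open Scope int_scope.
Local Open Scope ring_scope.

(** In the application K = 2^b, M = 2^c and g is the gcd. Writing n + l = K g x' y, the condition on
    x says that y = g x' modulo 4, and then the condition on d says that q divides x' y - A.
    Conversely this divisibility contains the condition modulo 4, because 4 divides q, A = g and
    x'^2 = 1 modulo 4. So y lies in the single class of y0 modulo q. *)
Lemma solve_congruences (K M d' g x' q A y0 l n : int) :
  g != 0 -> K != 0 -> x' != 0 ->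
  (forall z, (4 %| z)%Z -> (M * 4 * d' %| K * z)%Z = (q %| z)%Z) ->
  (4 %| q)%Z -> coprimez q x' -> (4 %| x' ^+ 2 - 1)%Z ->
  (4 %| A - g)%Z -> (M * 4 * (g * d') %| K * g * A - (l + M * (g * d') ^+ 2))%Z ->
  (q %| x' * y0 - A)%Z ->
  (K * 4 * (g * x') %| n + l - K * (g * x') ^+ 2)%Z && (M * 4 * (g * d') %| n - M * (g * d') ^+ 2)%Z
  = (K * (g * x') * q %| n + l - K * (g * x') * y0)%Z.
Proof.
move=> g0 K0 x0 key q4 cqx x2 A4 Ac Hy.
have KX0 : K * (g * x') != 0 by rewrite !mulf_neq0.
have mulg z : (M * 4 * (g * d') %| g * (K * z))%Z = (M * 4 * d' %| K * z)%Z.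
  by have -> : M * 4 * (g * d') = g * (M * 4 * d') by [ring]; rewrite dvdz_mul2l.
apply/andP/idP => [[/dvdzP[k H1] H2]|/dvdzP[k H]].
  pose y := g * x' + 4 * k.
  have Ey : n + l = K * (g * x') * y.
    by have := H1; rewrite /y => /(canRL (subrK _)) ->; ring.
  have d4 : (4 %| x' * y - A)%Z.
    have -> : x' * y - A = g * (x' ^+ 2 - 1) - (A - g) + 4 * (k * x') by rewrite /y; ring.
    by rewrite rpredD ?dvdz_mulr// rpredB// dvdz_mull.
  rewrite Ey -mulrBr dvdz_mul2l// -(@Gauss_dvdzr _ x')//.
  have -> : x' * (y - y0) = (x' * y - A) - (x' * y0 - A) by ring.
  rewrite rpredB// -key// -mulg.
  have -> : g * (K * (x' * y - A)) = (n - M * (g * d') ^+ 2) - (K * g * A - (l + M * (g * d') ^+ 2)).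
    have -> : g * (K * (x' * y - A)) = K * (g * x') * y - K * g * A by ring.
    by rewrite -Ey; ring.
  exact: rpredB.
pose y := y0 + k * q.
have Ey : n + l = K * (g * x') * y.
  by have := H; rewrite /y => /(canRL (subrK _)) ->; ring.
have dq : (q %| x' * y - A)%Z.
  have -> : x' * y - A = (x' * y0 - A) + x' * k * q by rewrite /y; ring.
  by rewrite rpredD// dvdz_mull.
have d4 : (4 %| x' * y - A)%Z by apply: dvdz_trans q4 dq.
split.
  have -> : n + l - K * (g * x') ^+ 2 = K * (g * x') * (y - g * x') by rewrite Ey; ring.
  have -> : K * 4 * (g * x') = K * (g * x') * 4 by ring.
  rewrite dvdz_mul2l//.
  have c4 : coprimez 4 x' by apply: coprimez_dvdl q4 cqx.
  rewrite -(@Gauss_dvdzr _ x')//.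
  have -> : x' * (y - g * x') = (x' * y - A) + (A - g) - g * (x' ^+ 2 - 1) by ring.
  by rewrite rpredB//; [rewrite rpredD | exact: dvdz_mull].
have -> : n - M * (g * d') ^+ 2 = g * (K * (x' * y - A)) + (K * g * A - (l + M * (g * d') ^+ 2)).
  have -> : g * (K * (x' * y - A)) = K * (g * x') * y - K * g * A by ring.
  by rewrite -Ey; ring.
by rewrite rpredD// mulg key.
Qed.

(** The truncated subtraction is intended: for b > c, cancelling 2^b leaves fewer than two factors 2
    in the modulus, and the assumption that 4 divides z restores the exponent 2. *)
Lemma pow2_cancel (b c d' : nat) (z : int) : odd d' -> (4 %| z)%Z ->
  ((2 ^ c)%N%:Z * 4 * d'%:Z %| (2 ^ b)%N%:Z * z)%Z = ((2 ^ (2 + (c - b)) * d')%N%:Z %| z)%Z.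
Proof.
move=> od z4; have [bc|cb] := leqP b c.
  have -> : (2 ^ c)%N%:Z * 4 * d'%:Z = (2 ^ b)%N%:Z * (2 ^ (2 + (c - b)) * d')%N%:Z.
    by rewrite -!PoszM; congr Posz; rewrite -{1}(subnKC bc) !expnD; ring.
  by rewrite dvdz_mul2l// eqz_nat -lt0n expn_gt0.
have -> : (2 + (c - b) = 2)%N by rewrite (eqP (ltnW cb)).
have cop k : coprimez d'%:Z (2 ^ k)%N%:Z by rewrite /coprimez /= /gcdz /= eqz_nat; apply: coprimeXr; rewrite coprimen2.
have -> : (2 ^ b)%N%:Z * z = (2 ^ c)%N%:Z * ((2 ^ (b - c))%N%:Z * z).
  by rewrite mulrA -PoszM -expnD subnKC// ltnW.
rewrite -mulrA dvdz_mul2l ?eqz_nat -?lt0n ?expn_gt0//.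
have c4 : coprimez 4 d'%:Z by rewrite coprimez_sym; exact: (cop 2%N).
have -> : (2 ^ 2 * d')%N%:Z = 4 * d'%:Z by rewrite PoszM.
rewrite !Gauss_dvdz// z4 dvdz_mull//=.
by rewrite Gauss_dvdzr//; exact: cop.
Qed.

Lemma repE c d n : rep c d n = [&& odd d, (2 ^ c * d ^ 2 < n)%N &
  ((2 ^ c)%N%:Z * 4 * d%:Z %| n%:Z - (2 ^ c)%N%:Z * d%:Z ^+ 2)%Z].
Proof.
rewrite /rep; congr [&& _, _ & _].
have -> : (2 ^ c)%N%:Z * 4 * d%:Z = (2 ^ (c + 2) * d)%N%:Z by rewrite expnD !PoszM.
have -> : (2 ^ c)%N%:Z * d%:Z ^+ 2 = (2 ^ c * d ^ 2)%N%:Z by rewrite expr2 -mulnn !PoszM.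
by rewrite -eqz_mod_dvd !modz_nat eqz_nat.
Qed.

(* If [rep c d n] and [rep b x (n + l)] with [g = gcdn d x], then
   [A = (n + l) / (2 ^ b * g)] satisfies these congruences, which do not involve
   [x] and determine [A] modulo [2 ^ (2 + (c - b)) * (d %/ g)]. *)
Definition compat (l b c d g : nat) (A : int) : bool :=
  (4 %| A - g%:Z)%Z && ((2 ^ c)%N%:Z * 4 * d%:Z %| (2 ^ b)%N%:Z * g%:Z * A - (l%:Z + (2 ^ c)%N%:Z * d%:Z ^+ 2))%Z.

(** The condition at the prime 2, with [m] standing for g A modulo 2^(c + 2). It is the same for all
    d and g because odd squares are 1 modulo 4, so that 2^c d^2 = 2^c modulo 2^(c + 2). *)
Definition solvable2 (l b c : nat) : bool :=
  [exists m : 'I_(2 ^ (c + 2)), (4 %| (m : nat)%:Z - 1)%Z && ((2 ^ (c + 2))%N%:Z %| (2 ^ b)%N%:Z * (m : nat)%:Z - (l%:Z + (2 ^ c)%N%:Z))%Z].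

Lemma odd_sqr4 (d : nat) : odd d -> (4 %| d%:Z ^+ 2 - 1)%Z.
Proof.
move=> od; have -> : d%:Z ^+ 2 = (d ^ 2)%N%:Z by rewrite expr2 -mulnn PoszM.
by rewrite -eqz_mod_dvd !modz_nat eqz_nat odd_sqr_mod4.
Qed.

Lemma inverse_mod (m a : int) : coprimez m a -> exists u, (m %| a * u - 1)%Z.
Proof.
move=> /coprimezP[[u v] /= E]; exists v; apply/dvdzP; exists (- u).
by rewrite -E; ring.
Qed.

(* Chinese remainders: the part of the conditions modulo the odd number [d]
   only asks for [g %| l]. *)
Lemma compat_exists (l b c d g : nat) : (0 < l)%N -> odd d -> (g %| d)%N ->
  (exists A, compat l b c d g A) <-> (g %| l)%N && solvable2 l b c.
Proof.
move=> l0 od gd.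
have og : odd g by move/dvdnP: gd od => [k ->]; rewrite oddM => /andP[].
have E4 : (2 ^ (c + 2))%N%:Z = (2 ^ c)%N%:Z * 4 by rewrite expnD PoszM.
have d1 : ((2 ^ c)%N%:Z * 4 %| (2 ^ c)%N%:Z * d%:Z ^+ 2 - (2 ^ c)%N%:Z)%Z.
  rewrite -[X in (_ %| _ - X)%Z]mulr1 -mulrBr dvdz_mul2l ?eqz_nat -?lt0n ?expn_gt0//.
  exact: odd_sqr4.
split=> [[A /andP[A4 Ac]]|/andP[gl /existsP[m /andP[m4 mc]]]].
  apply/andP; split.
    have gA : (g%:Z %| (2 ^ b)%N%:Z * g%:Z * A - (l%:Z + (2 ^ c)%N%:Z * d%:Z ^+ 2))%Z.
      by apply: dvdz_trans Ac; apply: dvdz_mull.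
    have H : (g%:Z %| l%:Z)%Z.
      have -> : l%:Z = (2 ^ b)%N%:Z * g%:Z * A - (2 ^ c)%N%:Z * d%:Z ^+ 2
        - ((2 ^ b)%N%:Z * g%:Z * A - (l%:Z + (2 ^ c)%N%:Z * d%:Z ^+ 2)) by ring.
      rewrite rpredB// rpredB//; first by rewrite dvdz_mulr// dvdz_mull.
      by rewrite expr2 !dvdz_mull.
    exact: H.
  have m1 : (g%:Z * A %% (2 ^ (c + 2))%N%:Z)%Z = (`|(g%:Z * A %% (2 ^ (c + 2))%N%:Z)%Z|%N)%:Z.
    by rewrite gez0_abs// modz_ge0// eqz_nat -lt0n expn_gt0.
  have mlt : (`|(g%:Z * A %% (2 ^ (c + 2))%N%:Z)%Z| < 2 ^ (c + 2))%N.
    by rewrite -ltz_nat -m1 ltz_pmod// ltz_nat expn_gt0.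
  apply/existsP; exists (Ordinal mlt) => /=; rewrite -m1.
  set M := (2 ^ (c + 2))%N%:Z in m1 mlt E4 *.
  have Mm : (M %| (g%:Z * A %% M)%Z - g%:Z * A)%Z by rewrite -eqz_mod_dvd modz_mod.
  apply/andP; split.
    have -> : (g%:Z * A %% M)%Z - 1 = ((g%:Z * A %% M)%Z - g%:Z * A) + g%:Z * (A - g%:Z) + (g%:Z ^+ 2 - 1) by ring.
    rewrite rpredD ?odd_sqr4// rpredD ?dvdz_mull//.
    by apply: dvdz_trans Mm; rewrite E4 dvdz_mull.
  have -> : (2 ^ b)%N%:Z * (g%:Z * A %% M)%Z - (l%:Z + (2 ^ c)%N%:Z)
    = (2 ^ b)%N%:Z * ((g%:Z * A %% M)%Z - g%:Z * A) + ((2 ^ b)%N%:Z * g%:Z * A - (l%:Z + (2 ^ c)%N%:Z * d%:Z ^+ 2))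
     + ((2 ^ c)%N%:Z * d%:Z ^+ 2 - (2 ^ c)%N%:Z) by ring.
  rewrite rpredD ?E4// rpredD//; first by rewrite -E4 dvdz_mull.
  by apply: dvdz_trans Ac; apply: dvdz_mulr.
set M := (2 ^ (c + 2))%N%:Z in mc E4 *.
have copM (k : nat) : odd k -> coprimez M k%:Z.
  by move=> ok; rewrite /coprimez /gcdz /= eqz_nat; apply: coprimeXl; rewrite coprime2n.
have [u Hu] := inverse_mod (copM g og).
have [v Hv] : exists v, (d%:Z %| (2 ^ b)%N%:Z * v - 1)%Z.
  by apply: inverse_mod; rewrite /coprimez /gcdz /= eqz_nat; apply: coprimeXr; rewrite coprimen2.
have [l' lE] := dvdnP gl.
pose A := zchinese M d%:Z (u * (m : nat)%:Z) (l'%:Z * v).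
have cMd := copM d od.
have A1 : (M %| A - u * (m : nat)%:Z)%Z by rewrite -eqz_mod_dvd; apply/eqP/zchinese_modl.
have A2 : (d%:Z %| A - l'%:Z * v)%Z by rewrite -eqz_mod_dvd; apply/eqP/zchinese_modr.
have M4 : (4 %| M)%Z by rewrite E4 dvdz_mull.
exists A; apply/andP; split.
  have c4 : coprimez 4 g%:Z by apply: coprimez_dvdl M4 (copM g og).
  rewrite -(@Gauss_dvdzr _ g%:Z)//.
  have -> : g%:Z * (A - g%:Z) = g%:Z * (A - u * (m : nat)%:Z) + (g%:Z * u - 1) * (m : nat)%:Z + ((m : nat)%:Z - 1) - (g%:Z ^+ 2 - 1) by ring.
  rewrite rpredB ?odd_sqr4// rpredD// rpredD//; first by rewrite dvdz_mull// (dvdz_trans M4).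
  by rewrite dvdz_mulr// (dvdz_trans M4).
rewrite -E4 Gauss_dvdz//; apply/andP; split.
  have -> : (2 ^ b)%N%:Z * g%:Z * A - (l%:Z + (2 ^ c)%N%:Z * d%:Z ^+ 2)
   = (2 ^ b)%N%:Z * g%:Z * (A - u * (m : nat)%:Z) + (2 ^ b)%N%:Z * (m : nat)%:Z * (g%:Z * u - 1)
     + ((2 ^ b)%N%:Z * (m : nat)%:Z - (l%:Z + (2 ^ c)%N%:Z)) - ((2 ^ c)%N%:Z * d%:Z ^+ 2 - (2 ^ c)%N%:Z) by ring.
  by rewrite rpredB ?E4// -?E4 rpredD// rpredD// dvdz_mull.
have -> : (2 ^ b)%N%:Z * g%:Z * A - (l%:Z + (2 ^ c)%N%:Z * d%:Z ^+ 2)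
   = (2 ^ b)%N%:Z * g%:Z * (A - l'%:Z * v) + l%:Z * ((2 ^ b)%N%:Z * v - 1) - (2 ^ c)%N%:Z * d%:Z * d%:Z.
  by rewrite lE PoszM; ring.
by rewrite rpredB ?dvdz_mull// rpredD// dvdz_mull.
Qed.

End Congruences.

(** * Counting integers in an arithmetic progression *)

Section Counting.
Variable R : realType.

Lemma divz_succ (z : int) (Q : nat) : (0 < Q)%N ->
  ((z + 1) %/ Q%:Z)%Z = (z %/ Q%:Z)%Z + ((Q%:Z %| z + 1)%Z : nat)%:Z.
Proof.
move=> Q0; have QZ : Q%:Z != 0 by rewrite eqz_nat -lt0n.
have r0 := modz_ge0 z QZ; have rQ : (z %% Q%:Z)%Z < Q%:Z by rewrite ltz_pmod// ltz_nat.
set r := (z %% Q%:Z)%Z in r0 rQ; set k := (z %/ Q%:Z)%Z.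
have zE : z + 1 = k * Q%:Z + (r + 1) by rewrite {1}(divz_eq z Q%:Z) -addrA.
rewrite zE divzMDl// rpredDl ?dvdz_mull//; congr (_ + _).
have [E|ne] := eqVneq (r + 1) Q%:Z; first by rewrite E dvdzz divzz QZ.
have lt : r + 1 < Q%:Z by rewrite lt_neqAle ne lezD1.
have r1 : 0 <= r + 1 by rewrite addr_ge0.
rewrite divz_small ?r1 ?gtr0_norm ?ltz_nat//.
case: (boolP (Q%:Z %| r + 1)%Z) => // /dvdzP[j Ej]; exfalso.
move: lt r0; rewrite -(lerD2r 1) Ej => H1 H2.
have : 0 < j by nia.
have : j < 1 by nia.
lia.
Qed.

Lemma floor_divz (m : int) (Q : nat) : (0 < Q)%N -> Num.floor (m%:~R / Q%:R : R) = (m %/ Q%:Z)%Z.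
Proof.
move=> Q0; have QZ : Q%:Z != 0 by rewrite eqz_nat -lt0n.
have QR : 0 < Q%:R :> R by rewrite ltr0n.
have r0 := modz_ge0 m QZ; have rQ : (m %% Q%:Z)%Z < Q%:Z by rewrite ltz_pmod// ltz_nat.
apply: floor_def; rewrite ler_pdivlMr// ltr_pdivrMr// [Q%:R]pmulrn -!rmorphM /= ler_int ltr_int.
rewrite {2 3}(divz_eq m Q%:Z) lerDl r0 /= mulrDl mul1r ltrD2l.
exact: rQ.
Qed.

Definition inprog (Q : nat) (a : int) (n : nat) : bool := (Q%:Z %| n%:Z - a)%Z.

Lemma count_progression (lo X Q : nat) (a : int) : (0 < Q)%N -> (lo <= X)%N ->
  (\sum_(1 <= n < X.+1) nat_of_bool ((lo < n)%N && inprog Q a n))%:R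
  = (X - lo)%:R / Q%:R - saw ((X%:Z - a)%:~R / Q%:R) + saw ((lo%:Z - a)%:~R / Q%:R) :> R.
Proof.
move=> Q0 loX; have QR : Q%:R != 0 :> R by rewrite pnatr_eq0 -lt0n.
have H k : (\sum_(1 <= n < (lo + k).+1) nat_of_bool ((lo < n)%N && inprog Q a n))%:Z
   = (((lo + k)%N%:Z - a) %/ Q%:Z)%Z - ((lo%:Z - a) %/ Q%:Z)%Z.
  elim: k => [|k IH].
    rewrite addn0 subrr big_nat big1// => n /andP[_]; rewrite ltnS => nlo.
    by rewrite ltnNge nlo.
  rewrite addnS big_nat_recr//= PoszD IH ltnS leq_addr /= /inprog.
  have -> : (lo + k).+1%:Z - a = ((lo + k)%N%:Z - a) + 1 by rewrite -addn1 PoszD; ring.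
  by rewrite divz_succ//; ring.
have := H (X - lo)%N; rewrite subnKC// => E.
rewrite [LHS]pmulrn E /saw !floor_divz// rmorphB /= natrB// !rmorphB /=.
rewrite -!pmulrn.
have -> : (X%:R - lo%:R) / Q%:R = (X%:R - a%:~R) / Q%:R - (lo%:R - a%:~R) / Q%:R :> R by field.
ring.
Qed.

End Counting.

(** * Sawtooth sums over a hyperbola *)

Ltac nonneg := repeat first [exact: sqrtr_ge0 | exact: ler0n | apply: addr_ge0 | apply: mulr_ge0
  | apply: exprn_ge0 | rewrite invr_ge0 | by [] | lra].

Section TwistedSawtooth.
Variable R : realType.
Notation C := (complex R).
Notation nm := (@nm R).
Notation e := (@e R).
Notation ch x := ((chi x)%:~R : R).
Variable q : nat.
Hypotheses (q0 : (0 < q)%N) (q4 : (4 %| q)%N).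
Notation Zq := 'Z_q.
Notation ez := (@ez R q).

Let q1 : (1 < q)%N. Proof. by apply: leq_trans (dvdn_leq q0 q4). Qed.
Let qR : 0 < q%:R :> R. Proof. by rewrite ltr0n. Qed.

Lemma chi_mod (n : nat) : chi (n %% q) = chi n.
Proof. by rewrite /chi modn_dvdm. Qed.

Definition wchi (x : Zq) : R := ch (x : nat).

Lemma wchi_nat (n : nat) : wchi n%:R = ch n.
Proof. by rewrite /wchi val_Zp_nat// chi_mod. Qed.

Lemma wchiM (x t : Zq) : wchi (x * t) = wchi x * wchi t.
Proof.
rewrite -[x]natr_Zp -[t]natr_Zp -natrM !wchi_nat chiM rmorphM //.
Qed.

Lemma wchi_unit (x : Zq) : x \is a GRing.unit -> `|wchi x| = 1.
Proof.
rewrite -[x]natr_Zp wchi_nat unitZpE// => cop.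
have od : odd (x : nat).
  rewrite -coprime2n; apply: coprime_dvdl cop.
  exact: dvdn_trans q4.
rewrite /chi; have : (x %% 4 < 4)%N by rewrite ltn_mod.
have : odd (x %% 4)%N by rewrite odd_mod.
by case: (x %% 4)%N => [|[|[|[|]]]]//= _ _; rewrite ?normrN1 ?normr1.
Qed.

Section Range.
Variables (a b A' : nat) (y : nat -> nat) (f : nat -> R).
Hypothesis ay : forall x, coprime q x -> (x%:R * (y x)%:R : Zq) = - A'%:R.
Variables (eta : R) (K : nat) (Bd : nat -> R).
Hypotheses (eta0 : 0 < eta) (etaK : eta <= 1 -> 1 <= eta ^+ 2 * K%:R).
Hypothesis Bd0 : forall k, 0 <= Bd k.
Hypothesis HB : forall k, (0 < k)%N -> forall w : Zq -> R,
  (forall x t : Zq, x \is a GRing.unit -> t \is a GRing.unit -> w (x * t) = w x * w t) ->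
  (forall x : Zq, x \is a GRing.unit -> `|w x| = 1) -> (forall x : Zq, `|w x| <= 1) ->
  nm (\sum_(a <= x < b | coprime q x) (w x%:R)%:C%C * ez ((k * A')%:R * (x%:R)^-1) * e (k%:R * f x / q%:R)) <= Bd k.

(** Modulo q the number y x is -A' / x, so it enters the phase as the additive character at k A' /
    x. This is the source of the Kloosterman sums. *)
Lemma phase_split (k x : nat) : coprime q x ->
  e (k%:R * ((f x - (y x)%:R) / q%:R)) = ez ((k * A')%:R * (x%:R)^-1) * e (k%:R * f x / q%:R).
Proof.
move=> cop; have ux : (x%:R : Zq) \is a GRing.unit by rewrite unitZpE.
have -> : k%:R * ((f x - (y x)%:R) / q%:R) = (- (k * y x)%N%:Z)%:~R / q%:R + k%:R * f x / q%:R.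
  by rewrite rmorphN /= -pmulrn natrM; ring.
rewrite eD e_intq//; congr (ez _ * _).
rewrite rmorphN /= -pmulrn !natrM.
have -> : (y x)%:R = (x%:R * (y x)%:R) * (x%:R)^-1 :> Zq by rewrite mulrAC divrr// mul1r.
by rewrite ay//; ring.
Qed.

(* [sawtooth_bound] needs nonnegative weights, so [chi] is written as the
   difference of [(1 + chi) / 2] and [(1 - chi) / 2]. *)
Lemma chi_saw :
  `|\sum_(a <= x < b | coprime q x) ch x * saw ((f x - (y x)%:R) / q%:R)|
  <= 10 * eta * (b - a)%:R + 2 * \sum_(1 <= k < K.+1) k%:R^-1 * Num.min 1 (k%:R * eta)^-1 * Bd k.
Proof.
have L0 : 0 <= (b - a)%:R :> R by apply: ler0n.
pose th x := (f x - (y x)%:R) / q%:R.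
pose mn k : R := Num.min 1 (k%:R * eta)^-1.
have mn0 k : 0 <= mn k by rewrite le_min ler01 invr_ge0 mulr_ge0 ?ler0n// ltW.
have S0 : 0 <= \sum_(1 <= k < K.+1) k%:R^-1 * mn k * Bd k.
  by apply: sumr_ge0 => k _; rewrite !mulr_ge0 ?invr_ge0 ?ler0n.
have [e1|e1] := leP eta 1; last first.
  apply: (@le_trans _ _ (10 * eta * (b - a)%:R)); last by rewrite lerDl mulr_ge0.
  apply: le_trans (ler_norm_sum _ _ _) _.
  apply: (@le_trans _ _ (\sum_(a <= x < b) 1)); last first.
    rewrite sumr_const_nat -[leLHS]mul1r ler_wpM2r//; lra.
  rewrite big_mkcond; apply: ler_sum => x _; case: ifP => // _.
  rewrite normrM -[leRHS]mulr1; apply: ler_pM => //; first exact: chi_le1.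
  have := floor_itv (th x); rewrite /saw -/(th x) rmorphD /= => /andP[u1 u2].
  by rewrite ler_norml; apply/andP; split; lra.
pose s := index_iota a b.
pose v (sg : R) x : R := if coprime q x then (1 + sg * ch x) / 2 else 0.
have sgch (sg : R) x : `|sg| = 1 -> 0 <= 1 + sg * ch x <= 2.
  move=> sg1; have : `|sg * ch x| <= 1 by rewrite normrM sg1 mul1r chi_le1.
  by rewrite ler_norml => /andP[h1 h2]; apply/andP; split; lra.
have side (sg : R) : `|sg| = 1 -> `|\sum_(x <- s) v sg x * saw (th x)| <= 5 * eta * (b - a)%:R
    + \sum_(1 <= k < K.+1) k%:R^-1 * mn k * Bd k.
  move=> sg1.
  have v0 x : 0 <= v sg x by rewrite /v; case: ifP => // _; rewrite divr_ge0//; have /andP[] := sgch sg x sg1.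
  have vN : \sum_(x <- s) v sg x <= (b - a)%:R.
    apply: (@le_trans _ _ (\sum_(a <= x < b) 1)); last by rewrite sumr_const_nat.
    apply: ler_sum => x _; rewrite /v; case: ifP => // _.
    by have /andP[_] := sgch sg x sg1; lra.
  have e01 : 0 < eta <= 1 by rewrite eta0.
  apply: le_trans (sawtooth_bound th v0 vN e01 (etaK e1)) _; rewrite lerD2l.
  apply: ler_sum_nat => k /andP[k0 _]; apply: ler_wpM2l; first by apply: mulr_ge0; [rewrite invr_ge0 | exact: mn0].
  pose T (w : Zq -> R) := \sum_(a <= x < b | coprime q x) (w x%:R)%:C%C * ez ((k * A')%:R * (x%:R)^-1) * e (k%:R * f x / q%:R).
  have -> : \sum_(x <- s) (v sg x)%:C%C * e (k%:R * th x) = (2^-1)%:C%C * (T (fun=> 1) + sg%:C%C * T wchi).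
    rewrite /T [sg%:C%C * _]mulr_sumr -big_split /= mulr_sumr [RHS]big_mkcond.
    apply: eq_bigr => x _; rewrite /v; case: ifP => cop; last by rewrite mul0r.
    rewrite /th phase_split// wchi_nat.
    have -> : (1 + sg * ch x) / 2 = 2^-1 * (1 + sg * ch x) by rewrite mulrC.
    by rewrite !rmorphM rmorphD rmorphM /= rmorph1; ring.
  rewrite nmM nm_real ger0_norm ?invr_ge0//.
  apply: (@le_trans _ _ (2^-1 * (Bd k + Bd k))); last by lra.
  apply: ler_wpM2l => //; apply: le_trans (nmD _ _) _; rewrite nmM nm_real sg1 mul1r.
  apply: lerD; apply: HB => //.
  - by move=> x t _ _; rewrite mulr1.
  - by move=> x _; rewrite normr1.
  - by move=> x; rewrite normr1.
  - by move=> x t _ _; exact: wchiM.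
  - exact: wchi_unit.
  by move=> x; exact: chi_le1.
have -> : \sum_(a <= x < b | coprime q x) ch x * saw ((f x - (y x)%:R) / q%:R)
   = \sum_(x <- s) v 1 x * saw (th x) - \sum_(x <- s) v (-1) x * saw (th x).
  rewrite -sumrB big_mkcond; apply: eq_bigr => x _; rewrite /v -/(th x); case: ifP => _; last by ring.
  by field.
apply: le_trans (ler_normB _ _) _.
have := side 1 (normr1 _); have := side (-1) (normrN1 _).
rewrite /mn; lra.
Qed.
End Range.

Variables (th : R) (K : nat) (eta : R).
Hypotheses (th_harm : harm R q <= th) (th_tau : (tau q)%:R <= th) (th_K : harm R K.+1 <= th).
Hypotheses (eta0 : 0 < eta) (etaK : eta <= 1 -> 1 <= eta ^+ 2 * K%:R).

Lemma th_ge1 : 1 <= th.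
Proof. by apply: le_trans th_tau; rewrite ler1n tau_gt0. Qed.

(** The kernel min(1, 1 / t) is weakened to t^(-1/2) here and to t^(-1/4) in [min_le_sqrt2]. With t
    = k eta these powers cancel the growth k^(1/2) and k^(1/4) of the two terms in [hyperbola_sum],
    and sums over 1 / k remain. *)
Lemma min_le_sqrt (t : R) : 0 < t -> Num.min 1 t^-1 <= (Num.sqrt t)^-1.
Proof.
move=> t0; have s0 : 0 < Num.sqrt t by rewrite sqrtr_gt0.
have E : t = Num.sqrt t ^+ 2 by rewrite sqr_sqrtr// ltW.
rewrite ge_min; have [s1|s1] := leP (Num.sqrt t) 1; apply/orP; [left|right].
  by rewrite -[leLHS]invr1 lef_pV2 ?posrE.
rewrite lef_pV2 ?posrE// {2}E expr2; apply: ler_peMl; exact: ltW.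
Qed.

Lemma min_le_sqrt2 (t : R) : 0 < t -> Num.min 1 t^-1 <= (Num.sqrt (Num.sqrt t))^-1.
Proof.
move=> t0; have s0 : 0 < Num.sqrt t by rewrite sqrtr_gt0.
apply: le_trans (min_le_sqrt s0).
rewrite le_min ge_min lexx /= ge_min; have [s1|s1] := leP (Num.sqrt t) 1.
  by rewrite -[leLHS]invr1 lef_pV2 ?posrE// s1.
apply/orP; right; have E : t = Num.sqrt t ^+ 2 by rewrite sqr_sqrtr// ltW.
rewrite lef_pV2 ?posrE// {2}E expr2; apply: ler_peMl; exact: ltW.
Qed.

Lemma sum_gcd_weighted (A' : nat) : \sum_(1 <= k < K.+1) k%:R^-1 * (gcdn (k * A') q)%:R <= th ^+ 2 * (gcdn A' q)%:R.
Proof.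
apply: (@le_trans _ _ ((gcdn A' q)%:R * \sum_(1 <= k < K.+1) (gcdn k q)%:R / k%:R)).
  rewrite mulr_sumr; apply: ler_sum => k _.
  rewrite mulrA -natrM [leRHS]mulrC; apply: ler_wpM2l; first by rewrite invr_ge0.
  by rewrite ler_nat; apply: leq_trans (gcdnM_le _ _ q0) _; rewrite mulnC.
rewrite mulrC; apply: ler_wpM2r; first exact: ler0n.
apply: le_trans (sum_gcd_div R K.+1 q0) _; rewrite expr2.
by apply: ler_pM; rewrite ?ler0n ?harm_ge0.
Qed.

Lemma sum_inv_weighted : \sum_(1 <= k < K.+1) k%:R^-1 <= th :> R.
Proof. by apply: le_trans th_K; apply: harm_le. Qed.

Definition common (A' : nat) : R := 2 * th ^+ 2 * (gcdn A' q)%:R * q34 R q.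

Theorem hyperbola_saw (W : R) (A' b : nat) (y : nat -> nat) : 0 < W ->
  ((1 < b)%N -> b.-1%:R ^+ 2 <= W) ->
  (forall x, coprime q x -> (x%:R * (y x)%:R : Zq) = - A'%:R) ->
  `|\sum_(1 <= x < b | coprime q x) ch x * saw ((W / x%:R - (y x)%:R) / q%:R)|
  <= 10 * eta * (b - 1)%:R + 4 * th * Num.sqrt (W / q%:R / eta)
     + 2 * th ^+ 2 * (42 + 20 * Num.sqrt (q%:R * Num.sqrt (W / eta)) / q%:R) * common A'.
Proof.
move=> W0 bW ay; have th1 := th_ge1; have e0 := eta0; have qR' := qR.
have q340 : 0 <= q34 R q := q34_ge0 R q.
pose Bd k := 2 * Num.sqrt (k%:R * W / q%:R)
     + (42 + 20 * Num.sqrt (q%:R * Num.sqrt (k%:R * W)) / q%:R)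
       * (2 * th ^+ 2 * (gcdn (k * A') q)%:R * q34 R q).
have Bd0 k : 0 <= Bd k.
  by rewrite /Bd; nonneg.
apply: le_trans (chi_saw ay eta0 etaK Bd0 _) _.
  move=> k k0 w wM w1 wle.
  rewrite (eq_bigr (fun x : nat => (w x%:R)%:C%C * ez ((k * A')%:R * (x%:R)^-1) * e (k%:R * W / x%:R / q%:R))); first exact: hyperbola_sum.
  by move=> x _; rewrite [k%:R * (W / _)]mulrA.
rewrite -addrA lerD2l.
pose c1 : R := Num.sqrt (W / q%:R / eta).
pose c2 : R := Num.sqrt (q%:R * Num.sqrt (W / eta)) / q%:R.
have c20 : 0 <= c2 by rewrite divr_ge0 ?sqrtr_ge0 ?ler0n.
pose D : R := 2 * th ^+ 2 * q34 R q.
have D0 : 0 <= D by rewrite !mulr_ge0 ?exprn_ge0//; lra.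
have term k : (0 < k)%N -> k%:R^-1 * Num.min 1 (k%:R * eta)^-1 * Bd k <= 2 * c1 * k%:R^-1
    + (42 + 20 * c2) * D * (k%:R^-1 * (gcdn (k * A') q)%:R).
  move=> k0; have kR : 0 < k%:R :> R by rewrite ltr0n.
  have ke : 0 < k%:R * eta by rewrite mulr_gt0.
  have ki : 0 <= k%:R^-1 :> R by rewrite invr_ge0 ltW.
  set M := Num.min _ _.
  have M0 : 0 <= M by rewrite le_min ler01 invr_ge0 ltW.
  have M1 : M <= 1 by rewrite ge_min lexx.
  have M2 : M * Num.sqrt (k%:R * W / q%:R) <= c1.
    apply: le_trans (ler_wpM2r (sqrtr_ge0 _) (min_le_sqrt ke)) _.
    rewrite -sqrtrV ?(ltW ke)// -sqrtrM ?invr_ge0 ?(ltW ke)// /c1.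
    by rewrite le_eqVlt; apply/orP; left; apply/eqP; congr Num.sqrt; field; rewrite !gt_eqF.
  have M3 : M * (Num.sqrt (q%:R * Num.sqrt (k%:R * W)) / q%:R) <= c2.
    rewrite /c2 mulrA ler_pM2r ?invr_gt0//.
    apply: le_trans (ler_wpM2r (sqrtr_ge0 _) (min_le_sqrt2 ke)) _.
    rewrite -sqrtrV ?sqrtr_ge0// -sqrtrM ?invr_ge0 ?sqrtr_ge0// ler_wsqrtr//.
    rewrite mulrCA ler_pM2l// -sqrtrV ?(ltW ke)// -sqrtrM ?invr_ge0 ?(ltW ke)//.
    by rewrite le_eqVlt; apply/orP; left; apply/eqP; congr Num.sqrt; field; rewrite !gt_eqF.
  set g : R := (gcdn (k * A') q)%:R; have g0 : 0 <= g by apply: ler0n.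
  have -> : k%:R^-1 * M * Bd k = k%:R^-1 * (2 * (M * Num.sqrt (k%:R * W / q%:R))
     + (42 * M + 20 * (M * (Num.sqrt (q%:R * Num.sqrt (k%:R * W)) / q%:R))) * (D * g)).
    by rewrite /Bd /D -/g; ring.
  have -> : 2 * c1 * k%:R^-1 + (42 + 20 * c2) * D * (k%:R^-1 * g) = k%:R^-1 * (2 * c1 + (42 + 20 * c2) * (D * g)) by ring.
  apply: ler_wpM2l => //; apply: lerD; first by rewrite ler_pM2l.
  by apply: ler_wpM2r; [rewrite mulr_ge0 | lra].
apply: (@le_trans _ _ (2 * \sum_(1 <= k < K.+1) (2 * c1 * k%:R^-1 + (42 + 20 * c2) * D * (k%:R^-1 * (gcdn (k * A') q)%:R)))).
  by apply: ler_wpM2l => //; apply: ler_sum_nat => k /andP[k0 _]; exact: term.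
rewrite big_split /= -!mulr_sumr.
have H1 := sum_inv_weighted; have H2 := sum_gcd_weighted A'.
have c10 : 0 <= 2 * c1 by rewrite mulr_ge0// sqrtr_ge0.
have cD : 0 <= (42 + 20 * c2) * D by rewrite mulr_ge0// addr_ge0// mulr_ge0.
have H3 := ler_wpM2l c10 H1; have H4 := ler_wpM2l cD H2.
apply: le_trans (_ : 2 * (2 * c1 * th + (42 + 20 * c2) * D * (th ^+ 2 * (gcdn A' q)%:R)) <= _); first lra.
rewrite /common -/c1 -/c2 le_eqVlt; apply/orP; left; apply/eqP; rewrite /D /c2; ring.
Qed.

Theorem linear_saw (A' s a b : nat) (y : nat -> nat) :
  (forall x, coprime q x -> (x%:R * (y x)%:R : Zq) = - A'%:R) ->
  `|\sum_(a <= x < b | coprime q x) ch x * saw (((s * x)%:R - (y x)%:R) / q%:R)|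
  <= 10 * eta * (b - a)%:R + 2 * th ^+ 2 * ((b - a)%:R / q%:R + 4) * common A'.
Proof.
move=> ay; have th1 := th_ge1; have e0 := eta0; have qR' := qR.
have q340 : 0 <= q34 R q := q34_ge0 R q.
pose c : R := (b - a)%:R / q%:R + 4.
have c0 : 0 <= c by rewrite addr_ge0// divr_ge0 ?ler0n.
pose Bd k := c * (2 * th ^+ 2 * (gcdn (k * A') q)%:R * q34 R q).
have Bd0 k : 0 <= Bd k by rewrite /Bd !mulr_ge0 ?exprn_ge0 ?ler0n//; lra.
apply: le_trans (chi_saw ay eta0 etaK Bd0 _) _.
  by move=> k k0 w wM w1 wle; exact: linear_sum.
rewrite lerD2l.
have -> : 2 * th ^+ 2 * c * common A' = 2 * (2 * th ^+ 2 * c * q34 R q * (th ^+ 2 * (gcdn A' q)%:R)).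
  by rewrite /common; ring.
apply: ler_wpM2l => //.
have D0 : 0 <= 2 * th ^+ 2 * c * q34 R q by rewrite !mulr_ge0 ?exprn_ge0//; lra.
apply: le_trans (ler_wpM2l D0 (sum_gcd_weighted A')); rewrite mulr_sumr.
apply: ler_sum_nat => k /andP[k0 _].
have M1 : Num.min 1 (k%:R * eta)^-1 <= 1 by rewrite ge_min lexx.
apply: (@le_trans _ _ (k%:R^-1 * 1 * Bd k)).
  by apply: ler_wpM2r => //; apply: ler_wpM2l; rewrite ?invr_ge0 ?ler0n.
by rewrite /Bd le_eqVlt; apply/orP; left; apply/eqP; ring.
Qed.
End TwistedSawtooth.

(** * The error for one divisor class *)

Lemma dvdz_sub (m a b : int) : (m %| a)%Z -> (m %| b)%Z -> (m %| a - b)%Z.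
Proof. by move=> ma mb; rewrite rpredB. Qed.

Section LocalError.
Variable R : realType.
Notation ch x := ((chi x)%:~R : R).
Variables (l X P b c d g d' : nat).
Hypotheses (l0 : (0 < l)%N) (X0 : (0 < X)%N) (dE : d = (g * d')%N) (od : odd d) (dX : (2 ^ c * d ^ 2 < X)%N).

Definition pairs (x : nat) : nat := \sum_(1 <= n < X.+1) nat_of_bool (rep c d n && rep b x (n + l)).
(** When 2^b x^2 <= l the truncated subtraction gives 0, as it should: every n > 0 then satisfies
    2^b x^2 < n + l. *)
Definition lowest (x : nat) : nat := maxn (2 ^ c * d ^ 2) (2 ^ b * x ^ 2 - l).

Let t := (2 + (c - b))%N.
Let q := (2 ^ t * d')%N.

Lemma sum_ltn (lo N : nat) : (\sum_(1 <= n < N.+1) nat_of_bool (lo < n) = N - lo)%N.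
Proof.
elim: N => [|N IH]; first by rewrite big_geq.
by rewrite big_nat_recr//= IH ltnS; case: (leqP lo N) => H; [rewrite addn1 subSn | rewrite addn0; move: H; clear; lia].
Qed.

Lemma lowest_lt (x n : nat) : (0 < n)%N ->
  (2 ^ c * d ^ 2 < n)%N && (2 ^ b * x ^ 2 < n + l)%N = (lowest x < n)%N.
Proof.
move=> n0; rewrite /lowest gtn_max; congr (_ && _).
by apply/idP/idP; move: (2 ^ b * x ^ 2)%N n0; clear; lia.
Qed.

Lemma box_count (x : nat) : \sum_(1 <= n < X.+1) box R c d n * box R b x (n + l) = (X - lowest x)%:R.
Proof.
rewrite -sum_ltn natr_sum; apply: eq_big_nat => n /andP[n0 _].
by rewrite /box -natrM -lowest_lt// mulnb.
Qed.

Lemma d'_odd : odd d'. Proof. by have := od; rewrite dE oddM => /andP[]. Qed.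
Lemma g_odd : odd g. Proof. by have := od; rewrite dE oddM => /andP[]. Qed.
Lemma modulus_gt0 : (0 < q)%N.
Proof. by rewrite /q muln_gt0 expn_gt0 /=; have := d'_odd; case: d'. Qed.
Lemma modulus_dvd4 : (4 %| q)%N.
Proof. by rewrite /q /t expnD -mulnA dvdn_mulr. Qed.

Lemma coprime_modulus (x : nat) : coprime q x = odd x && coprime x d'.
Proof. by rewrite /q coprimeMl coprime_pexpl// coprime2n [coprime d' _]coprime_sym. Qed.

Section Solvable.
Variable A : int.
Hypothesis cA : compat l b c d g A.

(** By [solve_congruences] the n counted form one progression modulo 2^b g x q above [lowest].
    Division by 2^b g x turns each end point m into (m + l) / (2^b g x), to be compared with y0
    modulo q. *)
Lemma pairs_eval (x y0 : nat) : coprime q x -> (q%:Z %| x%:Z * y0%:Z - A)%Z ->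
  (pairs (g * x))%:R - (X - lowest (g * x))%:R / (2 ^ b * (g * x) * q)%:R
  = (lowest (g * x) < X)%N%:R * (saw (((lowest (g * x) + l)%:R / (2 ^ b * g)%:R / x%:R - y0%:R) / q%:R)
     - saw (((X + l)%:R / (2 ^ b * g)%:R / x%:R - y0%:R) / q%:R)) :> R.
Proof.
move=> cop Hy; have q0 := modulus_gt0.
have /andP[ox _] : odd x && coprime x d' by rewrite -coprime_modulus.
have x0 : (0 < x)%N by case: (x) ox.
have og := g_odd; have g0 : (0 < g)%N by case: (g) og.
have xx : odd (g * x) by rewrite oddM og.
have b0 : (0 < 2 ^ b)%N by rewrite expn_gt0.
pose Q := (2 ^ b * (g * x) * q)%N.
have Q0 : (0 < Q)%N by rewrite /Q muln_gt0 q0 andbT !muln_gt0 b0 g0 x0.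
pose a : int := (2 ^ b * (g * x) * y0)%N%:Z - l%:Z.
have pE : pairs (g * x) = \sum_(1 <= n < X.+1) nat_of_bool ((lowest (g * x) < n)%N && inprog Q a n).
  apply: eq_big_nat => n /andP[n0 _]; rewrite !repE od xx /= -lowest_lt// /inprog.
  move/andP: cA => [A4 Ac].
  have key z : (4 %| z)%Z -> ((2 ^ c)%N%:Z * 4 * d'%:Z %| (2 ^ b)%N%:Z * z)%Z = (q%:Z %| z)%Z.
    by move=> z4; rewrite pow2_cancel// d'_odd.
  have Ac' : ((2 ^ c)%N%:Z * 4 * (g%:Z * d'%:Z) %| (2 ^ b)%N%:Z * g%:Z * A - (l%:Z + (2 ^ c)%N%:Z * (g%:Z * d'%:Z) ^+ 2))%Z.
    by rewrite -[g%:Z * d'%:Z]PoszM -dE.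
  have := @solve_congruences (2 ^ b)%N%:Z (2 ^ c)%N%:Z d'%:Z g%:Z x%:Z q%:Z A y0%:Z l%:Z n%:Z _ _ _ key _ _ _ A4 Ac' Hy.
  rewrite !eqz_nat -!lt0n g0 b0 x0 => /(_ isT isT isT modulus_dvd4).
  have cz : coprimez q%:Z x%:Z by rewrite /coprimez /gcdz /= eqz_nat.
  move=> /(_ cz (odd_sqr4 ox)).
  rewrite -[g%:Z * x%:Z]PoszM -[g%:Z * d'%:Z]PoszM -dE => E.
  have -> : n%:Z - a = n%:Z + l%:Z - (2 ^ b)%N%:Z * (g * x)%N%:Z * y0%:Z by rewrite /a !PoszM; ring.
  have -> : Q%:Z = (2 ^ b)%N%:Z * (g * x)%N%:Z * q%:Z by rewrite -!PoszM.
  rewrite -E PoszD.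
  by case: (_ < n)%N => //=; case: (_ < n + l)%N => //=; rewrite ?andbF// andbC.
have [lt|ge] := ltnP (lowest (g * x)) X; last first.
  rewrite mul0r (eqP ge) mul0r subr0 pE big_nat big1// => n /andP[_ nX].
  by rewrite ltnNge (leq_trans _ ge).
rewrite mul1r pE count_progression//; last exact: ltnW.
have nz (n : nat) : (0 < n)%N -> n%:R != 0 :> R by move=> n0; rewrite pnatr_eq0 -lt0n.
have QE : Q%:R = (2 ^ b)%:R * (g%:R * x%:R) * q%:R :> R by rewrite /Q natrM natrM [(g * x)%N%:R]natrM.
have conv (m : nat) : (m%:Z - a)%:~R / Q%:R = ((m + l)%:R / (2 ^ b * g)%:R / x%:R - y0%:R) / q%:R :> R.
  rewrite /a opprB addrA rmorphB rmorphD /= -!pmulrn natrD QE [(2 ^ b * g)%N%:R]natrM.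
  rewrite [(2 ^ b * (g * x) * y0)%N%:R]natrM [(2 ^ b * (g * x))%N%:R]natrM [(g * x)%N%:R]natrM.
  move: (nz q q0) (nz g g0) (nz x x0) (nz (2 ^ b)%N b0).
  move: (q%:R : R) (g%:R : R) (x%:R : R) ((2 ^ b)%:R : R) => qr gr xr br q_ g_ x_ b_.
  by field; rewrite q_ g_ x_ b_.
by rewrite -/Q !conv; ring.
Qed.

(** A is odd, being congruent to the odd g modulo 4, so gcd(A', q) is odd and divides d'. Its
    product with g then divides d and, by the congruence for A, also l. The gcd lost in the
    Kloosterman estimates is thus harmless on average over d. *)
Lemma residue_gcd (A' : nat) : (q%:Z %| A'%:Z + A)%Z -> (gcdn A' q <= gcdn d l)%N.
Proof.
move=> HA; set h := gcdn A' q; have q0 := modulus_gt0.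
have h0 : (0 < h)%N by rewrite gcdn_gt0 q0 orbT.
have og := g_odd; have g0 : (0 < g)%N by case: (g) og.
move/andP: cA => [A4 Ac].
have hA : (h%:Z %| A)%Z.
  have u1 : (h%:Z %| A'%:Z)%Z by exact: dvdn_gcdl.
  have u2 : (h%:Z %| q%:Z)%Z by exact: dvdn_gcdr.
  have -> : A = (A'%:Z + A) - A'%:Z by ring.
  by rewrite rpredB// (dvdz_trans u2).
have oA : odd `|A|%N.
  have [k Hk] := dvdzP A4.
  have -> : A = g%:Z + 4 * k by have := Hk => /(canRL (subrK _)) ->; ring.
  have /dvdzP[j Hj] : (2 %| g%:Z + 4 * k - 1)%Z.
    rewrite -addrAC rpredD//; last by rewrite dvdz_mulr.
    have -> : g%:Z - 1 = 2 * (g./2)%:Z.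
      by rewrite -{1}(odd_double_half g) og /= -muln2 PoszD PoszM; ring.
    exact: dvdz_mulr.
  have -> : g%:Z + 4 * k = 1 + 2 * j by have := Hj => /(canRL (subrK _)) ->; ring.
  by move: (j); clear; lia.
have oh : odd h.
  have : (h %| `|A|)%N by [].
  by case/dvdnP => k Hk; move: oA; rewrite Hk oddM => /andP[].
have hd' : (h %| d')%N.
  have : (h %| q)%N by apply: dvdn_gcdr.
  by rewrite /q Gauss_dvdr// coprimeXr// coprimen2.
have ghd : (g * h %| d)%N by rewrite dE dvdn_mul.
have ghl : (g * h %| l)%N.
  have H : ((g * h)%N%:Z %| l%:Z)%Z.
    have -> : l%:Z = (2 ^ b)%N%:Z * (g%:Z * A) - (2 ^ c)%N%:Z * d%:Z * d%:Z
      - ((2 ^ b)%N%:Z * g%:Z * A - (l%:Z + (2 ^ c)%N%:Z * d%:Z ^+ 2)) by ring.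
    apply: dvdz_sub; last by apply: dvdz_trans Ac; apply: dvdz_mull.
    apply: dvdz_sub; last by apply: dvdz_mull.
    by rewrite PoszM; apply: dvdz_mull; apply: dvdz_mul.
  exact: H.
have : (g * h %| gcdn d l)%N by rewrite dvdn_gcd ghd.
move/(dvdn_leq _) => H; apply: leq_trans (H _); first by rewrite leq_pmull.
by rewrite gcdn_gt0 l0 orbT.
Qed.

Variables (th : R) (K : nat) (eta : R).
Hypotheses (th_harm : harm R q <= th) (th_tau : (tau q)%:R <= th) (th_K : harm R K.+1 <= th).
Hypotheses (eta0 : 0 < eta) (etaK : eta <= 1 -> 1 <= eta ^+ 2 * K%:R).

(** The upper limit X gives sawtooths along a hyperbola. So does the lower limit 2^c d^2, valid for
    small x. For larger x the lower limit is 2^b (g x)^2 - l, where (n + l) / (2^b g x) is just g x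
    and the phase is linear; [L] is the length of this range. *)
Theorem local_error (N : nat) : exists L : nat,
  (g * L)%:R <= Num.sqrt X%:R + g%:R :> R /\
  `|\sum_(1 <= x < N | coprime q x) ch x * ((pairs (g * x))%:R - (X - lowest (g * x))%:R / (2 ^ b * (g * x) * q)%:R)|
  <= 10 * eta * (2 * Num.sqrt (X + l)%:R + L%:R)
   + 8 * th * Num.sqrt ((X + l)%:R / (2 ^ b * g)%:R / q%:R / eta)
   + 2 * th ^+ 2 * (84 + 40 * Num.sqrt (q%:R * Num.sqrt ((X + l)%:R / (2 ^ b * g)%:R / eta)) / q%:R + L%:R / q%:R + 4)
       * (2 * th ^+ 2 * (gcdn d l)%:R * q34 R q).
Proof.
have q0 := modulus_gt0; have q4 := modulus_dvd4.
have q1 : (1 < q)%N by apply: leq_trans (dvdn_leq q0 q4).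
have og := g_odd; have g0 : (0 < g)%N by case: (g) og.
have b0 : (0 < 2 ^ b)%N by rewrite expn_gt0.
have th1 : 1 <= th by apply: le_trans th_tau; rewrite ler1n tau_gt0.
have e0 := eta0.
(* The representative of -A in [0, q), as the exponential sums are stated for natural residues. *)
pose A' : nat := (- A%:~R : 'Z_q).
have HA' : (q%:Z %| A'%:Z + A)%Z.
  have : (A'%:Z + A)%:~R = 0 :> 'Z_q by rewrite rmorphD /= -pmulrn natr_Zp addNr.
  have [z E] : exists z : nat, (A'%:Z + A = z%:Z) \/ (A'%:Z + A = - z%:Z).
    by exists (absz (A'%:Z + A)); case: (leP 0 (A'%:Z + A)) => H; [left; rewrite gez0_abs | right; rewrite ltz0_abs// opprK].
  have zq : z%:R = 0 :> 'Z_q -> (q %| z)%N.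
    by move=> /(congr1 (fun u : 'Z_q => u : nat)); rewrite val_Zp_nat// => /eqP.
  case: E => ->; first by rewrite -pmulrn; exact: zq.
  by rewrite rmorphN /= -pmulrn => /eqP; rewrite oppr_eq0 => /eqP /zq H; rewrite dvdzE abszN.
have Gle := residue_gcd HA'.
pose y (x : nat) : nat := (A%:~R * (x%:R)^-1 : 'Z_q).
have ay x : coprime q x -> (x%:R * (y x)%:R : 'Z_q) = - A'%:R.
  move=> cop; rewrite /y /A' !natr_Zp opprK mulrCA divrr ?mulr1// unitZpE//.
have Hy x : coprime q x -> (q%:Z %| x%:Z * (y x)%:Z - A)%Z.
  move=> cop.
  have -> : x%:Z * (y x)%:Z - A = ((x * y x + A')%N%:Z) - (A'%:Z + A) by rewrite PoszD PoszM; ring.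
  rewrite rpredB//; have : (x * y x + A')%:R = 0 :> 'Z_q by rewrite natrD natrM ay// addNr.
  by move=> /(congr1 (fun u : 'Z_q => u : nat)); rewrite val_Zp_nat// => /eqP.
have kg0 : (0 < 2 ^ b * g ^ 2)%N by rewrite muln_gt0 b0 expn_gt0 g0.
have Xl0 : (0 < X + l)%N by rewrite addn_gt0 X0.
(* From [a1] on, no n <= X exceeds the lower limit; up to [a2] the lower limit is 2^c d^2. *)
have [a1 a10 [a1E _]] := square_cutoff kg0 Xl0.
have [a2 a20 [a2E a2N]] := square_cutoff kg0 (ltn0Sn (l + 2 ^ c * d ^ 2)).
have gx x : (2 ^ b * (g * x) ^ 2 = 2 ^ b * g ^ 2 * x ^ 2)%N by rewrite expnMn mulnA.
have lX : (l + 2 ^ c * d ^ 2 < X + l)%N by rewrite addnC ltn_add2r.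
have a12 : (a2 <= a1)%N.
  rewrite leqNgt; apply/negP => H.
  have H1 : (2 ^ b * g ^ 2 * a1 ^ 2 < (l + 2 ^ c * d ^ 2).+1)%N by rewrite a2E.
  have H2 : (2 ^ b * g ^ 2 * a1 ^ 2 < X + l)%N by apply: leq_trans lX.
  by move: H2; rewrite a1E ltnn.
have bgR : 0 < (2 ^ b * g)%:R :> R by rewrite ltr0n muln_gt0 b0.
have qR : 0 < q%:R :> R by rewrite ltr0n.
pose Cm : R := 2 * th ^+ 2 * (gcdn d l)%:R * q34 R q.
have q340 : 0 <= q34 R q := q34_ge0 R q.
have Ccom : common q th A' <= Cm.
  rewrite /common /Cm; apply: ler_wpM2r => //; apply: ler_wpM2l; last by rewrite ler_nat.
  by rewrite mulr_ge0// exprn_ge0//; lra.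
have Cm0 : 0 <= Cm by rewrite /Cm; nonneg.
have com0 : 0 <= common q th A' by rewrite /common; nonneg.
pose w : R := (X + l)%:R / (2 ^ b * g)%:R.
pose c1 : R := Num.sqrt (w / q%:R / eta).
pose c2 : R := Num.sqrt (q%:R * Num.sqrt (w / eta)) / q%:R.
have c20 : 0 <= c2 by rewrite divr_ge0 ?sqrtr_ge0.
pose U (n x : nat) := saw ((n%:R / (2 ^ b * g)%:R / x%:R - (y x)%:R) / q%:R : R).
have ei0 : 0 <= eta^-1 by rewrite invr_ge0 ltW.
have HY (n m : nat) : (0 < n <= X + l)%N -> (forall x, (x < m)%N -> (2 ^ b * g ^ 2 * x ^ 2 <= n)%N) ->
   `|\sum_(1 <= x < minn N m | coprime q x) ch x * U n x|
   <= 10 * eta * Num.sqrt (X + l)%:R + 4 * th * c1 + 2 * th ^+ 2 * (42 + 20 * c2) * Cm.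
  move=> /andP[n0 nX] Hm.
  pose W : R := n%:R / (2 ^ b * g)%:R.
  have W0 : 0 < W by rewrite divr_gt0// ltr0n.
  have Ww : W <= w by rewrite ler_pM2r ?invr_gt0// ler_nat.
  have WX : W <= (X + l)%:R.
    apply: le_trans Ww _; rewrite ler_pdivrMr// ler_peMr// ler1n muln_gt0 b0 g0//.
  have bW : (1 < minn N m)%N -> (minn N m).-1%:R ^+ 2 <= W.
    move=> m1; rewrite ler_pdivlMr// -natrX -natrM ler_nat.
    have xm : ((minn N m).-1 < m)%N by apply: leq_trans (geq_minr N m); rewrite prednK// ltnW.
    apply: leq_trans (Hm _ xm); rewrite mulnC leq_mul2r; apply/orP; right.
    by rewrite leq_mul2l -mulnn leq_pmulr ?orbT.
  have b1 : (minn N m - 1)%:R <= Num.sqrt (X + l)%:R :> R.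
    have [le|lt] := leqP (minn N m) 1; first by rewrite (eqP le) sqrtr_ge0.
    rewrite -[leLHS]ger0_norm// -sqrtr_sqr ler_wsqrtr// subn1; exact: le_trans (bW lt) WX.
  apply: le_trans (hyperbola_saw q0 q4 th_harm th_tau th_K eta0 etaK W0 bW ay) _.
  have m1 : Num.sqrt (W / q%:R / eta) <= c1.
    by apply: ler_wsqrtr; do 2 (apply: ler_wpM2r; first by rewrite ?invr_ge0 ltW).
  have m2 : Num.sqrt (q%:R * Num.sqrt (W / eta)) / q%:R <= c2.
    apply: ler_wpM2r; first by rewrite invr_ge0 ltW.
    by apply: ler_wsqrtr; apply: ler_wpM2l; [rewrite ltW | apply: ler_wsqrtr; apply: ler_wpM2r].
  apply: lerD; first (apply: lerD).
  - by apply: ler_wpM2l => //; rewrite mulr_ge0// ltW.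
  - by apply: ler_wpM2l => //; lra.
  have t2 : 0 <= 2 * th ^+ 2 by rewrite mulr_ge0// exprn_ge0//; lra.
  apply: ler_pM => //; first by rewrite mulr_ge0// addr_ge0// mulr_ge0// divr_ge0 ?sqrtr_ge0// ltW.
  by apply: ler_wpM2l => //; lra.
pose V (x : nat) := saw (((g * x)%:R - (y x)%:R) / q%:R : R).
have HL : `|\sum_(a2 <= x < minn N a1 | coprime q x) ch x * V x|
   <= 10 * eta * (minn N a1 - a2)%:R + 2 * th ^+ 2 * ((minn N a1 - a2)%:R / q%:R + 4) * Cm.
  apply: le_trans (linear_saw q0 q4 th_harm th_tau th_K eta0 etaK g a2 (minn N a1) ay) _.
  rewrite lerD2l; apply: ler_wpM2l => //.
  by rewrite mulr_ge0 ?addr_ge0 ?divr_ge0 ?mulr_ge0 ?exprn_ge0//; lra.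
exists (minn N a1 - a2)%N; split.
  rewrite mulnBr; have [le|lt] := leqP (minn N a1) a2.
    by rewrite (eqP (leq_mul (leqnn g) le)) addr_ge0 ?sqrtr_ge0.
  set m := (minn N a1).-1.
  have mE : minn N a1 = m.+1 by rewrite /m prednK// (leq_ltn_trans _ lt).
  have ma2 : (a2 <= m)%N by rewrite -ltnS -mE.
  have ma1 : (m < a1)%N by rewrite -mE geq_minr.
  have H1 : (2 ^ b * g ^ 2 * m ^ 2 < X + l)%N by rewrite a1E.
  (* From 2^b g^2 m^2 < X + l and 2^b g^2 a2^2 > l, together with (m - a2)^2 <= m^2 - a2^2. *)
  have H3 : ((g * (m - a2)) ^ 2 <= X)%N.
    have K1 : (2 ^ b * g ^ 2 * a2 ^ 2 + 2 ^ b * g ^ 2 * (m - a2) ^ 2 <= 2 ^ b * g ^ 2 * m ^ 2)%N.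
      rewrite -mulnDr leq_mul2l; apply/orP; right.
      by rewrite -{2}(subnKC ma2) sqrnD leq_addr.
    have K2 : ((g * (m - a2)) ^ 2 <= 2 ^ b * g ^ 2 * (m - a2) ^ 2)%N by rewrite -gx leq_pmull.
    apply: leq_trans K2 _; rewrite -(leq_add2r (2 ^ b * g ^ 2 * a2 ^ 2)) addnC.
    apply: leq_trans K1 _; apply: leq_trans (ltnW H1) _; rewrite leq_add2l.
    by apply: leq_trans (ltnW a2N); rewrite leq_addr.
  rewrite -mulnBr mE subSn// mulnS natrD addrC lerD2r.
  by rewrite -[leLHS]ger0_norm// -sqrtr_sqr ler_wsqrtr// -natrX ler_nat.
have -> : \sum_(1 <= x < N | coprime q x) ch x * ((pairs (g * x))%:R - (X - lowest (g * x))%:R / (2 ^ b * (g * x) * q)%:R)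
  = \sum_(1 <= x < minn N a2 | coprime q x) ch x * U (l + 2 ^ c * d ^ 2)%N x
  + \sum_(a2 <= x < minn N a1 | coprime q x) ch x * V x
  - \sum_(1 <= x < minn N a1 | coprime q x) ch x * U (X + l)%N x.
  have Wn (u v : nat) (G : nat -> R) : (0 < u)%N -> \sum_(u <= x < minn N v | coprime q x) G x
     = \sum_(1 <= x < N) (if coprime q x then G x else 0) *+ ((u <= x)%N && (x < v)%N).
    by move=> u0; rewrite sum_window// -big_mkcond.
  rewrite !Wn// -big_split -sumrB /= big_mkcond.
  apply: eq_big_nat => x /andP[x0 _]; case: ifP => cop; last by rewrite !mul0rn addr0 subr0.
  rewrite (pairs_eval cop (Hy x cop)) x0 /=.
  have -> : (lowest (g * x) < X)%N = (x < a1)%N by rewrite -lowest_lt// dX gx a1E.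
  have [xa1|xa1] := ltnP x a1; last first.
    by rewrite [(x < a2)%N]ltnNge (leq_trans a12 xa1) /= !mulr0n mul0r mulr0 addr0 subr0.
  rewrite mul1r mulr1n; have [xa2|xa2] := ltnP x a2.
    have lowE : lowest (g * x) = (2 ^ c * d ^ 2)%N.
      by apply/maxn_idPl; rewrite leq_subLR gx -ltnS a2E.
    by rewrite lowE mulr1n mulr0n addr0 mulrBr /U addnC.
  have lowE : (lowest (g * x) + l = 2 ^ b * (g * x) ^ 2)%N.
    have H : (l + 2 ^ c * d ^ 2 < 2 ^ b * (g * x) ^ 2)%N by rewrite gx ltnNge -ltnS a2E -leqNgt.
    rewrite /lowest; have -> : maxn (2 ^ c * d ^ 2) (2 ^ b * (g * x) ^ 2 - l) = (2 ^ b * (g * x) ^ 2 - l)%N.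
      by apply/maxn_idPr; rewrite leq_subRL ?(ltnW H)// (leq_trans _ (ltnW H))// leq_addr.
    by rewrite subnK// (leq_trans _ (ltnW H))// leq_addr.
  rewrite mulr0n add0r mulr1n mulrBr /U /V; congr (_ * saw ((_ - _) / _) - _).
  rewrite lowE -mulnn !natrM; field.
  by rewrite !pnatr_eq0 -!lt0n x0 g0 b0.
have h1 : (0 < X + l <= X + l)%N by rewrite Xl0 leqnn.
have h2 : (0 < l + 2 ^ c * d ^ 2 <= X + l)%N by rewrite addn_gt0 l0 /=; exact: ltnW.
have HY1 := HY (X + l)%N a1 h1 (fun x xa => ltnW (etrans (a1E x) xa)).
have HY2 := HY (l + 2 ^ c * d ^ 2)%N a2 h2 (fun x xa => etrans (a2E x) xa).
apply: le_trans (ler_normB _ _) _; apply: le_trans (lerD (ler_normD _ _) (lexx _)) _.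
rewrite -/Cm -/w -/c1 -/c2; set Lr : R := (minn N a1 - a2)%:R in HL *.
have E3 : 2 * th ^+ 2 * (84 + 40 * Num.sqrt (q%:R * Num.sqrt (w / eta)) / q%:R + Lr / q%:R + 4) * Cm
  = 2 * (2 * th ^+ 2 * (42 + 20 * c2) * Cm) + 2 * th ^+ 2 * (Lr / q%:R + 4) * Cm by rewrite /c2; ring.
rewrite E3; lra.
Qed.
End Solvable.
End LocalError.

(** * Summing the errors *)

Section Monomials.
Variable R : realType.
Variables (X x s H d : R).
Hypotheses (x1 : 1 <= x) (xX : x ^+ 2 = X) (H0 : 0 < H) (d1 : 1 <= d) (dx : d <= x).
Hypotheses (F1 : s ^+ 3 * X <= H ^+ 3) (F2 : X ^+ 7 <= H ^+ 8) (F3 : s ^+ 3 * X ^+ 3 <= H ^+ 5).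
Hypothesis s0 : 0 < s.

Let X0 : 0 <= X. Proof. by rewrite -xX exprn_ge0// (le_trans ler01). Qed.
Let Hge0 : 0 <= H. Proof. exact: ltW. Qed.
Let x0 : 0 <= x. Proof. exact: le_trans ler01 x1. Qed.
Let d0 : 0 <= d. Proof. exact: le_trans ler01 d1. Qed.

Lemma fourth_power_le (u v : R) : 0 <= u -> 0 <= v -> u ^+ 4 <= v ^+ 4 -> u <= v.
Proof. by move=> u0 v0; rewrite ler_pXn2r. Qed.

Lemma X3x_le : X ^+ 3 * x <= H ^+ 4.
Proof.
rewrite -(@ler_pXn2r _ 2)// ?nnegrE ?exprn_ge0 ?mulr_ge0 ?exprn_ge0//.
have -> : (X ^+ 3 * x) ^+ 2 = X ^+ 7 by rewrite exprMn xX; ring.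
by rewrite -exprM.
Qed.

Lemma x_le_H : x <= H.
Proof.
rewrite -(@ler_pXn2r _ 8)// ?nnegrE//; apply: le_trans F2.
rewrite -xX -exprM; apply: ler_weXn2l => //.
Qed.

(** [z] is q^(3/4) and [C] is 2^c. On fourth powers, q^3 d^4 <= 64 (C d^2)^3 d; then C d^2 <= X and
    d <= x reduce the claim to X^3 x <= H^4, which is the square root of [F2]. *)
Lemma quarter_bound (z q C : R) : 0 <= z -> z ^+ 4 = q ^+ 3 -> 0 <= q -> q <= 4 * C * d -> 0 <= C -> C * d ^+ 2 <= X ->
  z * d <= 3 * H.
Proof.
move=> z0 zq q0 qC C0 CX.
apply: fourth_power_le; rewrite ?mulr_ge0// !exprMn zq.
have h1 : q ^+ 3 <= (4 * C * d) ^+ 3 by apply: lerXn2r; rewrite ?nnegrE ?mulr_ge0.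
have h2 : (C * d ^+ 2) ^+ 3 <= X ^+ 3 by apply: lerXn2r; rewrite ?nnegrE ?mulr_ge0 ?exprn_ge0.
apply: le_trans (ler_wpM2r (exprn_ge0 4 d0) h1) _.
have -> : (4 * C * d) ^+ 3 * d ^+ 4 = 64 * ((C * d ^+ 2) ^+ 3 * d) by ring.
have h3 : (C * d ^+ 2) ^+ 3 * d <= X ^+ 3 * x by apply: ler_pM; rewrite ?exprn_ge0 ?mulr_ge0 ?exprn_ge0.
have h4 := le_trans h3 X3x_le; have := exprn_ge0 4 Hge0.
have -> : 3 ^+ 4 * H ^+ 4 = 81 * H ^+ 4 by ring.
lra.
Qed.

(** [y] is (q^2 W)^(1/4), the size of the stationary phase term. The fourth power of the left side
    is q W d^4, where C d^2 <= X absorbs the power of 2, and [F3] concludes. *)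
Lemma stationary_bound (z y q C W : R) : 0 <= z -> z ^+ 4 = q ^+ 3 -> 0 < q -> 0 <= C -> C * d ^+ 2 <= X ->
  0 <= y -> y ^+ 4 = q ^+ 2 * W -> 0 <= W -> q * W <= 4 * C * d * (s ^+ 3 * d / H) ->
  z * (y / q) * d <= 2 * H.
Proof.
move=> z0 zq q0 C0 CX y0 yW W0 qW.
have q00 := ltW q0.
apply: fourth_power_le; rewrite ?mulr_ge0 ?invr_ge0//.
have -> : (z * (y / q) * d) ^+ 4 = z ^+ 4 * y ^+ 4 / q ^+ 4 * d ^+ 4 by field; rewrite gt_eqF.
rewrite zq yW.
have -> : q ^+ 3 * (q ^+ 2 * W) / q ^+ 4 * d ^+ 4 = q * W * d ^+ 4 by field; rewrite gt_eqF.
apply: le_trans (ler_wpM2r (exprn_ge0 4 d0) qW) _.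
have -> : 4 * C * d * (s ^+ 3 * d / H) * d ^+ 4 = 4 * ((C * d ^+ 2) * (d ^+ 2 * d ^+ 2) * s ^+ 3) / H by field; rewrite gt_eqF.
rewrite ler_pdivrMr//.
have dX : d ^+ 2 <= X by rewrite -xX; apply: lerXn2r; rewrite ?nnegrE.
have h1 : d ^+ 2 * d ^+ 2 <= X * X by apply: ler_pM; rewrite ?exprn_ge0.
have h2 : (C * d ^+ 2) * (d ^+ 2 * d ^+ 2) <= X * (X * X) by apply: ler_pM; rewrite ?mulr_ge0 ?exprn_ge0.
have h3 : (C * d ^+ 2) * (d ^+ 2 * d ^+ 2) * s ^+ 3 <= X * (X * X) * s ^+ 3 by apply: ler_wpM2r => //; rewrite exprn_ge0// ltW.
have -> : (2 * H) ^+ 4 * H = 16 * H ^+ 5 by ring.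
have h4 : X * (X * X) * s ^+ 3 = s ^+ 3 * X ^+ 3 by ring.
have := exprn_ge0 5 Hge0; have F3' := F3; rewrite h4 in h3; lra.
Qed.

Lemma linear_bound (z q L g d' : R) : 0 <= z -> z ^+ 4 = q ^+ 3 -> 1 <= g -> 0 <= L -> g * L <= 2 * x ->
  d = g * d' -> 4 * d' <= q -> 0 < d' -> z * (L / q) * d <= 2 * H.
Proof.
move=> z0 zq g1 L0 gL dE dq d'0.
have q0 : 0 < q by lra.
have g0 : 0 < g by lra.
apply: fourth_power_le; rewrite ?mulr_ge0 ?invr_ge0 ?(ltW q0)//.
have -> : (z * (L / q) * d) ^+ 4 = z ^+ 4 * L ^+ 4 / q ^+ 4 * d ^+ 4 by field; rewrite gt_eqF.
rewrite zq.
have -> : q ^+ 3 * L ^+ 4 / q ^+ 4 * d ^+ 4 = L ^+ 4 * d ^+ 4 / q by field; rewrite gt_eqF.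
rewrite ler_pdivrMr//.
have L4 : 0 <= L ^+ 4 by rewrite exprn_ge0.
have h1 : L ^+ 4 * d ^+ 4 <= (g * L) ^+ 4 * d ^+ 3 * d'.
  have E4 : d ^+ 4 = d ^+ 3 * (g * d') by rewrite -dE; ring.
  have -> : L ^+ 4 * d ^+ 4 = L ^+ 4 * d ^+ 3 * d' * g by rewrite E4; ring.
  have -> : (g * L) ^+ 4 * d ^+ 3 * d' = L ^+ 4 * d ^+ 3 * d' * g ^+ 4 by ring.
  apply: ler_wpM2l; first by rewrite !mulr_ge0 ?exprn_ge0// ltW.
  by rewrite -[leLHS]expr1 ler_weXn2l.
have h2 : (g * L) ^+ 4 <= (2 * x) ^+ 4 by apply: lerXn2r; rewrite ?nnegrE ?mulr_ge0// ltW.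
have h3 : d ^+ 3 <= x ^+ 3 by apply: lerXn2r; rewrite ?nnegrE.
have h4 : (g * L) ^+ 4 * d ^+ 3 <= (2 * x) ^+ 4 * x ^+ 3 by apply: ler_pM; rewrite ?exprn_ge0 ?mulr_ge0 ?exprn_ge0// ltW.
have h5 : (2 * x) ^+ 4 * x ^+ 3 = 16 * (X ^+ 3 * x) by rewrite -xX; ring.
have h6 : (2 * H) ^+ 4 * q = 16 * (H ^+ 4 * q) by ring.
have h7 := X3x_le; have h8 : 0 <= H ^+ 4 by rewrite exprn_ge0.
apply: le_trans h1 _; apply: le_trans (ler_wpM2r (ltW d'0) h4) _; rewrite h5 h6.
have h9 := ler_wpM2r (ltW d'0) h7.
have h10 : H ^+ 4 * d' <= H ^+ 4 * q by apply: ler_wpM2l => //; lra.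
lra.
Qed.
End Monomials.

Section Total.
Variable R : realType.
Notation ch x := ((chi x)%:~R : R).
Variables (l X P B N : nat) (th H : R).
Hypotheses (l0 : (0 < l)%N) (X0 : (0 < X)%N).
Hypotheses (PN : (P <= N)%N) (XN : (4 * (X + l) < N)%N).
Hypotheses (HT : forall m, (0 < m <= N)%N -> (tau m)%:R <= th) (HH : harm R N <= th) (HB : B%:R <= th).
Hypothesis H0 : 0 < H.
Notation s := (Num.sqrt (X + l)%:R : R).
Hypotheses (F1 : s ^+ 3 * X%:R <= H ^+ 3) (F2 : X%:R ^+ 7 <= H ^+ 8) (F3 : s ^+ 3 * X%:R ^+ 3 <= H ^+ 5).

(** The factor at the prime 2 of 1 / (2^b g x' q), the reciprocal of the modulus of the progression
    at x = g x'. The odd factor is g / (d x), accounted for by [gam]. *)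
Definition density (b c : nat) : R := (solvable2 l b c)%:R / (2 ^ (b + (2 + (c - b))))%:R.

Lemma th_total_ge1 : 1 <= th.
Proof. by apply: le_trans (HT (m := 1) _); rewrite ?ler1n ?tau_gt0//= (leq_ltn_trans _ XN). Qed.

(** The choice eta = H / (s d) makes the smoothing error eta s equal to H / d, and the other terms
    are the monomials estimated above. The constant 1500 covers 40 + 8 + 1400. *)
Lemma error_size (b c d g d' L : nat) (eta : R) : d = (g * d')%N -> odd d -> (2 ^ c * d ^ 2 < X)%N ->
  (g * L)%:R <= Num.sqrt X%:R + g%:R :> R ->
  let q := (2 ^ (2 + (c - b)) * d')%N in
  eta = H / (s * d%:R) ->
  10 * eta * (2 * s + L%:R)
   + 8 * th * Num.sqrt ((X + l)%:R / (2 ^ b * g)%:R / q%:R / eta)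
   + 2 * th ^+ 2 * (84 + 40 * Num.sqrt (q%:R * Num.sqrt ((X + l)%:R / (2 ^ b * g)%:R / eta)) / q%:R + L%:R / q%:R + 4)
       * (2 * th ^+ 2 * (gcdn d l)%:R * q34 R q)
  <= 1500 * th ^+ 4 * ((gcdn d l)%:R * (H / d%:R)).
Proof.
move=> dE od dX gL q etaE.
have th1 := th_total_ge1.
have d0 : (0 < d)%N by case: (d) od.
have g0 : (0 < g)%N by move: d0; rewrite dE muln_gt0 => /andP[].
have d'0 : (0 < d')%N by move: d0; rewrite dE muln_gt0 => /andP[].
have b0 : (0 < 2 ^ b)%N by rewrite expn_gt0.
have q0 : (0 < q)%N by rewrite /q muln_gt0 expn_gt0.
have XR : 1 <= X%:R :> R by rewrite ler1n.
set x : R := Num.sqrt X%:R.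
have xX : x ^+ 2 = X%:R by rewrite sqr_sqrtr// ler0n.
have x1 : 1 <= x by rewrite -[leLHS](@sqrtr1 R) ler_wsqrtr.
have sX : s ^+ 2 = (X + l)%:R by rewrite sqr_sqrtr// ler0n.
have xs : x <= s by rewrite ler_wsqrtr// ler_nat leq_addr.
have s0 : 0 < s by lra.
have dR : 1 <= d%:R :> R by rewrite ler1n.
have d2X : (d ^ 2 <= X)%N by apply: leq_trans (ltnW dX); rewrite leq_pmull// expn_gt0.
have dx : d%:R <= x.
  by rewrite -[leLHS]ger0_norm// -sqrtr_sqr ler_wsqrtr// -natrX ler_nat.
have gd : g%:R <= d%:R :> R by rewrite ler_nat dE leq_pmulr.
have gR : 1 <= g%:R :> R by rewrite ler1n.
have LR : 0 <= L%:R :> R by apply: ler0n.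
have gL2 : g%:R * L%:R <= 2 * x by move: gL; rewrite -/x natrM; lra.
have Lx : L%:R <= 2 * x by apply: le_trans gL2; rewrite ler_peMl.
have eta0 : 0 < eta by rewrite etaE divr_gt0// mulr_gt0//; lra.
have qR : 0 < q%:R :> R by rewrite ltr0n.
have C0 : 0 <= (2 ^ c)%:R :> R by apply: ler0n.
have CX : (2 ^ c)%:R * d%:R ^+ 2 <= X%:R :> R by rewrite -natrX -natrM ler_nat ltnW.
have tc : (2 ^ (2 + (c - b)) <= 4 * 2 ^ c)%N by rewrite -[4%N]/(2 ^ 2)%N -expnD leq_exp2l// leq_add2l leq_subr.
have qC : q%:R <= 4 * (2 ^ c)%:R * d%:R :> R.
  rewrite -!natrM ler_nat /q; apply: leq_mul => //.
  by rewrite dE leq_pmull.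
have z0 := q34_ge0 R q; have z4 := q34_4 R q.
set z := q34 R q in z0 z4 *.
have B1 := quarter_bound x1 xX H0 dR dx F2 z0 z4 (ltW qR) qC C0 CX.
have dq : 4 * d'%:R <= q%:R :> R.
  rewrite -natrM ler_nat /q leq_mul2r; apply/orP; right.
  by rewrite -[4%N]/(2 ^ 2)%N leq_exp2l// leq_addr.
have B3 := linear_bound x1 xX H0 dR dx F2 z0 z4 gR LR gL2 _ dq _.
rewrite ltr0n d'0 dE natrM in B3; have {}B3 := B3 erefl isT; rewrite -natrM -dE in B3.
set W := (X + l)%:R / (2 ^ b * g)%:R / eta.
have bgR : 1 <= (2 ^ b * g)%:R :> R by rewrite ler1n muln_gt0 b0.
have W0 : 0 <= W by rewrite !divr_ge0 ?ler0n// ltW.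
set y := Num.sqrt (q%:R * Num.sqrt W).
have y0 : 0 <= y by apply: sqrtr_ge0.
have y4 : y ^+ 4 = q%:R ^+ 2 * W.
  have -> : y ^+ 4 = (y ^+ 2) ^+ 2 by rewrite -exprM.
  by rewrite sqr_sqrtr ?mulr_ge0 ?sqrtr_ge0 ?ler0n// exprMn sqr_sqrtr.
have WE : W = s ^+ 3 * d%:R / H / (2 ^ b * g)%:R.
  have sn : s != 0 by rewrite gt_eqF.
  have dn : d%:R != 0 :> R by rewrite pnatr_eq0 -lt0n.
  have bn : (2 ^ b * g)%:R != 0 :> R by rewrite pnatr_eq0 -lt0n muln_gt0 b0.
  have Hn : H != 0 by rewrite gt_eqF.
  rewrite /W etaE -[X in X / _ / _ = _]sX.
  move: sn dn bn; move: (s) (d%:R : R) ((2 ^ b * g)%:R : R) => u1 u2 u3 n1 n2 n3.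
  by field; rewrite n1 n2 n3 Hn.
have sdH : 0 <= s ^+ 3 * d%:R / H.
  by rewrite divr_ge0 ?mulr_ge0 ?exprn_ge0 ?ler0n// ltW.
have qW : q%:R * W <= 4 * (2 ^ c)%:R * d%:R * (s ^+ 3 * d%:R / H).
  apply: ler_pM; [exact: ltW | exact: W0 | exact: qC |].
  by rewrite WE ler_pdivrMr ?ler_peMr//; lra.
have B2 := stationary_bound x1 xX H0 dR dx F3 s0 z0 z4 qR C0 CX y0 y4 W0 qW.
have B4 : Num.sqrt ((X + l)%:R / (2 ^ b * g)%:R / q%:R / eta) <= H / d%:R.
  have Hd0 : 0 <= H / d%:R by rewrite divr_ge0 ?ler0n// ltW.
  rewrite -[leRHS](ger0_norm Hd0) -sqrtr_sqr; apply: ler_wsqrtr.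
  have -> : (X + l)%:R / (2 ^ b * g)%:R / q%:R / eta = W / q%:R by rewrite /W; ring.
  rewrite WE.
  have E1 : s ^+ 3 * d%:R / H / (2 ^ b * g)%:R / q%:R = s ^+ 3 / H / (2 ^ b * 2 ^ (2 + (c - b)))%:R.
    have nz (n : nat) : (0 < n)%N -> n%:R != 0 :> R by move=> n0; rewrite pnatr_eq0 -lt0n.
    have Hn : H != 0 by rewrite gt_eqF.
    have T0 : (0 < 2 ^ (2 + (c - b)))%N by rewrite expn_gt0.
    rewrite /q dE; move: T0; move: (2 ^ (2 + (c - b)))%N => T T0; rewrite !natrM.
    move: (nz _ d'0) (nz _ g0) (nz (2 ^ b)%N b0) (nz _ T0).
    move: (s) (d'%:R : R) (g%:R : R) ((2 ^ b)%:R : R) (T%:R : R).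
    by move=> u1 u2 u3 u4 u5 n2 n3 n4 n5; field; rewrite n2 n3 n4 n5 Hn.
  rewrite E1.
  have k1 : 1 <= (2 ^ b * 2 ^ (2 + (c - b)))%:R :> R by rewrite ler1n muln_gt0 !expn_gt0.
  have sH : 0 <= s ^+ 3 / H by rewrite divr_ge0 ?exprn_ge0// ltW.
  apply: le_trans (_ : s ^+ 3 / H <= _); first by rewrite ler_pdivrMr ?ler_peMr//; lra.
  rewrite exprMn exprVn ler_pdivrMr// mulrAC ler_pdivlMr ?exprn_gt0//; last lra.
  have -> : H ^+ 2 * H = H ^+ 3 by ring.
  apply: le_trans F1; apply: ler_wpM2l; first by rewrite exprn_ge0// ltW.
  by rewrite -natrX ler_nat.
set G : R := (gcdn d l)%:R.
have G1 : 1 <= G by rewrite ler1n gcdn_gt0 d0.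
set h := H / d%:R in B4 *.
have h0 : 0 <= h by rewrite divr_ge0 ?ler0n// ltW.
have hd : h * d%:R = H by rewrite /h divfK// gt_eqF//; lra.
have dpos : 0 < d%:R :> R by lra.
have C1 : z <= 3 * h by rewrite -(ler_pM2r dpos) -[leRHS]mulrA hd.
have C2 : z * (y / q%:R) <= 2 * h by rewrite -(ler_pM2r dpos) -[leRHS]mulrA hd.
have C3 : z * (L%:R / q%:R) <= 2 * h by rewrite -(ler_pM2r dpos) -[leRHS]mulrA hd.
have C4 : eta * (2 * s + L%:R) <= 4 * h.
  have -> : 4 * h = eta * (4 * s) by rewrite /h etaE; field; rewrite !gt_eqF//; lra.
  by apply: ler_wpM2l; [exact: ltW | lra].
have T1 : th <= th ^+ 4 by rewrite -[leLHS]expr1 ler_weXn2l.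
have T4 : 1 <= th ^+ 4 by rewrite exprn_ege1.
have TG : 1 <= th ^+ 4 * G by rewrite -[leLHS]mulr1; apply: ler_pM.
have T5 : th <= th ^+ 4 * G by apply: le_trans T1 _; rewrite ler_peMr//; lra.
have D1 : 10 * (eta * (2 * s + L%:R)) <= 40 * (th ^+ 4 * G * h).
  have : h <= th ^+ 4 * G * h by rewrite ler_peMl.
  lra.
have D2 : 8 * th * Num.sqrt ((X + l)%:R / (2 ^ b * g)%:R / q%:R / eta) <= 8 * (th ^+ 4 * G * h).
  rewrite -mulrA ler_pM2l//; apply: ler_pM; rewrite ?sqrtr_ge0//; lra.
have D3 : 2 * th ^+ 2 * (84 + 40 * y / q%:R + L%:R / q%:R + 4) * (2 * th ^+ 2 * G * z) <= 1400 * (th ^+ 4 * G * h).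
  have -> : 2 * th ^+ 2 * (84 + 40 * y / q%:R + L%:R / q%:R + 4) * (2 * th ^+ 2 * G * z)
    = th ^+ 4 * G * (4 * (88 * z + 40 * (z * (y / q%:R)) + z * (L%:R / q%:R))) by ring.
  have -> : 1400 * (th ^+ 4 * G * h) = th ^+ 4 * G * (1400 * h) by ring.
  apply: ler_wpM2l; first exact: le_trans ler01 TG.
  by lra.
rewrite -/W -/y -/G -/z.
have -> : 1500 * th ^+ 4 * (G * h) = 1500 * (th ^+ 4 * G * h) by ring.
have : 0 <= th ^+ 4 * G * h by rewrite mulr_ge0//; lra.
lra.
Qed.

Lemma pairs_none (b c d g d' x : nat) : d = (g * d')%N -> odd d -> odd x ->
  (forall A, ~~ compat l b c d g A) -> pairs l X b c d (g * x) = 0%N.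
Proof.
move=> dE od ox none; apply: big1_seq => n _; case: (boolP (rep c d n)) => //=; rewrite repE => /and3P[_ _ Dc].
case: (boolP (rep b (g * x) (n + l))) => //=; rewrite repE => /and3P[_ _ /dvdzP[k Hk]].
(* A counted n provides the compatible value (n + l) / (2^b g). *)
exfalso; apply/negP: (none (x%:Z * ((g * x)%N%:Z + 4 * k))); rewrite negbK /compat; apply/andP; split.
  have -> : x%:Z * ((g * x)%N%:Z + 4 * k) - g%:Z = g%:Z * (x%:Z ^+ 2 - 1) + 4 * (x%:Z * k) by rewrite PoszM; ring.
  by rewrite rpredD//; [apply: dvdz_mull; exact: odd_sqr4 | exact: dvdz_mulr].
have -> : (2 ^ b)%N%:Z * g%:Z * (x%:Z * ((g * x)%N%:Z + 4 * k)) - (l%:Z + (2 ^ c)%N%:Z * d%:Z ^+ 2)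
  = n%:Z - (2 ^ c)%N%:Z * d%:Z ^+ 2; last exact: Dc.
have E : (n + l)%N%:Z = (2 ^ b)%N%:Z * g%:Z * (x%:Z * ((g * x)%N%:Z + 4 * k)).
  by move: Hk => /(canRL (subrK _)) ->; rewrite PoszM; ring.
by rewrite -E PoszD; ring.
Qed.

Definition deviation (b c d x : nat) : R :=
  ch x * ((pairs l X b c d x)%:R - density b c * (gam d l x)%:R / (d%:R * x%:R) * (X - lowest l b c d x)%:R).

(** If no A is compatible, both the count and the main term vanish, the latter through [gam] or
    [density]. Otherwise the class consists of x = g x' with x' prime to q, even x being removed by
    [chi], and [local_error] applies. *)
Lemma deviation_class (b c d g : nat) : odd d -> (2 ^ c * d ^ 2 < X)%N -> (g %| d)%N ->
  `|\sum_(0 <= x < P) deviation b c d x *+ (g == gcdn d x)| <= 1500 * th ^+ 4 * ((gcdn d l)%:R * (H / d%:R)).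
Proof.
move=> od dX gd.
have th1 := th_total_ge1.
have d0 : (0 < d)%N by case: (d) od.
have [d' dE'] := dvdnP gd; have dE : d = (g * d')%N by rewrite mulnC.
have g0 : (0 < g)%N by move: d0; rewrite dE muln_gt0 => /andP[].
have d'0 : (0 < d')%N by move: d0; rewrite dE muln_gt0 => /andP[].
have RHS0 : 0 <= 1500 * th ^+ 4 * ((gcdn d l)%:R * (H / d%:R)).
  by have H0' := H0; nonneg.
pose q := (2 ^ (2 + (c - b)) * d')%N.
have copE := coprime_modulus b c d'.
have -> : \sum_(0 <= x < P) deviation b c d x *+ (g == gcdn d x)
  = \sum_(0 <= x < (P + g.-1) %/ g | coprime q x) deviation b c d (g * x).
  rewrite (eq_bigr (fun x => if (g == gcdn d x) && (g %| x)%N then deviation b c d x else 0)); last first.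
    move=> x _; case: eqP => /= [E|]; last by rewrite mulr0n.
    by have -> : (g %| x)%N; [rewrite E dvdn_gcdr | rewrite mulr1n].
  rewrite -big_mkcond sum_multiples//.
  rewrite big_mkcond [RHS]big_mkcond; apply: eq_bigr => x _.
  rewrite copE dE -muln_gcdr -{1}(muln1 g) eqn_pmul2l// eq_sym [gcdn _ _]gcdnC -/(coprime x d').
  case: (coprime x d'); rewrite ?andbT ?andbF//.
  have [//|ex] := boolP (odd x).
  by rewrite /deviation chi_even ?mul0r// oddM (negPf ex) andbF.
have ods x : coprime q x -> odd x by rewrite copE => /andP[].
have gE x : coprime q x -> gcdn d (g * x) = g.
  by rewrite copE => /andP[_ /eqP cx]; rewrite dE -muln_gcdr [gcdn d' x]gcdnC cx muln1.
have cex := compat_exists b c l0 od gd.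
have [[A cA]|none] := pselect (exists A, compat l b c d g A); last first.
  have nn : ~~ ((g %| l)%N && solvable2 l b c) by apply/negP => /(proj2 cex).
  rewrite big1 ?normr0// => x cx.
  have nA A : ~~ compat l b c d g A by apply/negP => cA; apply: none; exists A.
  rewrite /deviation (pairs_none dE od (ods x cx) nA) /gam (gE x cx) /density.
  move: nn; rewrite negb_and => /orP[] /negPf ->; by rewrite ?mul0r ?mulr0 ?mul0r subr0 mulr0.
have /andP[gl sol] := proj1 cex (ex_intro _ A cA).
have q0 : (0 < q)%N by rewrite /q muln_gt0 expn_gt0.
have q1 : (1 < q)%N.
  by rewrite /q (leq_trans _ (leq_pmulr _ d'0))// -[2%N]/(2 ^ 1)%N leq_exp2l.
have b0 : (0 < 2 ^ b)%N by rewrite expn_gt0.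
have XR : 1 <= X%:R :> R by rewrite ler1n.
have s0 : 0 < s by rewrite sqrtr_gt0 ltr0n addn_gt0 X0.
have sX : s ^+ 2 = (X + l)%:R by rewrite sqr_sqrtr// ler0n.
have xX : (Num.sqrt X%:R : R) ^+ 2 = X%:R by rewrite sqr_sqrtr// ler0n.
have x1 : 1 <= Num.sqrt X%:R :> R by rewrite -[leLHS](@sqrtr1 R) ler_wsqrtr.
have d2X : (d ^ 2 <= X)%N by apply: leq_trans (ltnW dX); rewrite leq_pmull// expn_gt0.
have dx : d%:R <= Num.sqrt X%:R :> R.
  by rewrite -[leLHS]ger0_norm// -sqrtr_sqr ler_wsqrtr// -natrX ler_nat.
have xH := x_le_H x1 xX H0 F2.
have dR : 1 <= d%:R :> R by rewrite ler1n.
have qN : (0 < q <= N)%N.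
  rewrite q0 /=; apply: leq_trans (ltnW XN).
  apply: (@leq_trans (4 * (2 ^ c * d ^ 2))).
    have tc : (2 ^ (2 + (c - b)) <= 4 * 2 ^ c)%N by rewrite -[4%N]/(2 ^ 2)%N -expnD leq_exp2l// leq_add2l leq_subr.
    rewrite /q mulnA; apply: leq_mul => //.
    by rewrite dE (leq_trans (leq_pmull d' g0))// -mulnn leq_pmulr// muln_gt0 g0.
  by rewrite leq_mul2l /= (leq_trans (ltnW dX))// leq_addr.
have th_harm : harm R q <= th by apply: le_trans HH; apply: harm_le; case/andP: qN.
have th_tau : (tau q)%:R <= th by apply: HT.
have th_K : harm R (X + l).+1 <= th.
  apply: le_trans HH; apply: harm_le; apply: leq_trans XN; rewrite ltnS; exact: leq_pmull.
pose eta := H / (s * d%:R).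
have eta0 : 0 < eta by rewrite divr_gt0// mulr_gt0//; lra.
(* The number of frequencies is K = X + l, and eta^2 (X + l) = (H / d)^2 is at least 1 because d <=
   sqrt X <= H. *)
have etaK : eta <= 1 -> 1 <= eta ^+ 2 * (X + l)%:R.
  move=> _; have -> : eta ^+ 2 * (X + l)%:R = (H / d%:R) ^+ 2.
    by rewrite -sX /eta; field; rewrite !gt_eqF//; lra.
  by apply: exprn_ege1; rewrite ler_pdivlMr ?mul1r; [exact: le_trans dx xH | lra].
have [L [HL1 HL2]] := local_error l0 X0 dE od dX cA th_harm th_tau th_K eta0 etaK ((P + g.-1) %/ g).
have E := error_size b dE od dX HL1 (erefl eta).
apply: le_trans E; apply: le_trans HL2.
have -> : \sum_(0 <= x < (P + g.-1) %/ g | coprime q x) deviation b c d (g * x)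
  = ch g * \sum_(1 <= x < (P + g.-1) %/ g | coprime q x) ch x *
     ((pairs l X b c d (g * x))%:R - (X - lowest l b c d (g * x))%:R / (2 ^ b * (g * x) * q)%:R).
  rewrite mulr_sumr; have [->|N0] := posnP ((P + g.-1) %/ g)%N; first by rewrite !big_geq.
  have c0 : coprime q 0 = false by rewrite /coprime gcdn0 gtn_eqF.
  rewrite big_ltn_cond//= c0.
  rewrite big_nat_cond [RHS]big_nat_cond; apply: eq_bigr => x /andP[/andP[x0 _] cx].
  have E : density b c * (gam d l (g * x))%:R / (d%:R * (g * x)%:R) * (X - lowest l b c d (g * x))%:R
    = (X - lowest l b c d (g * x))%:R / (2 ^ b * (g * x) * q)%:R.
    have T0 : (0 < 2 ^ (2 + (c - b)))%N by rewrite expn_gt0.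
    have -> : density b c = (2 ^ b * 2 ^ (2 + (c - b)))%:R^-1 by rewrite /density sol expnD; exact: mul1r.
    rewrite /gam (gE x cx) gl /q; move: (lowest _ _ _ _ _) => lo; rewrite dE.
    move: T0; move: (2 ^ (2 + (c - b)))%N => T T0; rewrite !natrM.
    have nz (n : nat) : (0 < n)%N -> n%:R != 0 :> R by move=> n0; rewrite pnatr_eq0 -lt0n.
    move: (nz _ d'0) (nz _ g0) (nz _ x0) (nz (2 ^ b)%N b0) (nz _ T0).
    move: (d'%:R : R) (g%:R : R) (x%:R : R) ((2 ^ b)%:R : R) (T%:R : R) ((X - lo)%:R : R).
    by move=> u1 u2 u3 u4 u5 u6 n1 n2 n3 n4 n5; field; rewrite n1 n2 n3 n4 n5.
  by rewrite /deviation E chiM rmorphM /= mulrA.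
by rewrite normrM ler_piMl// chi_le1.
Qed.

Lemma deviation_sum (b c d : nat) : (0 < d < P)%N ->
  `|ch d * \sum_(1 <= x < P) deviation b c d x| <= 1500 * th ^+ 5 * ((gcdn d l)%:R * (H / d%:R)).
Proof.
move=> /andP[d0 dP]; have th1 := th_total_ge1.
have RHS0 k : 0 <= 1500 * th ^+ k * ((gcdn d l)%:R * (H / d%:R)) by have H0' := H0; nonneg.
have [od|ed] := boolP (odd d); last by rewrite chi_even// mul0r normr0.
have [dX|Xd] := ltnP (2 ^ c * d ^ 2) X; last first.
  rewrite big1 ?mulr0 ?normr0// => x _; rewrite /deviation.
  have -> : (X - lowest l b c d x)%N = 0%N.
    by apply/eqP; rewrite subn_eq0 (leq_trans Xd)// leq_maxl.
  have -> : pairs l X b c d x = 0%N.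
    rewrite /pairs big_nat big1// => n /andP[_ nX]; rewrite /rep ltnNge.
    by rewrite (leq_trans _ Xd) ?andbF//.
  by rewrite mulr0 subrr mulr0.
rewrite normrM; apply: (@le_trans _ _ (1 * `|\sum_(1 <= x < P) deviation b c d x|)).
  by apply: ler_wpM2r => //; exact: chi_le1.
rewrite mul1r.
have -> : \sum_(1 <= x < P) deviation b c d x = \sum_(0 <= g < d.+1) \sum_(0 <= x < P) deviation b c d x *+ (g == gcdn d x).
  rewrite exchange_big_nat/= [RHS]big_ltn ?(ltn_trans d0)//.
  rewrite [X in _ = X + _]big1 ?add0r; last by move=> g _; rewrite /deviation chi_even// mul0r mul0rn.
  apply: eq_bigr => x _; rewrite (@sum_delta _ d.+1 (gcdn d x) (fun=> deviation b c d x))//.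
  by rewrite ltnS dvdn_leq// dvdn_gcdl.
apply: le_trans (ler_norm_sum _ _ _) _.
pose E := 1500 * th ^+ 4 * ((gcdn d l)%:R * (H / d%:R)).
apply: (@le_trans _ _ (\sum_(0 <= g < d.+1) if (g %| d)%N then E else 0)).
  apply: ler_sum => g _; case: ifP => gd; first exact: deviation_class.
  rewrite big1 ?normr0// => x _; case: eqP => // Eg.
  by rewrite Eg dvdn_gcdl in gd.
rewrite -big_mkcond /= big_mkcond big_ltn//= dvd0n gtn_eqF// add0r -big_mkcond.
rewrite -(@sum_divisors _ d d.+1 (fun=> E)); last by rewrite d0 /= ltnSn.
rewrite big_const_seq count_predT iter_addr_0 -[leLHS]mulr_natl.
have -> : 1500 * th ^+ 5 * ((gcdn d l)%:R * (H / d%:R)) = th * E by rewrite /E; ring.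
apply: ler_wpM2r; first exact: RHS0.
by apply: HT; rewrite d0 (leq_trans (ltnW dP)).
Qed.

Lemma halfsum_pairs :
  \sum_(1 <= n < X.+1) (halfsum B P n)%:~R * (halfsum B P (n + l))%:~R
  = \sum_(0 <= b < B) \sum_(0 <= c < B) \sum_(1 <= d < P) ch d * \sum_(1 <= x < P) ch x * (pairs l X b c d x)%:R.
Proof.
have hE n : (halfsum B P n)%:~R = \sum_(0 <= c < B) \sum_(1 <= d < P) ch d * (rep c d n)%:R :> R.
  rewrite /halfsum rmorph_sum; apply: eq_bigr => c _; rewrite rmorph_sum; apply: eq_bigr => d _.
  by rewrite /= rmorphMn mulr_natr.
under eq_bigr => n _.
  rewrite !hE mulr_sumr; under eq_bigr do rewrite mulr_suml; over.
rewrite exchange_big_nat/=; apply: eq_bigr => b _.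
rewrite exchange_big_nat/=; apply: eq_bigr => c _.
under eq_bigr do rewrite mulr_suml.
rewrite exchange_big_nat/=; apply: eq_bigr => d _.
rewrite mulr_sumr; under eq_bigr do rewrite mulr_sumr.
rewrite exchange_big_nat/=; apply: eq_bigr => x _.
rewrite /pairs natr_sum !mulr_sumr; apply: eq_bigr => n _.
by rewrite -mulnb natrM; ring.
Qed.

Lemma sing_lowest :
  \sum_(1 <= n < X.+1) sing l P B density n
  = \sum_(0 <= b < B) \sum_(0 <= c < B) \sum_(1 <= d < P) ch d * \sum_(1 <= x < P)
      ch x * (density b c * (gam d l x)%:R / (d%:R * x%:R) * (X - lowest l b c d x)%:R).
Proof.
rewrite /sing exchange_big_nat/=; apply: eq_bigr => b _.
rewrite exchange_big_nat/=; apply: eq_bigr => c _.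
rewrite -mulr_sumr /sing2 exchange_big_nat/= mulr_sumr; apply: eq_bigr => d _.
rewrite exchange_big_nat/= !mulr_sumr; apply: eq_bigr => x _.
rewrite -mulr_sumr box_count; ring.
Qed.

(** A single class costs th^4, the sum over the gcd costs [th], the sum of gcd(d, l) / d over d
    costs th^2, and the exponents b and c cost [th] each: hence the ninth power. *)
Theorem halfsum_correlation :
  `|\sum_(1 <= n < X.+1) (halfsum B P n)%:~R * (halfsum B P (n + l))%:~R - \sum_(1 <= n < X.+1) sing l P B density n|
  <= 1500 * th ^+ 9 * H.
Proof.
have th1 := th_total_ge1.
have -> : \sum_(1 <= n < X.+1) (halfsum B P n)%:~R * (halfsum B P (n + l))%:~R - \sum_(1 <= n < X.+1) sing l P B density n
  = \sum_(0 <= b < B) \sum_(0 <= c < B) \sum_(1 <= d < P) ch d * \sum_(1 <= x < P) deviation b c d x.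
  rewrite halfsum_pairs sing_lowest -sumrB; apply: eq_bigr => b _; rewrite -sumrB; apply: eq_bigr => c _.
  rewrite -sumrB; apply: eq_bigr => d _; rewrite -mulrBr -sumrB; congr (_ * _); apply: eq_bigr => x _.
  by rewrite /deviation mulrBr.
have inner b c : `|\sum_(1 <= d < P) ch d * \sum_(1 <= x < P) deviation b c d x| <= 1500 * th ^+ 7 * H.
  apply: le_trans (ler_norm_sum _ _ _) _.
  apply: (@le_trans _ _ (\sum_(1 <= d < P) 1500 * th ^+ 5 * H * ((gcdn d l)%:R / d%:R))).
    apply: ler_sum_nat => d dP; apply: le_trans (deviation_sum b c dP) _.
    by rewrite le_eqVlt; apply/orP; left; apply/eqP; ring.
  rewrite -mulr_sumr.
  have -> : 1500 * th ^+ 7 * H = 1500 * th ^+ 5 * H * th ^+ 2 by ring.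
  apply: ler_wpM2l; first by have H0' := H0; nonneg.
  apply: le_trans (sum_gcd_div R P l0) _; rewrite expr2; apply: ler_pM; rewrite ?ler0n ?harm_ge0//.
    apply: HT; rewrite l0 /=; apply: leq_trans (ltnW XN).
    by rewrite mulnDr (leq_trans _ (leq_addl _ _))// leq_pmull.
  by apply: le_trans HH; exact: harm_le.
apply: le_trans (ler_norm_sum _ _ _) _.
apply: (@le_trans _ _ (\sum_(0 <= b < B) \sum_(0 <= c < B) 1500 * th ^+ 7 * H)).
  by apply: ler_sum => b _; apply: le_trans (ler_norm_sum _ _ _) _; apply: ler_sum => c _.
rewrite !sumr_const_nat subn0 -mulrnA -[leLHS]mulr_natl natrM.
have -> : 1500 * th ^+ 9 * H = th * th * (1500 * th ^+ 7 * H) by ring.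
apply: ler_wpM2r; first by have H0' := H0; nonneg.
by apply: ler_pM; rewrite ?ler0n.
Qed.

Lemma density_ge0 b c : 0 <= density b c.
Proof. by rewrite /density divr_ge0 ?ler0n. Qed.

Lemma density_small (b c k : nat) : (k <= b \/ k <= c)%N -> density b c * Num.sqrt (2 ^ k)%:R <= 1.
Proof.
move=> kbc; rewrite /density mulrAC ler_pdivrMr ?ltr0n ?expn_gt0// mul1r.
have kk : (k <= b + (2 + (c - b)))%N by move: kbc; clear; lia.
have p1 : 1 <= (2 ^ k)%:R :> R by rewrite ler1n expn_gt0.
apply: (@le_trans _ _ (1 * (2 ^ k)%:R)); last by rewrite mul1r ler_nat leq_exp2l.
apply: ler_pM; rewrite ?ler0n ?sqrtr_ge0//; first by case: solvable2; rewrite //= ler01.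
rewrite -[leRHS](@sqr_sqrtr _ (2 ^ k)%:R) ?ler0n// expr2 ler_peMl ?sqrtr_ge0//.
by rewrite -[leLHS](@sqrtr1 R) ler_wsqrtr.
Qed.
End Total.

(** * Extracting the constant *)

Section Limit.
Variable R : realType.

(** Along X, 2 X, 4 X, ... the bounds decrease geometrically, so the differences add up to at most 1
    / (1 - rho) times the first bound. *)
Lemma iterate_doubling (f G : nat -> R) (rho : R) : 0 <= rho < 1 ->
  (forall X, (0 < X)%N -> 0 <= G X) -> (forall X, (0 < X)%N -> G (2 * X)%N <= rho * G X) ->
  (forall X Y, (0 < X <= Y)%N -> (Y <= 2 * X)%N -> `|f X - f Y| <= G X) ->
  forall X Y, (0 < X <= Y)%N -> `|f X - f Y| <= (1 - rho)^-1 * G X.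
Proof.
move=> /andP[r0 r1] G0 G2 fG.
have k1 : 1 <= (1 - rho)^-1 by rewrite invf_ge1; lra.
have kE : 1 + (1 - rho)^-1 * rho = (1 - rho)^-1 by field; rewrite subr_eq0 gt_eqF.
move=> X Y; have [n] := ubnP (Y - X)%N; elim: n X Y => // n IH X Y nE /andP[X0 XY].
have [le|lt] := leqP Y (2 * X).
  apply: le_trans (fG X Y _ le) _; first by rewrite X0.
  by rewrite ler_peMl// G0.
have X2 : (X <= 2 * X)%N by rewrite leq_pmull.
apply: le_trans (ler_distD (f (2 * X)%N) _ _) _.
apply: le_trans (lerD (fG X (2 * X)%N _ _) (IH (2 * X)%N Y _ _)) _ => //; rewrite ?X0 ?muln_gt0 ?X0 ?(ltnW lt)//.
  by move: nE lt X0; clear; lia.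
have := ler_wpM2l (le_trans ler01 k1) (G2 X X0).
move=> H; have E : (1 - rho)^-1 * G X = G X + (1 - rho)^-1 * (rho * G X) by rewrite -{1}kE; ring.
by rewrite E lerD2l.
Qed.

Lemma geometric_small (rho K d : R) : 0 <= rho < 1 -> 0 < d -> exists j, K * rho ^+ j < d.
Proof.
move=> /andP[r0 r1] d0.
have r1' : `|rho| < 1 by rewrite ger0_norm.
have K1 : 0 < `|K| + 1 by rewrite ltr_wpDl.
have /cvgrPdist_lt/(_ (d / (`|K| + 1))) := cvg_expr r1'.
rewrite divr_gt0// => /(_ isT) [N _ /(_ N (leqnn N))] /=.
rewrite sub0r normrN ger0_norm ?exprn_ge0// ltr_pdivlMr// => H.
exists N; apply: le_lt_trans H.
rewrite mulrC ler_wpM2l ?exprn_ge0//; have := ler_norm K; lra.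
Qed.

(* [c] must not depend on [G]: it is the supremum of the lower bounds [f X - G0 X]. *)
Lemma squeeze_limit (f G0 : nat -> R) :
  (forall X Y, (0 < X <= Y)%N -> `|f X - f Y| <= G0 X) ->
  (forall d (X : nat), 0 < d -> exists2 Y, (X <= Y)%N & G0 Y < d) ->
  exists c : R, forall G : nat -> R,
   (forall X Y, (0 < X <= Y)%N -> `|f X - f Y| <= G X) ->
   forall X, (0 < X)%N -> `|f X - c| <= G X.
Proof.
move=> fG0 G0s.
pose E : set R := [set x | exists2 X, (0 < X)%N & x = f X - G0 X]%classic.
have ubE X G : (0 < X)%N -> (forall Y, (X <= Y)%N -> `|f X - f Y| <= G) -> ubound E (f X + G).
  move=> X0 HG _ [Y Y0 ->].
  have := fG0 Y (maxn X Y); rewrite Y0 leq_maxr => /(_ isT).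
  have := HG (maxn X Y) (leq_maxl _ _).
  by rewrite !ler_distl => /andP[a1 a2] /andP[b1 b2]; lra.
have hub : has_ubound E.
  by exists (f 1%N + G0 1%N); apply: ubE => // Y Y1; apply: fG0.
have hne : (E !=set0)%classic by exists (f 1%N - G0 1%N); exists 1%N.
exists (sup E) => G HG X X0; rewrite ler_distl; apply/andP; split; last first.
  rewrite -lerBlDr; apply/ler_addgt0Pr => d d0.
  have [Y XY Yd] := G0s d X d0.
  have Y0 : (0 < Y)%N by apply: leq_trans XY.
  have : f Y - G0 Y <= sup E by apply: ub_le_sup => //; exists Y.
  have := HG X Y; rewrite X0 XY => /(_ isT); rewrite ler_distl => /andP[a1 a2].
  lra.
rewrite lerBlDr; apply: ge_sup => //; apply: ubE => // Y XY.
by apply: HG; rewrite X0.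
Qed.

Variable S : nat -> nat -> R.

(** The constant is extracted once, with eps = 1/40; since [squeeze_limit] fixes it before the bound
    [G], it satisfies the bounds for all smaller eps as well. The restriction on eps makes the bound
    contract when X is doubled. *)
Theorem limit_of_doubling :
  (forall eps, 0 < eps -> exists C, forall l X Y : nat, (0 < l)%N -> (0 < X <= Y)%N -> (Y <= 2 * X)%N ->
    `|S l X / X%:R - S l Y / Y%:R| <= C * (X%:R `^ (- (1 / 5)) * (X + l)%:R `^ (3 / 20 + eps))) ->
  exists c : nat -> R, forall eps, 0 < eps <= 1 / 40 -> exists2 C, 0 <= C & forall l X : nat, (0 < l)%N -> (0 < X)%N ->
    `|S l X / X%:R - c l| <= C * (X%:R `^ (- (1 / 5)) * (X + l)%:R `^ (3 / 20 + eps)).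
Proof.
move=> core.
pose g l eps X : R := X%:R `^ (- (1 / 5)) * (X + l)%:R `^ (3 / 20 + eps).
have g0 l eps X : 0 <= g l eps X by rewrite mulr_ge0// powR_ge0.
pose rho : R := 2 `^ (- (1 / 40)).
have rho1 : 0 <= rho < 1.
  rewrite powR_ge0 /= /rho powRN invf_lt1 ?powR_gt0//.
  apply: (@le_lt_trans _ _ (1 `^ (1 / 40))); first by rewrite powR1.
  apply: gt0_ltr_powR; rewrite ?nnegrE//; lra.
have gd l eps X : (0 < X)%N -> 0 < eps <= 1 / 40 -> g l eps (2 * X)%N <= rho * g l eps X.
  move=> X0 /andP[e0 e1]; rewrite /g natrM powRM//.
  have H1 : (2 * X + l)%:R `^ (3 / 20 + eps) <= 2 `^ (3 / 20 + eps) * (X + l)%:R `^ (3 / 20 + eps) :> R.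
    rewrite -powRM//; apply: ge0_ler_powR; rewrite ?nnegrE ?mulr_ge0//; first lra.
    by rewrite -natrM ler_nat mulnDr leq_add2l leq_pmull.
  apply: le_trans (ler_wpM2l _ H1) _; first by rewrite mulr_ge0// powR_ge0.
  rewrite mulrACA; apply: ler_wpM2r; first by rewrite mulr_ge0// powR_ge0.
  rewrite -powRD ?pnatr_eq0 ?implybT// /rho.
  by apply: ler_powR; rewrite ?ler1n//; lra.
have full l eps : (0 < l)%N -> 0 < eps <= 1 / 40 -> exists2 C, 0 <= C & forall l X Y : nat, (0 < l)%N -> (0 < X <= Y)%N ->
    `|S l X / X%:R - S l Y / Y%:R| <= C * g l eps X.
  move=> l0 e; have e0 : 0 < eps by case/andP: e.
  have [C HC] := core eps e0.
  exists ((1 - rho)^-1 * `|C|); first by rewrite mulr_ge0// invr_ge0; case/andP: rho1; lra.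
  move=> {l0}l X Y l0; rewrite -mulrA.
  apply: (@iterate_doubling (fun X => S l X / X%:R) (fun X => `|C| * g l eps X)) => //.
  - by move=> Z _; rewrite mulr_ge0.
  - by move=> Z Z0 /=; rewrite [leRHS]mulrCA; apply: ler_wpM2l => //; exact: gd.
  move=> {}X {}Y XY Y2; apply: le_trans (HC _ _ _ l0 XY Y2) _.
  by rewrite ler_wpM2r ?ler_norm// g0.
have e40 : 0 < (1 / 40 : R) <= 1 / 40 by apply/andP; split; lra.
have lim l : exists c : R, (0 < l)%N -> forall G : nat -> R,
   (forall X Y, (0 < X <= Y)%N -> `|S l X / X%:R - S l Y / Y%:R| <= G X) ->
   forall X, (0 < X)%N -> `|S l X / X%:R - c| <= G X.
  have [->|l0] := posnP l; first by exists 0.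
  have [C C0 HC] := full l _ l0 e40.
  have small j : g l (1 / 40) (2 ^ j)%N <= rho ^+ j * g l (1 / 40) 1%N.
    elim: j => [|j IH]; first by rewrite expn0 expr0 [leRHS]mul1r.
    rewrite expnS exprS -mulrA; apply: le_trans (gd _ _ _ _ e40) _; first by rewrite expn_gt0.
    by rewrite ler_wpM2l//; case/andP: rho1.
  have sm d (X : nat) : 0 < d -> exists2 Y, (X <= Y)%N & C * g l (1 / 40) Y < d.
    move=> d0; have [j Hj] := geometric_small (C * g l (1 / 40) 1%N) rho1 d0.
    have [X0|X0] := posnP X.
        exists (2 ^ j)%N; first by rewrite X0.
        apply: le_lt_trans Hj; rewrite -mulrA [g _ _ _ * _]mulrC; exact: ler_wpM2l.
    exists (2 ^ (j + X))%N.
        by rewrite expnD (leq_trans (ltnW (ltn_expl X (ltnSn 1))))// leq_pmull// expn_gt0.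
    apply: le_lt_trans Hj; rewrite -mulrA [g _ _ _ * _]mulrC; apply: ler_wpM2l => //.
    apply: le_trans (small _) _; rewrite ler_wpM2r//.
    by apply: ler_wiXn2l; [case/andP: rho1 | case/andP: rho1 => _ /ltW | rewrite leq_addr].
  have [c Hc] := @squeeze_limit (fun X => S l X / X%:R) (fun X => C * g l (1 / 40) X)
    (fun X Y => HC l X Y l0) sm.
  by exists c.
have [c Hc] := choice lim.
exists c => eps e.
(* The bound in [full] is uniform in l, so the instance l = 1 yields a constant valid for every
   l. *)
have [C C0 HC] := full 1%N eps isT e.
exists C => // l X l0 X0; apply: (Hc l l0 (fun X => C * g l eps X)) => // {X0}X Y XY.
exact: HC.
Qed.
End Limit.

(** * The correlation sum *)

Section DivisorBounds.
Variable R : realType.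

Lemma harm_pow2 (j : nat) : harm R (2 ^ j).-1 <= j%:R.
Proof.
elim: j => [|j IH]; first by rewrite /harm big_geq.
have p0 : (0 < 2 ^ j)%N by rewrite expn_gt0.
have pR : 0 < (2 ^ j)%:R :> R by rewrite ltr0n.
rewrite /harm prednK ?expn_gt0// (@big_cat_nat _ _ _ (2 ^ j)%N)//=; last by rewrite leq_exp2l.
rewrite -natr1; apply: lerD; first by move: IH; rewrite /harm prednK.
apply: (@le_trans _ _ (\sum_(2 ^ j <= i < 2 ^ j.+1) (2 ^ j)%:R^-1)).
  apply: ler_sum_nat => i /andP[ji _]; rewrite lef_pV2 ?posrE ?ltr0n ?(leq_trans p0)//.
  by rewrite ler_nat.
rewrite sumr_const_nat expnS mul2n -addnn addnK -[leLHS]mulr_natl divff//.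
Qed.

Lemma tau_pow2 (j : nat) : (j < tau (2 ^ j))%N.
Proof.
rewrite /tau -[j in (j < _)%N]/(j.+1.-1) prednK// -(size_iota 0 j.+1) -(size_map (expn 2)).
apply: uniq_leq_size; first by rewrite map_inj_uniq ?iota_uniq//; exact: expnI.
apply/allP; rewrite all_map; apply/allP => i; rewrite mem_iota add0n ltnS /= => ij.
by rewrite -dvdn_divisors ?expn_gt0// dvdn_exp2l.
Qed.

(** The divisor bound also controls logarithms: the largest power 2^J not exceeding N has J + 1
    divisors, and the harmonic sum is at most the number J + 1 of dyadic blocks. *)
Lemma uniform_divisor_bound (eps : R) : 0 < eps -> exists2 M, 1 <= M &
  forall N, (0 < N)%N -> exists B : nat, [/\ (N < 2 ^ B)%N, B%:R <= M * N%:R `^ eps,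
    harm R N <= M * N%:R `^ eps & forall m, (0 < m <= N)%N -> (tau m)%:R <= M * N%:R `^ eps].
Proof.
move=> e0; have [M M1 HM] := divisor_bound e0.
exists M => // N N0.
have HT m : (0 < m <= N)%N -> (tau m)%:R <= M * N%:R `^ eps.
  move=> /andP[m0 mN]; apply: le_trans (HM m m0) _; apply: ler_wpM2l; first lra.
  by apply: ge0_ler_powR; rewrite ?nnegrE ?ler0n ?ler_nat// ltW.
have /andP[J1 J2] := trunc_log_bounds (isT : (1 < 2)%N) N0.
set J := trunc_log 2 N in J1 J2.
have BT : J.+1%:R <= M * N%:R `^ eps.
  apply: le_trans (HT (2 ^ J)%N _); first by rewrite ler_nat; exact: tau_pow2.
  by rewrite expn_gt0.
exists J.+1; split=> //; apply: le_trans BT; apply: le_trans (harm_pow2 _).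
by apply: harm_le; rewrite -ltnS prednK ?expn_gt0.
Qed.
End DivisorBounds.

Section Core.
Variable R : realType.

Definition correlation (l X : nat) : R := \sum_(1 <= n < X.+1) (r n%:Z)%:R * (r (n%:Z + l%:Z))%:R.

Definition scale (l X : nat) : R := X%:R `^ (4 / 5) * (X + l)%:R `^ (3 / 20).

(** The twentieth roots u of X and v of X + l turn every fractional power in use into a monomial, so
    that the later comparisons are polynomial. *)
Lemma scale_facts (l X : nat) : (0 < X)%N -> exists u v : R, [/\ 1 <= u, u <= v, X%:R = u ^+ 20,
  (X + l)%:R = v ^+ 20 & Num.sqrt (X + l)%:R = v ^+ 10 /\ scale l X = u ^+ 16 * v ^+ 3].
Proof.
move=> X0; pose u : R := X%:R `^ (1 / 20); pose v : R := (X + l)%:R `^ (1 / 20).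
have pw (n k : nat) : (0 < n)%N -> n%:R `^ (k%:R / 20) = (n%:R `^ (1 / 20)) ^+ k :> R.
  move=> n0; have -> : k%:R / 20 = (1 / 20) * k%:R :> R by ring.
  by rewrite powRrM powR_mulrn// powR_ge0.
have Xl0 : (0 < X + l)%N by rewrite addn_gt0 X0.
have p1 (n : nat) : (0 < n)%N -> n%:R = (n%:R `^ (1 / 20)) ^+ 20 :> R.
  by move=> n0; rewrite -pw// divff ?powRr1// pnatr_eq0.
exists u, v; split.
- rewrite -[leLHS](powRr0 X%:R); apply: ler_powR; first by rewrite ler1n.
  by rewrite divr_ge0.
- by apply: ge0_ler_powR; rewrite ?nnegrE ?ler0n ?ler_nat ?leq_addr// divr_ge0.
- exact: p1.
- exact: p1.
split.
  rewrite {1}(p1 _ Xl0) -/v; have -> : v ^+ 20 = (v ^+ 10) ^+ 2 by rewrite -exprM.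
  by rewrite sqrtr_sqr ger0_norm// exprn_ge0// powR_ge0.
rewrite /scale; have -> : 4 / 5 = 16%:R / 20 :> R by field.
by rewrite pw// pw.
Qed.

Lemma scale_le (l X Y : nat) : (0 < X <= Y)%N -> (Y <= 2 * X)%N -> scale l Y / Y%:R <= 2 * (scale l X / X%:R).
Proof.
move=> /andP[X0 XY] Y2.
have e (Z : nat) : (0 < Z)%N -> scale l Z / Z%:R = Z%:R `^ (- (1 / 5)) * (Z + l)%:R `^ (3 / 20) :> R.
  move=> Z0; have ZR : 0 < Z%:R :> R by rewrite ltr0n.
  rewrite /scale mulrAC; congr (_ * _).
  have -> : Z%:R^-1 = Z%:R `^ (-1) :> R by rewrite powRN powRr1 ?ltW.
  rewrite -powRD; last by apply/implyP => _; rewrite gt_eqF.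
  by congr (_ `^ _); field.
rewrite !e ?(leq_trans X0)//.
have XR : 0 < X%:R :> R by rewrite ltr0n.
have h1 : Y%:R `^ (- (1 / 5)) <= X%:R `^ (- (1 / 5)) :> R.
  rewrite !powRN lef_pV2 ?posrE ?powR_gt0 ?ltr0n ?(leq_trans X0)//.
  by apply: ge0_ler_powR; rewrite ?nnegrE ?ler0n ?ler_nat// divr_ge0.
have h2 : (Y + l)%:R `^ (3 / 20) <= 2 * (X + l)%:R `^ (3 / 20) :> R.
  apply: (@le_trans _ _ ((2 * (X + l)%:R) `^ (3 / 20))).
    apply: ge0_ler_powR; rewrite ?nnegrE ?mulr_ge0 ?ler0n ?divr_ge0//.
    by rewrite -natrM ler_nat mulnDr leq_add// leq_pmull.
  rewrite powRM//; apply: ler_wpM2r; first exact: powR_ge0.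
  by rewrite -[leRHS](powRr1 (ler0n R 2)); apply: ler_powR; rewrite ?ler1n//; lra.
apply: le_trans (ler_pM _ _ h1 h2) _; rewrite ?powR_ge0//.
by rewrite le_eqVlt; apply/orP; left; apply/eqP; ring.
Qed.

Section Bounded.
Variables (l N P B : nat) (th : R).
Hypotheses (l0 : (0 < l)%N) (PN : (P + l <= N)%N).
Hypotheses (HT : forall m, (0 < m <= N)%N -> (tau m)%:R <= th) (HH : harm R N <= th) (HB : B%:R <= th) (N2 : (N < 2 ^ B)%N).

(** The hypothesis (X + l)^3 <= X^4 reads v^3 <= u^4. Up to common factors, [F1] and [F3] are its
    seventh and fifth powers, while [F2] follows from 1 <= u <= v. *)
Lemma correlation_asymp (X : nat) : (0 < X)%N -> (4 * (X + l) < P)%N -> ((X + l) ^ 3 <= X ^ 4)%N ->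
  `|correlation l X - 64 * \sum_(1 <= n < X.+1) sing l P B (density R l) n| <= 400 * 300 * th ^+ 9 * scale l X.
Proof.
move=> X0 XP reg.
have [u [v [u1 uv Xu Zv [sv Hs]]]] := scale_facts l X0.
have th1 : 1 <= th.
  apply: le_trans (HT (m := 1) _); rewrite ?ler1n ?tau_gt0//=.
  by apply: leq_trans PN; rewrite addn_gt0 (leq_ltn_trans _ XP).
have PleN : (P <= N)%N by apply: leq_trans PN; rewrite leq_addr.
have XlP : (X + l < P)%N by apply: leq_ltn_trans XP; rewrite leq_pmull.
have vu : v ^+ 3 <= u ^+ 4.
  rewrite -(@ler_pXn2r _ 20)// ?nnegrE ?exprn_ge0//; [|lra|lra].
  have -> : (v ^+ 3) ^+ 20 = (v ^+ 20) ^+ 3 by rewrite -!exprM.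
  have -> : (u ^+ 4) ^+ 20 = (u ^+ 20) ^+ 4 by rewrite -!exprM.
  by rewrite -Xu -Zv -!natrX ler_nat.
have v1 : 1 <= v by lra.
have pu k : 1 <= u ^+ k by apply: exprn_ege1.
have pv k : 1 <= v ^+ k by apply: exprn_ege1.
have vuk k : (v ^+ 3) ^+ k <= (u ^+ 4) ^+ k.
  by apply: lerXn2r => //; rewrite nnegrE exprn_ge0//; lra.
have U0 k : 0 <= u ^+ k by apply: le_trans (pu k).
have V0 k : 0 <= v ^+ k by apply: le_trans (pv k).
have H0 : 0 < scale l X.
  by rewrite Hs mulr_gt0//; apply: lt_le_trans ltr01 _.
have F1 : Num.sqrt (X + l)%:R ^+ 3 * X%:R <= scale l X ^+ 3.
  rewrite sv Xu Hs.
  have -> : (v ^+ 10) ^+ 3 * u ^+ 20 = (u ^+ 20 * v ^+ 9) * (v ^+ 3) ^+ 7 by ring.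
  have -> : (u ^+ 16 * v ^+ 3) ^+ 3 = (u ^+ 20 * v ^+ 9) * (u ^+ 4) ^+ 7 by ring.
  by apply: ler_wpM2l => //; rewrite mulr_ge0.
have F2 : X%:R ^+ 7 <= scale l X ^+ 8.
  rewrite Xu Hs.
  have -> : (u ^+ 20) ^+ 7 = u ^+ 128 * u ^+ 12 by ring.
  have -> : (u ^+ 16 * v ^+ 3) ^+ 8 = u ^+ 128 * (v ^+ 12 * v ^+ 12) by ring.
  apply: ler_wpM2l => //; apply: (@le_trans _ _ (v ^+ 12)); first by apply: lerXn2r; rewrite ?nnegrE//; lra.
  by rewrite ler_peMr.
have F3 : Num.sqrt (X + l)%:R ^+ 3 * X%:R ^+ 3 <= scale l X ^+ 5.
  rewrite sv Xu Hs.
  have -> : (v ^+ 10) ^+ 3 * (u ^+ 20) ^+ 3 = (u ^+ 60 * v ^+ 15) * (v ^+ 3) ^+ 5 by ring.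
  have -> : (u ^+ 16 * v ^+ 3) ^+ 5 = (u ^+ 60 * v ^+ 15) * (u ^+ 4) ^+ 5 by ring.
  by apply: ler_wpM2l => //; rewrite mulr_ge0.
have sH : Num.sqrt (X + l)%:R <= scale l X.
  rewrite sv Hs.
  apply: (@le_trans _ _ (v ^+ 3 * (v ^+ 3) ^+ 3)).
    have -> : v ^+ 3 * (v ^+ 3) ^+ 3 = v ^+ 10 * v ^+ 2 by ring.
    by rewrite ler_peMr.
  apply: le_trans (ler_wpM2l (V0 3%N) (vuk 3%N)) _.
  have -> : u ^+ 16 * v ^+ 3 = v ^+ 3 * (u ^+ 4) ^+ 3 * u ^+ 4 by ring.
  by rewrite ler_peMr// mulr_ge0// exprn_ge0.
have XlN : (X + l < N)%N by apply: leq_trans PleN.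
have HT' m : (0 < m <= X + l)%N -> (tau m)%:R <= th.
  by move=> /andP[m0 mX]; apply: HT; rewrite m0 (leq_trans mX)// ltnW.
have A1 := correlation_halfsum X0 (ltn_trans XlN N2) XlP HT' HB.
have A2 := halfsum_correlation l0 X0 PleN (leq_trans XP PleN) HT HH HB H0 F1 F2 F3.
rewrite -/(correlation l X) in A1.
set hs := \sum_(1 <= n < X.+1) (halfsum B P n)%:~R * (halfsum B P (n + l))%:~R in A1 A2.
set si := \sum_(1 <= n < X.+1) sing l P B (density R l) n in A2 *.
have -> : correlation l X - 64 * si = (correlation l X - 64 * hs) + 64 * (hs - si) by ring.
apply: le_trans (ler_normD _ _) _; rewrite normrM (@ger0_norm _ 64)//.
have T2 : th ^+ 2 <= th ^+ 9 by apply: ler_weXn2l.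
have A3 : th ^+ 2 * Num.sqrt (X + l)%:R <= th ^+ 9 * scale l X.
  by apply: ler_pM => //; rewrite ?sqrtr_ge0// exprn_ge0//; lra.
have A4 : 0 <= th ^+ 9 * scale l X by rewrite mulr_ge0 ?exprn_ge0 ?(ltW H0)//; lra.
lra.
Qed.

Lemma correlation_trivial (X : nat) : (0 < X)%N -> (X + l <= N)%N -> `|correlation l X / X%:R| <= 16 * th ^+ 2.
Proof.
move=> X0 XN; have XR : 0 < X%:R :> R by rewrite ltr0n.
rewrite normrM normfV (gtr0_norm XR) ler_pdivrMr//.
apply: le_trans (ler_norm_sum _ _ _) _.
apply: (@le_trans _ _ (\sum_(1 <= n < X.+1) 16 * th ^+ 2)); last first.
  by rewrite sumr_const_nat subSS subn0 mulr_natr.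
have rb n : (0 < n <= X + l)%N -> `|(r n%:Z)%:R| <= 4 * th :> R.
  move=> /andP[n0 nX]; rewrite pmulrn r_sigma// rmorphM /= normrM ger0_norm//.
  apply: ler_wpM2l => //; apply: le_trans (sigma_le_tau R n) (HT _).
  by rewrite n0 (leq_trans nX).
apply: ler_sum_nat => n /andP[n0 nX]; rewrite normrM -PoszD.
have -> : 16 * th ^+ 2 = (4 * th) * (4 * th) by ring.
apply: ler_pM => //; apply: rb; first by rewrite n0 (leq_trans _ (leq_addr _ _)).
by rewrite addn_gt0 n0 leq_add2r.
Qed.

(** The same [P] and [B] serve X and Y, so both main terms are means of one truncated series. If (X
    + l)^3 > X^4, then [scale l X] is at least X and the trivial bound for the means is enough. *)
Lemma correlation_means (X Y : nat) : (0 < X <= Y)%N -> (Y <= 2 * X)%N -> (4 * (Y + l) < P)%N ->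
  `|correlation l X / X%:R - correlation l Y / Y%:R| <= 400 * 1000 * th ^+ 9 * (scale l X / X%:R).
Proof.
move=> /andP[X0 XY] Y2 YP; have Y0 := leq_trans X0 XY.
have th1 : 1 <= th.
  apply: le_trans (HT (m := 1) _); rewrite ?ler1n ?tau_gt0//=.
  by apply: leq_trans PN; rewrite addn_gt0 (leq_ltn_trans _ YP).
have PleN : (P <= N)%N by apply: leq_trans PN; rewrite leq_addr.
have YlN : (Y + l <= N)%N by apply: leq_trans PleN; apply: ltnW; apply: leq_ltn_trans YP; rewrite leq_pmull.
have XlN : (X + l <= N)%N by apply: leq_trans YlN; rewrite leq_add2r.
have XR : 0 < X%:R :> R by rewrite ltr0n.
have YR : 0 < Y%:R :> R by rewrite ltr0n.
have [u [v [u1 uv Xu Zv [sv Hs]]]] := scale_facts l X0.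
have T2 : th ^+ 2 <= th ^+ 9 by apply: ler_weXn2l.
have T6 : th ^+ 6 <= th ^+ 9 by apply: ler_weXn2l.
have T0 : 0 <= th ^+ 9 by rewrite exprn_ge0//; lra.
have q0 : 0 <= scale l X / X%:R by rewrite divr_ge0 ?mulr_ge0 ?powR_ge0.
have [reg|nreg] := leqP ((X + l) ^ 3) (X ^ 4); last first.
  have uv4 : u ^+ 4 <= v ^+ 3.
    rewrite -(@ler_pXn2r _ 20)// ?nnegrE ?exprn_ge0//; [|lra|lra].
    have -> : (v ^+ 3) ^+ 20 = (v ^+ 20) ^+ 3 by rewrite -!exprM.
    have -> : (u ^+ 4) ^+ 20 = (u ^+ 20) ^+ 4 by rewrite -!exprM.
    by rewrite -Xu -Zv -!natrX ler_nat ltnW.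
  have XH : 1 <= scale l X / X%:R.
    rewrite ler_pdivlMr// mul1r Hs Xu.
    have -> : u ^+ 20 = u ^+ 16 * u ^+ 4 by ring.
    by apply: ler_wpM2l => //; rewrite exprn_ge0//; lra.
  apply: le_trans (ler_normB _ _) _.
  have := correlation_trivial X0 XlN; have := correlation_trivial Y0 YlN.
  have : th ^+ 9 * 1 <= th ^+ 9 * (scale l X / X%:R) by apply: ler_wpM2l.
  lra.
(* The condition passes from X to Y because (Y + l) / Y <= (X + l) / X. *)
have regY : ((Y + l) ^ 3 <= Y ^ 4)%N.
  rewrite -(@leq_pmul2r (X ^ 3)) ?expn_gt0 ?X0//.
  have h1 : ((Y + l) * X <= Y * (X + l))%N by rewrite mulnDl mulnDr leq_add2l mulnC leq_mul2r XY orbT.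
  have h2 : (((Y + l) * X) ^ 3 <= (Y * (X + l)) ^ 3)%N by rewrite leq_exp2r.
  rewrite -expnMn; apply: leq_trans h2 _; rewrite expnMn [(Y ^ 4)%N]expnSr -mulnA leq_mul2l; apply/orP; right.
  apply: leq_trans reg _; rewrite expnS leq_mul2r XY orbT//.
have XP : (4 * (X + l) < P)%N by apply: leq_ltn_trans YP; rewrite leq_mul2l leq_add2r XY orbT.
have A1 := correlation_asymp X0 XP reg; have A2 := correlation_asymp Y0 YP regY.
have HH' : harm R P <= th by apply: le_trans HH; apply: harm_le.
have HT' m : (0 < m <= P + l)%N -> (tau m)%:R <= th.
  by move=> /andP[m0 mP]; apply: HT; rewrite m0 (leq_trans mP).
have A3 := @mean_sing R l P B th (density R l) l0 HT' HH' HB (density_ge0 R l)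
  (fun b c => density_small R l (or_introl (leqnn b))) (fun b c => density_small R l (or_intror (leqnn c))) X Y.
rewrite X0 XY in A3; have {}A3 := A3 isT.
set sX := \sum_(1 <= n < X.+1) sing _ _ _ _ n in A1 A3.
set sY := \sum_(1 <= n < Y.+1) sing _ _ _ _ n in A2 A3.
have E : correlation l X / X%:R - correlation l Y / Y%:R
  = (correlation l X - 64 * sX) / X%:R - (correlation l Y - 64 * sY) / Y%:R + 64 * (sX / X%:R - sY / Y%:R) by ring.
rewrite E; apply: le_trans (ler_normD _ _) _; apply: le_trans (lerD (ler_normB _ _) (lexx _)) _.
rewrite !normrM !normfV (gtr0_norm XR) (gtr0_norm YR) (@ger0_norm _ 64)//.
have B1 : `|correlation l X - 64 * sX| / X%:R <= 400 * 300 * th ^+ 9 * (scale l X / X%:R).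
  by rewrite mulrA; apply: ler_wpM2r => //; rewrite invr_ge0 ltW.
have B2 : `|correlation l Y - 64 * sY| / Y%:R <= 400 * 300 * th ^+ 9 * (scale l Y / Y%:R).
  by rewrite mulrA; apply: ler_wpM2r => //; rewrite invr_ge0 ltW.
have B3 : 400 * 300 * th ^+ 9 * (scale l Y / Y%:R) <= 400 * 300 * th ^+ 9 * (2 * (scale l X / X%:R)).
  apply: ler_wpM2l; first lra.
  by apply: scale_le => //; rewrite X0.
have B4 : th ^+ 6 / Num.sqrt X%:R <= th ^+ 9 * (scale l X / X%:R).
  apply: ler_pM => //; rewrite ?invr_ge0 ?sqrtr_ge0// ?exprn_ge0 ?(le_trans ler01)//.
  have s0 : 0 < Num.sqrt X%:R :> R by rewrite sqrtr_gt0.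
  rewrite -[leLHS]mul1r ler_pdivrMr// mulrAC ler_pdivlMr// mul1r.
  rewrite -[leLHS](sqr_sqrtr (ltW XR)) expr2; apply: ler_wpM2r; first exact: ltW.
  have sX' : Num.sqrt X%:R = u ^+ 10 :> R.
    rewrite Xu; have -> : u ^+ 20 = (u ^+ 10) ^+ 2 by rewrite -exprM.
    by rewrite sqrtr_sqr ger0_norm// exprn_ge0// (le_trans ler01).
  rewrite sX' Hs.
  have -> : u ^+ 16 * v ^+ 3 = u ^+ 10 * (u ^+ 6 * v ^+ 3) by ring.
  rewrite ler_peMr// ?exprn_ge0 ?(le_trans ler01)//.
  have p6 : 1 <= u ^+ 6 by apply: exprn_ege1.
  have p3 : 1 <= v ^+ 3 by apply: exprn_ege1; exact: le_trans uv.
  by rewrite -[leLHS]mulr1; apply: ler_pM.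
have q9 : 0 <= th ^+ 9 * (scale l X / X%:R) by rewrite mulr_ge0.
lra.
Qed.
End Bounded.

Theorem correlation_doubling (eps : R) : 0 < eps -> exists C : R, forall l X Y : nat, (0 < l)%N -> (0 < X <= Y)%N -> (Y <= 2 * X)%N ->
  `|correlation l X / X%:R - correlation l Y / Y%:R| <= C * (X%:R `^ (- (1 / 5)) * (X + l)%:R `^ (3 / 20 + eps)).
Proof.
move=> e0; have e9 : 0 < eps / 9 by rewrite divr_gt0.
have [M M1 HM] := uniform_divisor_bound e9.
exists (400 * 1000 * M ^+ 9 * 16 `^ eps) => l X Y l0 XY Y2.
have /andP[X0 XY'] := XY.
(* P exceeds 4 (Y + l), a bound for all moduli q, and [mean_sing] asks for divisor bounds up to P +
   l. As Y <= 2 X, this stays within 16 (X + l). *)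
pose P := (4 * (Y + l)).+1; pose N := (P + l)%N.
have N16 : (N <= 16 * (X + l))%N by move: Y2 X0 l0; rewrite /N /P; clear; lia.
have [B [NB BM hM tM]] := HM N isT.
have := @correlation_means l N P B _ l0 (leqnn _) tM hM BM NB X Y XY Y2 (leqnn _).
move/le_trans; apply.
have ZR : 0 < (X + l)%:R :> R by rewrite ltr0n addn_gt0 X0.
have XR : 0 < X%:R :> R by rewrite ltr0n.
have E : (M * N%:R `^ (eps / 9)) ^+ 9 = M ^+ 9 * N%:R `^ eps.
  rewrite exprMn; congr (_ * _); rewrite -powR_mulrn ?powR_ge0// -powRrM.
  by congr (_ `^ _); field.
have N1 : N%:R `^ eps <= 16 `^ eps * (X + l)%:R `^ eps :> R.
  rewrite -powRM//; apply: ge0_ler_powR; rewrite ?nnegrE ?mulr_ge0 ?ler0n ?(ltW e0)//.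
  by rewrite -natrM ler_nat.
have SE : scale l X / X%:R = X%:R `^ (- (1 / 5)) * (X + l)%:R `^ (3 / 20) :> R.
  rewrite /scale mulrAC; congr (_ * _).
  have -> : X%:R^-1 = X%:R `^ (-1) :> R by rewrite powRN powRr1 ?ltW.
  rewrite -powRD; last by apply/implyP => _; rewrite gt_eqF.
  by congr (_ `^ _); field.
rewrite E SE powRD; last by apply/implyP => _; rewrite gt_eqF.
set a := X%:R `^ _; set b := (X + l)%:R `^ (3 / 20); set w := (X + l)%:R `^ eps in N1 *.
have a0 : 0 <= a by apply: powR_ge0.
have b0 : 0 <= b by apply: powR_ge0.
have -> : 400 * 1000 * M ^+ 9 * 16 `^ eps * (a * (b * w)) = 400 * 1000 * M ^+ 9 * (a * b) * (16 `^ eps * w) by ring.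
have -> : 400 * 1000 * (M ^+ 9 * N%:R `^ eps) * (a * b) = 400 * 1000 * M ^+ 9 * (a * b) * N%:R `^ eps by ring.
apply: ler_wpM2l; last exact: N1.
apply: mulr_ge0; last by apply: mulr_ge0.
apply: mulr_ge0; first by rewrite mulr_ge0 ?ler0n.
by apply: exprn_ge0; lra.
Qed.

(** The case X = 1 bounds the constant c l, whose growth with l matters when a real X is replaced by
    its integer part. *)
Lemma correlation_one (eps : R) : 0 < eps -> exists2 C, 0 <= C & forall l : nat, (0 < l)%N ->
  `|correlation l 1| <= C * (1 + l)%:R `^ eps.
Proof.
move=> e0; have [M M1 HM] := divisor_bound e0.
exists (16 * M) => [|l l0]; first by rewrite mulr_ge0//; lra.
have rb n : (0 < n)%N -> `|(r n%:Z)%:R| <= 4 * (tau n)%:R :> R.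
  move=> n0; rewrite pmulrn r_sigma// rmorphM /= normrM ger0_norm//.
  by apply: ler_wpM2l => //; exact: sigma_le_tau.
rewrite /correlation big_nat1 normrM -PoszD.
have -> : 16 * M * (1 + l)%:R `^ eps = (4 * 1) * (4 * (M * (1 + l)%:R `^ eps)) by ring.
apply: ler_pM => //; first exact: rb.
by apply: le_trans (rb _ _) _ => //; apply: ler_wpM2l => //; exact: HM.
Qed.
End Core.

Theorem theorem1p4 (R : realType) :
  exists c : nat -> R,
    forall eps : R, 0 < eps ->
    exists C : R,
      forall (l : nat) (X : R), (1 <= l)%N -> 1 <= X ->
        `| \sum_(1 <= n < (Num.truncn X).+1)
             (r n%:Z)%:R * (r (n%:Z + l%:Z))%:R - c l * X |
        <= C * (X `^ (4 / 5) * (X + l%:R) `^ (3 / 20 + eps)).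
Proof.
have [c Hc] := limit_of_doubling (@correlation_doubling R).
exists c => eps e0.
(* Larger eps reduce to 1/40, because X + l is at least 1 and its powers increase with the
   exponent. *)
pose e := Num.min eps (1 / 40).
have e01 : 0 < e <= 1 / 40 by rewrite lt_min e0 ge_min lexx orbT divr_gt0.
have ee : e <= eps by rewrite ge_min lexx.
have /andP[e00 _] := e01.
have [C C0 HC] := Hc e e01.
have [D D0 HD] := @correlation_one R e e00.
exists (2 * C + D) => l X l1 X1.
have X0 : 0 <= X by lra.
have /andP[n1 n2] := truncn_itv X0.
set n := Num.truncn X in n1 n2 *.
have n0 : (0 < n)%N.
  by rewrite lt0n; apply: contraTneq n2 => ->; rewrite -leNgt.
have nR : 0 < n%:R :> R by rewrite ltr0n.
have X45 : 1 <= X `^ (4 / 5).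
  by rewrite -[leLHS](powRr0 X); apply: ler_powR => //; rewrite divr_ge0.
have lR : 0 <= l%:R :> R by apply: ler0n.
have Z1 : 1 <= X + l%:R by lra.
have base (a : R) : 0 <= a -> a <= X + l%:R -> a `^ (3 / 20 + e) <= (X + l%:R) `^ (3 / 20 + eps).
  move=> a0 aX; apply: (@le_trans _ _ ((X + l%:R) `^ (3 / 20 + e))); last by apply: ler_powR => //; lra.
  by apply: ge0_ler_powR; rewrite ?nnegrE//; lra.
set T := X `^ (4 / 5) * (X + l%:R) `^ (3 / 20 + eps).
have Zp : 0 <= (X + l%:R) `^ (3 / 20 + eps) by apply: powR_ge0.
have ZT : (X + l%:R) `^ (3 / 20 + eps) <= T by rewrite ler_peMl.
have S1 : `|correlation R l n - c l * n%:R| <= C * T.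
  have -> : correlation R l n - c l * n%:R = n%:R * (correlation R l n / n%:R - c l) by field; rewrite gt_eqF.
  rewrite normrM gtr0_norm//; apply: le_trans (ler_wpM2l (ltW nR) (HC l n l1 n0)) _.
  rewrite mulrCA; apply: ler_wpM2l => //; rewrite mulrA; apply: ler_pM; rewrite ?mulr_ge0 ?powR_ge0//.
    rewrite -[leLHS]/(n%:R * n%:R `^ (- (1 / 5))).
    have -> : n%:R * n%:R `^ (- (1 / 5)) = n%:R `^ 1 * n%:R `^ (- (1 / 5)) :> R by rewrite powRr1 ?ltW.
    rewrite -powRD; last by apply/implyP => _; rewrite gt_eqF.
    have -> : 1 - 1 / 5 = 4 / 5 :> R by field.
    by apply: ge0_ler_powR; rewrite ?nnegrE// divr_ge0.
  by apply: base => //; rewrite natrD lerD2r.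
have S2 : `|c l| <= (C + D) * T.
  have K1 := HC l 1%N l1 isT; have K2 := HD l l1.
  rewrite divr1 powR1 mul1r in K1.
  have -> : c l = correlation R l 1 - (correlation R l 1 - c l) by ring.
  apply: le_trans (ler_normB _ _) _.
  have b1 : (1 + l)%:R `^ (3 / 20 + e) <= T.
    by apply: le_trans ZT; apply: base => //; rewrite natrD lerD2r.
  have b2 : (1 + l)%:R `^ e <= T.
    apply: le_trans b1; apply: ler_powR; first by rewrite ler1n.
    by rewrite lerDr divr_ge0.
  have := ler_wpM2l C0 b1; have := ler_wpM2l D0 b2; lra.
rewrite -/(correlation R l n).
have -> : correlation R l n - c l * X = (correlation R l n - c l * n%:R) - c l * (X - n%:R) by ring.
apply: le_trans (ler_normB _ _) _; rewrite normrM.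
have f0 : 0 <= X - n%:R by rewrite subr_ge0.
have f1 : X - n%:R <= 1 by rewrite -natr1 in n2; lra.
rewrite (ger0_norm f0).
have : `|c l| * (X - n%:R) <= `|c l| * 1 by apply: ler_wpM2l.
lra.
Qed.
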